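(* Let $a\in\mathbb{R}$ and suppose that $\{\lambda_i,\varphi_i(a)\}_{i=1}^N$ is the interior spectral data at $a$ of some pair $(\omega,v)$, and that $\alpha\ne0$. Assume that $\lambda_{j_0}<0<\lambda_{j_0+1}$ for some $j_0\in\{1,\dots,N-1\}$. If there are exactly $k\ge1$ indices $i$ with $\varphi_i(a)=0$, then infinitely many pairs $(\omega,v)$ yield the given interior spectral data $\{\lambda_i,\varphi_i(a)\}_{i=1}^N$ at $a$. Moreover: (i) if $\varphi_1(a)=0$ and $\varphi_N(a)=0$, then $\mathcal{F}$ is a connected manifold of dimension $k$; (ii) if exactly one of $\varphi_1(a)$, $\varphi_N(a)$ is zero, then $\mathcal{F}$ is a collection of 2 disjoint manifolds, each of dimension $k$; (iii) if $\varphi_1(a)\ne0$ and $\varphi_N(a)\ne0$, then $\mathcal{F}$ is a collection of 4 disjoint manifolds, each of dimension $k$.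
   Context: A pair $(\omega,v)$ means: for some $n\in\mathbb{N}$, $n\ge 1$, and real points $x_1<\dots<x_n$, $\omega=\sum_{i=1}^n\omega_i\delta_{x_i}$ and $v=\sum_{i=1}^n v_i\delta_{x_i}$ with $\omega_i\in\mathbb{R}$, $v_i\ge 0$ and $|\omega_i|+v_i>0$ ($\delta_x$ is the Dirac measure at $x$). The number $n$, the points and the weights may differ from pair to pair. For $z\in\mathbb{C}$ consider $-f''+\frac14 f=z\omega f+z^2vf$ on $\mathbb{R}$, meaning: $f$ is continuous, $-f''+\frac14 f=0$ on $\mathbb{R}\setminus\{x_1,\dots,x_n\}$, and $f'(x_i-)=f'(x_i+)+z\omega_if(x_i)+z^2v_if(x_i)$ for every $i$. An eigenvalue is a $z$ for which there is a nontrivial bounded solution. The eigenvalues form a finite set of nonzero real numbers $\lambda_1<\dots<\lambda_N$. For $z\in\mathbb{C}$, $\phi_\pm(z,\cdot)$ are the solutions with $\phi_\pm(z,x)=e^{\mp x/2}$ for all $x$ near $\pm\infty$. For an eigenvalue $\lambda$ put $\gamma_\lambda^2:=\int_{\mathbb{R}}|\phi_+(\lambda,x)|^2d\omega(x)+2\lambda\int_{\mathbb{R}}|\phi_+(\lambda,x)|^2dv(x)$; one has $\lambda\gamma_\lambda^2>0$. The normalized eigenfunctions are $\varphi_i(x)=\phi_+(\lambda_i,x)/\sqrt{\lambda_i\gamma_{\lambda_i}^2}$. For $a\in\mathbb{R}$, the family $\{\lambda_i,\varphi_i(a)\}_{i=1}^N$ is called the interior spectral data of $(\omega,v)$ at $a$.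 Put $\alpha:=1-\sum_{i=1}^N|\varphi_i(a)|^2$. The spectral data of a pair is the vector $(\lambda_1,\dots,\lambda_N,\lambda_1\gamma_{\lambda_1}^2,\dots,\lambda_N\gamma_{\lambda_N}^2)\in\mathbb{R}^{2N}$. For given interior spectral data at $a$, $\mathcal{F}\subset\mathbb{R}^{2N}$ denotes the set of spectral data of all pairs whose interior spectral data at $a$ is the given one. ''A collection of $m$ disjoint manifolds, each of dimension $k$'' means that the set has exactly $m$ connected components, each a manifold of dimension $k$. *)

(* Defs.v *)
From HB Require Import structures.
From mathcomp Require Import all_boot all_order all_algebra.
From mathcomp Require Import complex.
From mathcomp Require Import all_classical all_reals all_analysis.
Set Implicit Arguments.
Unset Strict Implicit.
Unset Printing Implicit Defensive.
Import Order.TTheory GRing.Theory Num.Theory.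
Import numFieldNormedType.Exports.
Local Open Scope classical_set_scope.
Local Open Scope ring_scope.
Local Open Scope complex_scope.

(* A node (x_i, omega_i, v_i) stands for the Dirac masses omega_i * delta_(x_i)
   of omega and v_i * delta_(x_i) of v. *)
Notation node R := (R * R * R)%type.
Definition pos {R : realType} (m : node R) : R := m.1.1.
Definition wgt {R : realType} (m : node R) : R := m.1.2.
Definition dip {R : realType} (m : node R) : R := m.2.

(* A pair (omega, v). Since the positions increase strictly and no node carries
   two zero masses, the list of nodes is determined by the two measures. *)
Record mpair (R : realType) := MPair {
  nodes : seq (node R) ;
  nodes_nonempty : (0 < size nodes)%N ;
  nodes_sorted : sorted (fun m m' => pos m < pos m') nodes ;
  nodes_mass : all (fun m => (0 <= dip m) && (0 < `|wgt m| + dip m)) nodes }.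

Section ComplexValued.
Context {R : realType}.
Implicit Types (f : R -> R[i]) (l : R[i]) (x : R).

(* Limits, continuity and derivatives of functions R -> C, taken on real and
   imaginary parts. *)
Definition Ccvg (F : set_system R) f l : Prop :=
  (complex.Re (f y) @[y --> F] --> complex.Re l) /\
  (complex.Im (f y) @[y --> F] --> complex.Im l).

Definition Ccontinuous f : Prop := forall x, Ccvg (nbhs x) f (f x).

Definition Cis_derive x f l : Prop :=
  is_derive x 1 (fun y => complex.Re (f y)) (complex.Re l) /\
  is_derive x 1 (fun y => complex.Im (f y)) (complex.Im l).

End ComplexValued.

Section Spectral.
Context {R : realType}.
Implicit Types (p : mpair R) (z : R[i]) (f : R -> R[i]) (a lambda : R).

(* f' below is the classical derivative off the support; its values at the
   support are irrelevant, only its one-sided limits there matter. *)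
Definition solution p z f : Prop :=
  Ccontinuous f /\
  exists f' : R -> R[i],
    (forall x, x \notin map pos (nodes p) ->
       Cis_derive x f (f' x) /\
       exists2 f'' : R[i], Cis_derive x f' f'' & - f'' + 4^-1 * f x = 0) /\
    (forall m, m \in nodes p ->
       exists dl dr : R[i],
         [/\ Ccvg ((pos m)^'-) f' dl, Ccvg ((pos m)^'+) f' dr &
             dl = dr + z * (wgt m)%:C * f (pos m)
                     + z ^+ 2 * (dip m)%:C * f (pos m)]).

Definition eigenvalue p z : Prop :=
  exists f, [/\ solution p z f, exists x, f x <> 0 &
                exists M : R, forall x, Normc.normc (f x) <= M].

(* The solution is unique when it exists, so the choice is immaterial. *)
Definition phi_plus p z : R -> R[i] :=
  xget (fun=> 0) [set f | solution p z f /\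
                          \forall x \near +oo, f x = (expR (- x / 2))%:C].

(* The integrals against omega and v are finite sums over the nodes. *)
Definition gamma2 p lambda : R :=
  \sum_(m <- nodes p) Normc.normc (phi_plus p lambda%:C (pos m)) ^+ 2 * wgt m
  + 2 * lambda *
    \sum_(m <- nodes p) Normc.normc (phi_plus p lambda%:C (pos m)) ^+ 2 * dip m.

Definition eigenvalues p (N : nat) (lam : 'I_N -> R) : Prop :=
  (forall i j : 'I_N, (i < j)%N -> lam i < lam j) /\
  [set z | eigenvalue p z] = [set (lam i)%:C | i in [set: 'I_N]].

Definition eigenfunction p lambda (x : R) : R[i] :=
  phi_plus p lambda%:C x / (Num.sqrt (lambda * gamma2 p lambda))%:C.

Definition interior_data p a (N : nat) (lam : 'I_N -> R) (u : 'I_N -> R[i]) :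
    Prop :=
  eigenvalues p lam /\ forall i, u i = eigenfunction p (lam i) a.

Definition spectral_data p (N : nat) (s : 'rV[R]_(N + N)) : Prop :=
  let lam i := lsubmx s 0 i in
  eigenvalues p lam /\ forall i, rsubmx s 0 i = lam i * gamma2 p (lam i).

Definition spectral_set a (N : nat) (lam : 'I_N -> R) (u : 'I_N -> R[i]) :
    set 'rV[R]_(N + N) :=
  [set s | exists2 p, interior_data p a lam u & spectral_data p s].

(* A topological manifold of dimension k: locally homeomorphic to an open set of
   R^k. Subsets of R^d are automatically Hausdorff and second countable. *)
Definition manifold (d k : nat) (M : set 'rV[R]_d) : Prop :=
  forall x, M x ->
  exists (U : set 'rV[R]_d) (V : set 'rV[R]_k)
         (h : 'rV[R]_d -> 'rV[R]_k) (g : 'rV[R]_k -> 'rV[R]_d),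
    [/\ open U, U x & open V] /\
    [/\ {homo h : y / (M `&` U) y >-> V y},
        {homo g : y / V y >-> (M `&` U) y},
        (forall y, (M `&` U) y -> g (h y) = y) &
        (forall y, V y -> h (g y) = y)] /\
    {within M `&` U, continuous h} /\ {within V, continuous g}.

(* Exactly c connected components, each a manifold of dimension k. *)
Definition disjoint_manifolds (c d k : nat) (M : set 'rV[R]_d) : Prop :=
  (connected_component M @` M #= `I_c)%card /\
  forall x, M x -> manifold k (connected_component M x).

End Spectral.

(* Main.v *)
Require Import Defs.
From HB Require Import structures.
From mathcomp Require Import all_boot all_order all_algebra.
From mathcomp Require Import complex ring lra.
From mathcomp Require Import all_classical all_reals all_analysis.
Import Order.TTheory GRing.Theory Num.Theory.
Import numFieldNormedType.Exports.
Set Implicit Arguments.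
Unset Strict Implicit.
Unset Printing Implicit Defensive.
Local Open Scope classical_set_scope.
Local Open Scope ring_scope.
Local Open Scope complex_scope.

(** Fix [a], write [r_i] for the value at [a] of the i-th normalized eigenfunction
    and [G = phi_+ phi_- / W] for the diagonal Green function at [a], where [phi_+]
    and [phi_-] decay at the right and left end and [W] is their Wronskian, so
    that the eigenvalues are the zeros of [W].

    All these are polynomials in [z]. Between the nodes a solution is
    [al e^(x/2) + be e^(-x/2)], and a node acts on [(al, be)] by a matrix whose
    entries are polynomials in [z]; [W] is the final [be] of [phi_+]. Differentiating
    the product of the matrices expresses the norming constants through [W'], and
    partial fractions give
    [G = alpha + sum_i r_i^2 lam_i / (lam_i - z)], with [alpha = 1 - sum_i r_i^2].
    So the data determine [W] and [G], hence the product [phi_+ phi_-]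
    ([eigenvalues_charpoly], [product_green]). If [alpha] is not zero,
    then [a] is not a node and [alpha] is positive ([green_degree], [green_pos]).

    The function [z G] is Herglotz, so its zeros are real and simple and are
    separated by its poles, the active eigenvalues, those with [r_i <> 0]
    ([green_zeros], [pole_between_zeros]). Passing from [(omega, v)] to its
    restrictions to the two sides of [a] amounts to splitting the masses of the
    Herglotz function [- 1 / (z G)] at the zeros other than [0] into two parts. At a zero that
    is not an eigenvalue exactly one of [phi_+], [phi_-] vanishes, and it takes the
    whole mass. At an inactive eigenvalue both vanish; the mass may be split in any
    proportion, and the proportion corresponds to the norming constant of that
    eigenvalue, which takes every positive value. Every splitting occurs because the
    half line problem is solvable: the positions and masses of the nodes are read
    off a continued fraction ([inverse_half], [pair_of_normings]).

    What is left to choose is thus which zeros belong to [phi_+]. The sign of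
    [phi_+] at the active eigenvalues is that of [r_i]. Since there is only one zero
    between two neighbouring active eigenvalues, two choices giving the same signs
    differ at most by zeros lying beyond all active eigenvalues on one side
    ([valid_symdiff]). There is such a zero below all of them exactly when the
    lowest eigenvalue is active, and one above exactly when the highest one is
    ([card_outer]); this uses that both signs occur among the eigenvalues. Hence
    there are 1, 2 or 4 choices.

    For a given choice the norming constants at the active eigenvalues are forced,
    being [phi_+^2 / r_i^2], and the others are free positive numbers, so the
    choice contributes a product of points and open half lines. Different choices
    force different constants, by interpolation ([kappa_inj]), and so give disjoint
    pieces; each piece is a connected component because the forced entries take
    only finitely many values ([component_box]). *)

(** * Partial fractions with residues of one sign *)

Section PartialFractions.
Context {R : rcfType}.
Implicit Types (f K : {poly R}) (rs : seq R).

(** Factor over the complex numbers and take real parts of the roots. *)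
Lemma real_rooted_splits f : f != 0 ->
  (forall z : R[i], root (map_poly (real_complex R) f) z -> complex.Im z = 0) ->
  exists rs, f = lead_coef f *: \prod_(s <- rs) ('X - s%:P).
Proof.
move=> f0 Hr.
have [zs Hzs] := closed_field_poly_normal (map_poly (real_complex R) f).
exists (map (@complex.Re R) zs).
apply: (@map_poly_inj _ _ (real_complex R)).
rewrite Hzs map_polyZ /= lead_coef_map /=.
congr (_ *: _); rewrite rmorph_prod big_map /=.
rewrite big_seq [RHS]big_seq; apply: eq_bigr => z zin.
rewrite rmorphB /= map_polyX map_polyC /=; congr (_ - _%:P).
have : complex.Im z = 0.
  apply: Hr; rewrite Hzs rootZ ?root_prod_XsubC //.
  by rewrite lead_coef_eq0 map_poly_eq0.
by case: z {zin} => x y /= ->.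
Qed.

(** The residues of [- K / f] at the zeros of [f], all real and simple, are
    positive: this is what makes [K / f] a Herglotz function up to a polynomial,
    and it depends only on [K] modulo [f]. *)
Definition herglotz_residues K f : Prop :=
  exists rs, [/\ uniq rs, f = lead_coef f *: \prod_(s <- rs) ('X - s%:P),
    f != 0 & forall s, s \in rs -> K.[s] * f^`().[s] < 0].

Lemma size_split f rs : f != 0 -> f = lead_coef f *: \prod_(s <- rs) ('X - s%:P) ->
  size f = (size rs).+1.
Proof.
by move=> f0 ->; rewrite size_scale ?lead_coef_eq0 // size_prod_XsubC.
Qed.

Lemma root_split f rs s : f != 0 ->
  f = lead_coef f *: \prod_(s <- rs) ('X - s%:P) -> root f s = (s \in rs).
Proof.
by move=> f0 ->; rewrite rootZ ?lead_coef_eq0 // root_prod_XsubC.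
Qed.

Lemma deriv_at_root f s : root f s -> f^`().[s] = (f %/ ('X - s%:P)).[s].
Proof.
rewrite -dvdp_XsubCl => /divpK {1}<-.
by rewrite derivM !hornerE derivXsubC !hornerE subrr mulr0 add0r.
Qed.

Lemma sum_gt0 (a : R) rs (h : R -> R) : 0 <= a -> (0 < a) || (0 < size rs)%N ->
  (forall s, s \in rs -> 0 < h s) -> 0 < a + \sum_(s <- rs) h s.
Proof.
move=> a0 /orP nt h0; case: nt => [ap|rs0].
  by rewrite ltr_wpDr // big_seq sumr_ge0 // => s /h0/ltW.
rewrite ltr_wpDl //; case: rs rs0 h0 => // s0 rs _ h0.
rewrite big_cons ltr_wpDr ?h0 ?mem_head // big_seq sumr_ge0 // => s sr.
by rewrite ltW // h0 // inE sr orbT.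
Qed.

Lemma lagrange f rs K : uniq rs -> f != 0 ->
  f = lead_coef f *: \prod_(s <- rs) ('X - s%:P) -> (size K < size f)%N ->
  (forall s, s \in rs -> f^`().[s] != 0) ->
  K = \sum_(s <- rs) (K.[s] / f^`().[s]) *: (f %/ ('X - s%:P)).
Proof.
move=> urs f0 fE sK fd; apply/eqP; rewrite -subr_eq0.
rewrite (size_split f0 fE) ltnS in sK.
set S := \sum_(s <- rs) _.
have sS : (size S <= size rs)%N.
  rewrite /S big_seq; apply: (big_ind (fun p : {poly R} => (size p <= size rs)%N)).
  - by rewrite size_poly0.
  - by move=> p q sp sq; rewrite (leq_trans (size_polyD _ _)) // geq_max sp.
  - move=> s sin; rewrite (leq_trans (size_scale_leq _ _)) //.
    by rewrite size_divp ?polyXsubC_eq0 // size_XsubC (size_split f0 fE) subn1.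
apply/eqP; apply: (@roots_geq_poly_eq0 _ _ rs) => //; last first.
  by rewrite (leq_trans (size_polyD _ _)) // size_polyN geq_max sK.
apply/allP => t tin; rewrite rootE hornerD hornerN /S.
have rt : root f t by rewrite (root_split _ f0 fE).
rewrite horner_sum (bigD1_seq t) //= hornerZ -deriv_at_root // divfK ?fd //.
rewrite big_seq_cond big1 ?addr0 ?subrr // => s /andP[sin st].
have rs' : root f s by rewrite (root_split _ f0 fE).
have := rt; rewrite rootE -{1}(divpK (p := f) (d := 'X - s%:P)) ?dvdp_XsubCl //.
rewrite hornerM !hornerE mulf_eq0 subr_eq0 [t == s]eq_sym (negPf st) orbF.
by move/eqP->; rewrite mulr0.
Qed.

Section Herglotz.
Variables (f K K0 : {poly R}) (rs : seq R) (a b : R).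
Hypotheses (urs : uniq rs) (f0 : f != 0)
  (fE : f = lead_coef f *: \prod_(s <- rs) ('X - s%:P))
  (Kneg : forall s, s \in rs -> K.[s] * f^`().[s] < 0)
  (KE : K = (a *: 'X + b%:P) * f + K0) (sK0 : (size K0 < size f)%N).

Definition residue (s : R) : R := - (K.[s] / f^`().[s]).

Lemma root_f s : (s \in rs) = root f s.
Proof. by rewrite (root_split _ f0 fE). Qed.

Lemma fd_neq0 s : s \in rs -> f^`().[s] != 0.
Proof. by move=> /Kneg; apply: contraTneq => ->; rewrite mulr0 ltxx. Qed.

Lemma residue_gt0 s : s \in rs -> 0 < residue s.
Proof.
move=> sin; rewrite /residue oppr_gt0.
have -> : K.[s] / f^`().[s] = (K.[s] * f^`().[s]) / f^`().[s] ^+ 2.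
  by field; exact: fd_neq0.
by rewrite pmulr_llt0 ?Kneg // invr_gt0 exprn_even_gt0 //= fd_neq0.
Qed.

Lemma partial_fraction :
  K = (a *: 'X + b%:P) * f - \sum_(s <- rs) residue s *: (f %/ ('X - s%:P)).
Proof.
rewrite {1}KE; congr (_ + _); rewrite {1}(lagrange urs f0 fE sK0 fd_neq0).
rewrite -sumrN big_seq [RHS]big_seq; apply: eq_bigr => s sin.
rewrite -scaleNr opprK KE hornerD hornerM.
by have := sin; rewrite root_f => /rootP ->; rewrite mulr0 add0r.
Qed.

(** [K0 / f] behaves at infinity like minus the sum of the residues over [z]. *)
Lemma partial_fraction_coef : (1 < size f)%N ->
  K0`_(size f).-2 = - (lead_coef f * \sum_(s <- rs) residue s).
Proof.
move=> sf; have -> : K0 = - \sum_(s <- rs) residue s *: (f %/ ('X - s%:P)).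
  by apply: (addrI ((a *: 'X + b%:P) * f)); rewrite -KE partial_fraction.
rewrite coefN coef_sum mulr_sumr; congr (- _).
rewrite big_seq [RHS]big_seq; apply: eq_bigr => s sin.
rewrite coefZ mulrC; congr (_ * _).
have dv : ('X - s%:P) %| f by rewrite dvdp_XsubCl -root_f.
rewrite [RHS](_ : _ = lead_coef (f %/ ('X - s%:P))).
  by rewrite /lead_coef size_divp ?polyXsubC_eq0 // size_XsubC subn1.
by rewrite -{1}(divpK dv) lead_coef_Mmonic ?monicXsubC.
Qed.

Lemma partial_fraction_lead : (1 < size f)%N ->
  K0`_(size f).-2 * lead_coef f < 0.
Proof.
move=> sf; rewrite partial_fraction_coef // mulNr oppr_lt0.
rewrite mulrAC -expr2 mulr_gt0 ?exprn_even_gt0 ?lead_coef_eq0 //.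
rewrite -[X in 0 < X]add0r; apply: sum_gt0 residue_gt0 => //.
by move: sf; rewrite (size_split f0 fE) ltnS => ->; rewrite orbT.
Qed.

Section Evaluation.
Variables (L : fieldType) (iota : {rmorphism R -> L}).

Lemma eval_divX (s : R) (t : L) : s \in rs ->
  (map_poly iota f).[t] = (map_poly iota (f %/ ('X - s%:P))).[t] * (t - iota s).
Proof.
rewrite root_f -dvdp_XsubCl => /divpK {1}<-.
by rewrite rmorphM /= rmorphB /= map_polyX map_polyC /= !hornerE.
Qed.

Lemma eval_partial_fraction (t : L) : (map_poly iota f).[t] != 0 ->
  (map_poly iota K).[t] = (map_poly iota f).[t] *
    (iota a * t + iota b + \sum_(s <- rs) iota (residue s) / (iota s - t)).
Proof.
move=> ft; rewrite {1}partial_fraction rmorphB rmorphM rmorphD /=.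
rewrite map_polyZ map_polyX map_polyC raddf_sum /= !hornerE mulrDr.
rewrite [X in X + _]mulrC; congr (_ + _).
rewrite horner_sum mulr_sumr -sumrN big_seq [RHS]big_seq.
apply: eq_bigr => s sin; rewrite map_polyZ hornerZ [in RHS](eval_divX _ sin).
have ts : t - iota s != 0.
  by move: ft; rewrite (eval_divX t sin) mulf_eq0 => /norP[].
by field; rewrite -opprB oppr_eq0.
Qed.

Lemma root_K_f (t : L) : (forall r : R, t = iota r -> r \in rs -> False) ->
  (map_poly iota f).[t] != 0.
Proof.
move=> nt; rewrite fE -mul_polyC rmorphM /= map_polyC rmorph_prod /= !hornerE.
rewrite mulf_neq0 ?fmorph_eq0 ?lead_coef_eq0 // horner_prod.
rewrite prodf_seq_neq0; apply/allP => s sin /=.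
rewrite rmorphB /= map_polyX map_polyC /= !hornerE subr_eq0.
by apply/eqP => ts; apply: (nt s).
Qed.

Lemma K_root_not_pole (r : R) : r \in rs -> ~~ root K r.
Proof. by move=> /Kneg; apply: contraTN => /rootP ->; rewrite mul0r ltxx. Qed.

(** Subtracting the values of the partial fraction at two zeros: the quotient
    by [t' - t] is a positive combination of the [1 / ((s - t) (s - t'))], so
    it vanishes only if these are not all positive. *)
Lemma two_roots (t t' : L) :
  root (map_poly iota K) t -> root (map_poly iota K) t' -> t != t' ->
  iota a + \sum_(s <- rs) iota (residue s) / ((iota s - t) * (iota s - t')) = 0.
Proof.
move=> rt rt' tt'.
have Hf u : root (map_poly iota K) u -> (map_poly iota f).[u] != 0.
  move=> ru; apply: root_K_f => r ur rin.
  by have := K_root_not_pole rin; rewrite -(fmorph_root iota) -ur ru.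
have ev u : root (map_poly iota K) u ->
    iota a * u + iota b + \sum_(s <- rs) iota (residue s) / (iota s - u) = 0.
  move=> ru; have := ru; rewrite rootE eval_partial_fraction ?Hf //.
  by rewrite mulf_eq0 (negPf (Hf _ ru)) => /eqP.
have nz u s : root (map_poly iota K) u -> s \in rs -> iota s - u != 0.
  move=> /Hf fu sin; move: fu; rewrite (eval_divX u sin) mulf_eq0 => /norP[_].
  by rewrite -opprB oppr_eq0.
apply: (mulfI (x := t - t')); first by rewrite subr_eq0.
have := congr2 (fun x y => x - y) (ev t rt) (ev t' rt').
rewrite subrr opprD addrACA -sumrB mulr0 => H; apply: etrans H.
rewrite mulrDr; congr (_ + _).
  by ring.
rewrite mulr_sumr big_seq [RHS]big_seq; apply: eq_bigr => s sin.
by field; rewrite !nz.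
Qed.

End Evaluation.

(** With no pole between the zeros, all terms in [two_roots] would be positive. *)
Lemma pole_between (t t' : R) : 0 <= a -> (0 < a) || (1 < size f)%N ->
  root K t -> root K t' -> t < t' -> exists2 s, s \in rs & t < s < t'.
Proof.
move=> a0 nt rt rt' tt'.
have mid p : map_poly (@idfun R) p = p by rewrite map_poly_id.
have := @two_roots R idfun t t'; rewrite mid => /(_ rt rt').
rewrite lt_eqF // => /(_ isT) /= H.
apply: contrapT => Hn.
have pos s : s \in rs -> 0 < residue s / ((s - t) * (s - t')).
  move=> sin; rewrite divr_gt0 ?residue_gt0 //.
  have st : s != t by apply: contraTneq rt => <-; apply: K_root_not_pole.
  have st' : s != t' by apply: contraTneq rt' => <-; apply: K_root_not_pole.
  case: (ltP s t) => lst.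
    by rewrite nmulr_rgt0 ?subr_lt0 // (lt_trans lst).
  case: (ltP t' s) => lst'.
    by rewrite mulr_gt0 ?subr_gt0 // lt_neqAle eq_sym st.
  exfalso; apply: Hn; exists s => //.
  by rewrite !lt_neqAle lst lst' st' eq_sym st.
rewrite (size_split f0 fE) ltnS in nt.
by have := sum_gt0 a0 nt pos; rewrite H ltxx.
Qed.

(** The quotient [K / f] has derivative [a + sum residue / (s - t)^2] at a zero [t],
    so it increases through it. *)
Lemma K_simple (t : R) : 0 <= a -> (0 < a) || (1 < size f)%N ->
  root K t -> 0 < f.[t] * K^`().[t].
Proof.
move=> a0 nt rt.
have mid p : map_poly (@idfun R) p = p by rewrite map_poly_id.
have ft : f.[t] != 0.
  rewrite -[f]mid; apply: (@root_K_f R idfun) => r /= tr rin.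
  by have := K_root_not_pole rin; rewrite -tr rt.
have ev : a * t + b + \sum_(s <- rs) residue s / (s - t) = 0.
  have := @eval_partial_fraction R idfun t; rewrite !mid => /(_ ft) /eqP.
  rewrite (rootP rt) eq_sym mulf_eq0 (negPf ft) => /eqP /= H.
  by apply: H.
have nz s : s \in rs -> s - t != 0.
  move=> sin; have := ft; have := @eval_divX R idfun s t sin.
  by rewrite !mid => ->; rewrite mulf_eq0 => /norP[_] /=; rewrite -opprB oppr_eq0.
have dE : K^`().[t] = f.[t] * (a + \sum_(s <- rs) residue s / (s - t) ^+ 2).
  rewrite partial_fraction derivB derivM derivD derivZ derivX derivC raddf_sum /=.
  rewrite !hornerE horner_sum.
  have -> : \sum_(s <- rs) (residue s *: (f %/ ('X - s%:P)))^`().[t] =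
     \sum_(s <- rs) (- (f^`().[t] * (residue s / (s - t))) -
                      f.[t] * (residue s / (s - t) ^+ 2)).
    rewrite big_seq [RHS]big_seq; apply: eq_bigr => s sin.
    have dv : ('X - s%:P) %| f by rewrite dvdp_XsubCl -root_f.
    rewrite derivZ hornerZ -{2 3}(divpK dv) derivM derivXsubC !hornerE /=.
    set q := f %/ _; set y := q.[t]; set y' := _.[t]; field; exact: nz.
  rewrite big_split /= !sumrN -!mulr_sumr.
  rewrite -[a * t + b](addrK (\sum_(s <- rs) residue s / (s - t))) ev.
  by ring.
rewrite dE mulrA -expr2 mulr_gt0 ?exprn_even_gt0 //.
have pos s : s \in rs -> 0 < residue s / (s - t) ^+ 2.
  by move=> sin; rewrite divr_gt0 ?residue_gt0 // exprn_even_gt0 // nz.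
by apply: sum_gt0 pos => //; rewrite (size_split f0 fE) ltnS in nt.
Qed.

End Herglotz.

End PartialFractions.

(** * Reciprocals of Herglotz functions and the continued fraction step *)

Section Inversion.
Context {R : rcfType}.
Implicit Types (f K : {poly R}) (rs : seq R).

Lemma herglotz_residuesN f K : herglotz_residues (- K) (- f) <-> herglotz_residues K f.
Proof.
suff H (g L : {poly R}) : herglotz_residues L g -> herglotz_residues (- L) (- g).
  by split=> [/H|/H]; rewrite ?opprK.
move=> [rs [urs fE f0 Kn]]; exists rs; split => //.
- by rewrite lead_coefN scaleNr -fE.
- by rewrite oppr_eq0.
- by move=> s /Kn; rewrite derivN !hornerN mulrNN.
Qed.

Lemma prod_XsubC_uniq rs (p : {poly R}) : p = \prod_(s <- rs) ('X - s%:P) ->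
  (forall s, s \in rs -> p^`().[s] != 0) -> uniq rs.
Proof.
elim: rs p => //= s rs IH p; rewrite big_cons => pE Hp; apply/andP; split.
  apply/negP => sin; have := Hp s (mem_head _ _).
  rewrite pE derivM derivXsubC mul1r hornerD hornerM hornerXsubC subrr mul0r addr0.
  by have := root_prod_XsubC rs s; rewrite sin => /rootP ->; rewrite eqxx.
apply: (IH _ erefl) => t tin.
have := Hp t; rewrite inE tin orbT => /(_ isT).
rewrite pE derivM derivXsubC mul1r hornerD hornerM hornerXsubC.
have /rootP -> : root (\prod_(s <- rs) ('X - s%:P)) t by rewrite root_prod_XsubC.
by rewrite add0r mulf_eq0 => /norP[].
Qed.

Lemma root_conj (p : {poly R}) (z : R[i]) :
  root (map_poly (real_complex R) p) z -> root (map_poly (real_complex R) p) z^*%C.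
Proof.
have {2}-> : map_poly (real_complex R) p = map_poly (@conjc R) (map_poly (real_complex R) p).
  rewrite -map_poly_comp; apply: eq_map_poly => x /=.
  by rewrite /real_complex_def /conjc oppr0.
by rewrite fmorph_root.
Qed.

(** The zeros of a Herglotz function are real and simple, and it increases
    through each of them; so minus its reciprocal is again Herglotz. Reality:
    a zero and its conjugate are two roots, and all the terms
    [r / |s - t|^2] left by subtraction are positive. *)
Lemma herglotz_inv f K K0 (a b : R) : herglotz_residues K f ->
  K = (a *: 'X + b%:P) * f + K0 -> (size K0 < size f)%N -> 0 <= a -> K != 0 ->
  herglotz_residues (- f) K.
Proof.
move=> [rs [urs fE f0 Kn]] KE sK0 a0 K_neq0.
have [nt|] := boolP ((0 < a) || (1 < size f)%N); last first.
  rewrite negb_or -leNgt -leqNgt => /andP[a0' sf].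
  have {a0 a0'} aE : a = 0 by apply/eqP; rewrite eq_le a0 a0'.
  have K00 : K0 = 0.
    by apply/eqP; rewrite -size_poly_leq0 -ltnS (leq_trans sK0).
  have sK : (size K <= 1)%N.
    rewrite KE aE K00 scale0r add0r addr0 mul_polyC.
    by rewrite (leq_trans (size_scale_leq _ _)).
  exists [::]; split => //; rewrite big_nil {1}(size1_polyC sK).
  by rewrite [X in lead_coef X](size1_polyC sK) lead_coefC alg_polyC.
have [|ts KtE] := @real_rooted_splits _ K K_neq0.
  move=> z rz; apply/eqP/negPn/negP => imz.
  have zz : z != z^*%C.
    apply: contraNneq imz; case: (z) => x y /= [] /eqP.
    by rewrite -subr_eq0 opprK -mulr2n mulrn_eq0.
  have /eqP := two_roots urs f0 fE Kn KE sK0 rz (root_conj rz) zz.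
  have [d dpos dE] : {d : R -> R | forall s, 0 < d s &
     forall s, (s%:C - z) * (s%:C - z^*%C) = (d s)%:C}.
    exists (fun s => (s - complex.Re z) ^+ 2 + complex.Im z ^+ 2).
      by move=> s; rewrite ltr_wpDl ?sqr_ge0 // exprn_even_gt0.
    move=> s; case: (z) => x y; rewrite /real_complex_def /=; simpc.
    by apply/eqP; rewrite eq_complex /=; apply/andP; split; apply/eqP; ring.
  under eq_bigr => s _ do rewrite dE -fmorph_div.
  rewrite -rmorph_sum -rmorphD /= fmorph_eq0 => /eqP H.
  have pos s : s \in rs -> 0 < residue f K s / d s.
    by move=> sin; rewrite divr_gt0 // (residue_gt0 Kn).
  rewrite (size_split f0 fE) ltnS in nt.
  by have := sum_gt0 a0 nt pos; rewrite H ltxx.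
have rK t : t \in ts -> root K t by rewrite (root_split _ K_neq0 KtE).
have sg t : t \in ts -> 0 < f.[t] * K^`().[t].
  by move=> /rK; apply: (K_simple urs f0 fE Kn KE sK0 a0 nt).
exists ts; split => //; last by move=> s /sg; rewrite hornerN mulNr oppr_lt0.
apply: (prod_XsubC_uniq erefl) => s /sg; rewrite KtE derivZ hornerZ.
by apply: contraTneq => ->; rewrite !mulr0 ltxx.
Qed.

(** One step of the continued fraction, [v] and [w] being the masses of a node.
    Applying [partial_fraction_lead] to [- f / K], which is Herglotz as well, bounds
    the degree of [K] and gives the sign of [v]; subtracting the polynomial part
    does not change the residues. *)
Lemma herglotz_peel f K : herglotz_residues (- f) K -> f != 0 ->
  (size f <= size K)%N ->
  exists v w K1, [/\ 0 <= v, 0 < `|w| + v,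
    K = (v *: 'X + w%:P) * f + K1, (size K1 < size f)%N & herglotz_residues K1 f].
Proof.
move=> HK f0; rewrite leq_eqVlt => sfK.
have [rs [urs KE K0 fneg]] := HK.
have fin v w K1 : K = (v *: 'X + w%:P) * f + K1 -> herglotz_residues K f ->
    herglotz_residues K1 f.
  move=> {}KE [ts [uts fE _ kn]]; exists ts; split => // s sin.
  have := kn _ sin; rewrite KE hornerD hornerM.
  have /rootP -> : root f s by rewrite (root_split _ f0 fE).
  by rewrite mulr0 add0r.
case/orP: sfK => [/eqP sfK|sfK].
  pose w := lead_coef K / lead_coef f.
  have w0 : w != 0 by rewrite mulf_neq0 ?invr_eq0 ?lead_coef_eq0.
  have KE' : K = (0 *: 'X + w%:P) * f + (K - w *: f).
    by rewrite scale0r add0r mul_polyC addrC subrK.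
  have sr : (size (K - w *: f)%R < size f)%N.
    have sf0 : (0 < size f)%N by rewrite size_poly_gt0.
    rewrite -(prednK sf0) ltnS; apply/leq_sizeP => j hj.
    rewrite coefB coefZ.
    case: (ltngtP j (size f).-1) => [|hj'|->]; first by rewrite ltnNge hj.
      rewrite !nth_default ?mulr0 ?subrr //; first by rewrite -ltnS prednK in hj'.
      by rewrite -sfK -(prednK sf0).
    by rewrite -/(lead_coef f) {1}sfK -/(lead_coef K) divfK ?subrr ?lead_coef_eq0.
  exists 0, w, (K - w *: f); split => //; first by rewrite addr0 normr_gt0.
  apply: (fin _ _ _ KE'); apply/herglotz_residuesN.
  apply: (@herglotz_inv _ _ (w^-1 *: (K - w *: f)) 0 (- w^-1)) HK _ _ _ _ => //.
  - rewrite scale0r add0r mul_polyC scalerBr scalerA mulVf // scale1r scaleNr.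
    by rewrite addrA addNr add0r.
  - by rewrite size_scale ?invr_eq0 // -sfK.
  - by rewrite oppr_eq0.
have sK1 : (1 < size K)%N by apply: leq_trans sfK; rewrite ltnS size_poly_gt0.
have mK : - f = (0 *: 'X + 0%:P) * K + - f by rewrite scale0r add0r mul0r add0r.
have sNf : (size (- f)%R < size K)%N by rewrite size_polyN.
have lt0 := partial_fraction_lead urs K0 KE fneg mK sNf sK1.
have sf : size f = (size K).-1.
  apply/eqP; rewrite eqn_leq -ltnS prednK ?(ltnW sK1) // sfK /=.
  have : f`_(size K).-2 != 0.
    by apply: contraTneq lt0 => H; rewrite coefN H oppr0 mul0r ltxx.
  case: (size K) sK1 => [|[|m]] //= _ H; rewrite ltnNge; apply: contra H => H.
  by rewrite nth_default.
have sfE : (size K).-2 = (size f).-1 by rewrite sf.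
have v0 : 0 < lead_coef K / lead_coef f.
  move: lt0; rewrite coefN sfE -/(lead_coef f) mulNr oppr_lt0 => H.
  have -> : lead_coef K / lead_coef f = lead_coef f * lead_coef K / lead_coef f ^+ 2.
    by field; rewrite lead_coef_eq0.
  by rewrite divr_gt0 // exprn_even_gt0 // lead_coef_eq0.
set v := lead_coef K / lead_coef f in v0.
pose K' := K - v *: 'X * f.
pose w := K'`_(size f).-1 / lead_coef f.
have sf0 : (0 < size f)%N by rewrite size_poly_gt0.
have cK' j : (size f <= j)%N -> K'`_j = 0.
  move=> hj; rewrite coefB -scalerAl coefZ coefXM.
  case: j hj => [|j] hj; first by rewrite leqn0 -leqn0 leqNgt sf0 in hj.
  case: (ltngtP (size f) j.+1) hj => // [hj|hj] _.
    rewrite !nth_default ?mulr0 ?subrr //.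
    by rewrite -(prednK (ltnW sK1)) -sf.
  rewrite /= -[j]/(j.+1.-1) -hj -/(lead_coef f).
  by rewrite /v divfK ?lead_coef_eq0 // {1}sf -/(lead_coef K) subrr.
have KE' : K = (v *: 'X + w%:P) * f + (K' - w *: f).
  by rewrite mulrDl mul_polyC addrACA subrr addr0 addrC subrK.
exists v, w, (K' - w *: f); split => //.
- exact: ltW.
- by rewrite ltr_wpDl.
- rewrite -(prednK sf0) ltnS; apply/leq_sizeP => j hj.
  rewrite coefB coefZ; case: (ltngtP j (size f).-1) => [|hj'|->].
  + by rewrite ltnNge hj.
  + have hj2 : (size f <= j)%N by rewrite -(prednK sf0).
    by rewrite cK' // nth_default // mulr0 subrr.
  + by rewrite -/(lead_coef f) divfK ?subrr ?lead_coef_eq0.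
- apply: (fin _ _ _ KE'); apply/herglotz_residuesN.
  apply: (herglotz_inv HK mK) => //; by rewrite oppr_eq0.
Qed.

End Inversion.

(** * Crossing a node *)

Section Transfer.
Context {R : realType} {K : comNzRingType} (iota : {rmorphism R -> K}) (z : K).
Implicit Types (m : node R) (s t : K * K) (ns : seq (node R)).

(** Between two nodes a solution is [al e^(x/2) + be e^(-x/2)] and is stored as
    the pair [(al, be)]. [kick m s] is [e^(-x/2)] times its value at the node. *)
Definition coupling m : K := z * iota (wgt m) + z ^+ 2 * iota (dip m).

Definition kick m s : K := s.1 + iota (expR (- pos m)) * s.2.

Definition cross m s : K * K :=
  (s.1 + coupling m * kick m s,
   s.2 - iota (expR (pos m)) * (coupling m * kick m s)).

Definition shoot s ns : K * K := foldr cross s ns.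

(** Up to a constant factor this is the Wronskian of the two solutions, which
    does not depend on the gap in which it is computed. *)
Definition wronskian s t : K := s.2 * t.1 - s.1 * t.2.

Definition swap s : K * K := (s.2, s.1).

Lemma iota_exp x : iota (expR (- x)) * iota (expR x) = 1.
Proof. by rewrite -rmorphM -expRD addNr expR0 rmorph1. Qed.

Lemma kick_cross m s : kick m (cross m s) = kick m s.
Proof.
have := iota_exp (pos m); rewrite /cross /kick /=.
move: (coupling m) (iota (expR (pos m))) (iota (expR (- pos m))) => c e' e ee.
case: s => a b /=.
transitivity (a + e * b + c * (1 - e * e') * (a + e * b)); first by ring.
by rewrite ee subrr mulr0 mul0r addr0.
Qed.

Lemma wronskian_cross m s t :
  wronskian (cross m s) (cross m t) = wronskian s t.
Proof.
have := iota_exp (pos m); rewrite /wronskian /cross /kick /=.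
move: (coupling m) (iota (expR (pos m))) (iota (expR (- pos m))) => c e' e ee.
case: s t => [s1 s2] [t1 t2] /=; apply/eqP; rewrite -subr_eq0; apply/eqP.
by transitivity (c * (e * e' - 1) * (s1 * t2 - s2 * t1)); [ring|rewrite ee subrr mulr0 mul0r].
Qed.

Lemma wronskian_shoot ns s t :
  wronskian (shoot s ns) (shoot t ns) = wronskian s t.
Proof. by elim: ns => //= m ns IH; rewrite wronskian_cross. Qed.

Lemma shoot_cat s ns ns' : shoot s (ns ++ ns') = shoot (shoot s ns') ns.
Proof. exact: foldr_cat. Qed.

Lemma shoot_linear (k : K) s ns :
  shoot (k * s.1, k * s.2) ns = (k * (shoot s ns).1, k * (shoot s ns).2).
Proof.
elim: ns => //= m ns ->; rewrite /cross /kick /=; congr (_, _); ring.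
Qed.

Lemma shoot0 ns : shoot (0, 0) ns = (0, 0).
Proof.
elim: ns => //= m ns ->; rewrite /cross /kick /=; congr (_, _); ring.
Qed.

Lemma shoot_inj ns : injective (shoot^~ ns).
Proof.
elim: ns => [s t //|m ns IH s t /= H]; apply: IH; move: H.
move: (shoot s ns) (shoot t ns) => {}s {}t H.
have kE : kick m s = kick m t by rewrite -(kick_cross m s) H kick_cross.
move: H; rewrite /cross kE; case: s t {kE} => [s1 s2] [t1 t2] /= [].
by move=> /addIr -> /addIr ->.
Qed.

(** The problem is symmetric under [x -> - x], which exchanges the two
    exponentials and reverses the direction of crossing. *)
Definition reflect_node m : node R := (- pos m, wgt m, dip m).

Definition reflect_nodes ns := rev (map reflect_node ns).

Lemma reflect_nodeK : involutive reflect_node.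
Proof. by case=> [[x w] v]; rewrite /reflect_node /pos /= opprK. Qed.

Lemma reflect_nodesK : involutive reflect_nodes.
Proof.
move=> ns; rewrite /reflect_nodes map_rev revK -map_comp -[RHS]map_id.
by apply: eq_map => m; apply: reflect_nodeK.
Qed.

Lemma cross_reflect m s :
  cross m (swap (cross (reflect_node m) s)) = swap s.
Proof.
have cE : coupling (reflect_node m) = coupling m by [].
have pE : pos (reflect_node m) = - pos m by [].
have := iota_exp (pos m); rewrite /cross /kick /swap cE pE opprK /=.
move: (coupling m) (iota (expR (- pos m))) (iota (expR (pos m))) => c e e' ee.
case: s => a b /=; congr (_, _).
  by transitivity (b + c * (1 - e * e') * b); [ring|rewrite ee; ring].
by transitivity (a + c * (1 - e * e') * a); [ring|rewrite ee; ring].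
Qed.

Lemma shoot_reflect ns s :
  shoot (swap (shoot s ns)) (reflect_nodes ns) = swap s.
Proof.
elim: ns => //= m ns IH.
rewrite /reflect_nodes /= rev_cons -cats1 shoot_cat /=.
by rewrite -[in X in swap X](reflect_nodeK m) cross_reflect.
Qed.

End Transfer.

Section Morphism.
Context {R : realType} {K K' : comNzRingType}.
Variables (iota : {rmorphism R -> K}) (iota' : {rmorphism R -> K'})
  (phi : {rmorphism K -> K'}) (z : K).
Hypothesis phi_iota : forall x, phi (iota x) = iota' x.

(** Evaluating the polynomial pair at a number amounts to continuing the solution
    for that number. *)
Lemma shoot_morph (s : K * K) ns :
  shoot iota' (phi z) (phi s.1, phi s.2) ns =
  (phi (shoot iota z s ns).1, phi (shoot iota z s ns).2).
Proof.
elim: ns => //= m ns ->; rewrite /cross /kick /coupling /=.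
by rewrite !(rmorphD, rmorphN, rmorphM, rmorphXn, phi_iota).
Qed.

End Morphism.

(** * The inverse problem on a half line *)

Section InverseProblem.
Context {R : realType}.
Implicit Types (m : node R) (ns : seq (node R)) (f K : {poly R}) (a : R).

Definition admissible ns : bool :=
  sorted (fun m m' => pos m < pos m') ns &&
  all (fun m => (0 <= dip m) && (0 < `|wgt m| + dip m)) ns.

(** The solution equal to [e^(-x/2)] near [+oo], continued to the left through
    the nodes [ns], as a pair of polynomials in the spectral parameter. *)
Definition state ns : {poly R} * {poly R} := shoot (@polyC R) 'X (0, 1) ns.

Lemma admissible_cons m ns :
  admissible (m :: ns) =
  [&& all (fun m' => pos m < pos m') ns, 0 <= dip m, 0 < `|wgt m| + dip m &
      admissible ns].
Proof.
rewrite /admissible /= path_sortedE; last by move=> x y z; apply: lt_trans.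
by rewrite -!andbA; do !bool_congr.
Qed.

Lemma state_cons m ns : state (m :: ns) = cross (@polyC R) 'X m (state ns).
Proof. by []. Qed.

(** The polynomial [f] is the value at [a] of the solution decaying on the right, and
    [K / f] is [(phi' / phi + 1/2) / z] there. At the first node to the right of [a]
    the value of the solution has smaller degree than at [a], which forces the
    distance to that node; its masses are then the polynomial part of [d K / f1],
    where [f1] is the value at the node and [d] the exponential of half the distance. *)
Lemma inverse_half n a f K : (size f <= n.+1)%N -> herglotz_residues K f ->
  (size K < size f)%N -> f.[0] = expR (- a / 2) ->
  exists ns, [/\ all (fun m => a < pos m) ns, admissible ns,
    expR (a / 2) *: (state ns).1 = 'X * K &
    expR (- a / 2) *: (state ns).2 = f - 'X * K].
Proof.
elim: n a f K => [|n IH] a f K sf HK sK f_0; have f0 : f != 0.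
- by apply/eqP => f0; move: f_0 (expR_gt0 (- a / 2)); rewrite f0 horner0 => <-; rewrite ltxx.
- have K0 : K = 0.
    by apply/eqP; rewrite -size_poly_leq0 -ltnS (leq_trans sK).
  exists [::]; split => //=; rewrite K0 mulr0 ?scaler0 ?subr0 //.
  by rewrite [f]size1_polyC // -horner_coef0 f_0 alg_polyC.
- by apply/eqP => f0; move: f_0 (expR_gt0 (- a / 2)); rewrite f0 horner0 => <-; rewrite ltxx.
have [sf1|sf1] := leqP (size f) 1; first by apply: IH => //; rewrite (leq_trans sf1).
have KE : K = (0 *: 'X + 0%:P) * f + K by rewrite scale0r add0r mul0r add0r.
have [rs [urs fE _ Kneg]] := HK.
have lt0 := partial_fraction_lead urs f0 fE Kneg KE sK sf1.
have K0 : K != 0 by apply: contraTneq lt0 => ->; rewrite coef0 mul0r ltxx.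
have HfK : herglotz_residues (- f) K by apply: (herglotz_inv HK KE).
have lf0 : lead_coef f != 0 by rewrite lead_coef_eq0.
(* [- r] is the limit of [z K / f] at infinity, negative as the residues are positive. *)
pose r := - K`_(size f).-2 / lead_coef f.
have r0 : 0 < r.
  have -> : r = - (K`_(size f).-2 * lead_coef f) / lead_coef f ^+ 2.
    by rewrite /r; field.
  by rewrite divr_gt0 ?oppr_gt0 // exprn_even_gt0.
have halfD (y : R) : y / 2 + y / 2 = y by field.
have d2gt1 : 1 < (1 + r) / r by rewrite ltr_pdivlMr // mul1r ltrDr.
have d2gt0 : 0 < (1 + r) / r by apply: lt_trans d2gt1.
(* The only position at which the leading terms of the value cancel. *)
pose x := a + ln ((1 + r) / r).
have ax : a < x by rewrite ltrDl ln_gt0.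
pose d := expR ((x - a) / 2).
have d0 : 0 < d := expR_gt0 _.
have d_neq0 : d != 0 by rewrite gt_eqF.
have dd : d * d = (1 + r) / r.
  have xa : x - a = ln ((1 + r) / r) by rewrite /x addrC addKr.
  by rewrite /d -expRD halfD xa lnK.
(* The value at [x] of the solution that is given at [a] by [f] and [K]. *)
pose f1 := d^-1 *: f + (d - d^-1) *: ('X * K).
have sf0 : (0 < size f)%N by rewrite size_poly_gt0.
have sK1 : size K = (size f).-1.
  apply/eqP; rewrite eqn_leq -ltnS prednK // sK /= leqNgt; apply/negP => H.
  suff : K`_(size f).-2 = 0 by move=> E; move: lt0; rewrite E mul0r ltxx.
  by rewrite nth_default // -ltnS prednK // -ltnS prednK.
have sf1f : (size f1 < size f)%N.
  rewrite -(prednK sf0) ltnS; apply/leq_sizeP => j hj.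
  rewrite coefD !coefZ coefXM.
  case: j hj => [|j] hj; first by move: sf1; rewrite -(prednK sf0) ltnS ltnNge hj.
  case: (ltngtP (size f).-1 j.+1) hj => // [hj|hj] _ /=.
    rewrite !nth_default ?mulr0 ?addr0 //; first by rewrite sK1.
    by rewrite -(prednK sf0).
  have -> : f`_j.+1 = lead_coef f by rewrite -hj.
  have -> : K`_j = - r * lead_coef f.
    by rewrite /r mulNr divfK // opprK -[j]/(j.+1.-1) -hj.
  have -> : d^-1 * lead_coef f + (d - d^-1) * (- r * lead_coef f) =
    d^-1 * lead_coef f * (1 + r - (d * d) * r) by field.
  by rewrite dd divfK ?gt_eqF // subrr mulr0.
have f1_0 : f1.[0] = expR (- x / 2).
  rewrite /f1 hornerD !hornerZ hornerM hornerX mul0r mulr0 addr0 f_0.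
  by rewrite /d -expRN -expRD; congr expR; field.
have f1_neq0 : f1 != 0.
  by apply/eqP => H; move: f1_0 (expR_gt0 (- x / 2)); rewrite H horner0 => <-; rewrite ltxx.
have HfK1 : herglotz_residues (- f1) (d *: K).
  have [ts [uts tE _ tneg]] := HfK; exists ts; split => //.
  - by rewrite lead_coefZ -scalerA -tE.
  - by rewrite scaler_eq0 negb_or d_neq0.
  - move=> t tin; have := tneg t tin.
    have /rootP Kt : root K t by rewrite (root_split _ K0 tE).
    rewrite derivZ !hornerN hornerZ /f1 hornerD !hornerZ hornerM hornerX Kt.
    rewrite mulr0 mulr0 addr0; congr (_ < 0); by field.
have sfK1 : (size f1 <= size (d *: K)%R)%N.
  by rewrite size_scale // sK1 -ltnS prednK.
have [v [w [K2 [v0 vw KE2 sK2 HK2]]]] := herglotz_peel HfK1 f1_neq0 sfK1.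
have [|ns [xns adm st1 st2]] := IH x f1 K2 _ HK2 sK2 f1_0.
  by rewrite -ltnS (leq_trans sf1f).
pose E : {poly R} := (expR (x / 2))%:P; pose iE : {poly R} := (expR (- x / 2))%:P.
have EiE : E * iE = 1 by rewrite -polyCM -expRD mulNr subrr expR0.
have aE : (state ns).1 = iE * ('X * K2).
  by rewrite -st1 -mul_polyC mulrA [iE * _]mulrC EiE mul1r.
have bE : (state ns).2 = E * (f1 - 'X * K2).
  by rewrite -st2 -mul_polyC mulrA EiE mul1r.
have kE : kick (@polyC R) (x, w, v) (state ns) = iE * f1.
  rewrite /kick /pos /= aE bE.
  have -> : (expR (- x))%:P = iE * iE.
    by rewrite -polyCM -expRD halfD.
  by rewrite -mulrA [iE * (E * _)]mulrA [iE * E]mulrC EiE mul1r -mulrDr addrC subrK.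
have cE : coupling (@polyC R) 'X (x, w, v) = 'X * (v *: 'X + w%:P).
  by rewrite /coupling /wgt /dip /= -mul_polyC; ring.
have dE : d%:P * K = (v *: 'X + w%:P) * f1 + K2 by rewrite mul_polyC.
have f1E : d%:P * f1 = f + ((d * d)%:P - 1) * ('X * K).
  rewrite /f1 -!mul_polyC mulrDr [d%:P * (d^-1%:P * _)]mulrA
    [d%:P * (_ * ('X * K))]mulrA -!polyCM divff // mul1r.
  have -> : d * (d - d^-1) = d * d - 1 by field.
  by rewrite polyCB.
exists ((x, w, v) :: ns); rewrite state_cons; split.
- rewrite /= ax /=; apply/allP => m min.
  by rewrite (lt_trans ax) // (allP xns).
- by rewrite admissible_cons /= xns /dip /wgt /= v0 vw.
- have -> : expR (a / 2) = d^-1 * expR (x / 2).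
    by rewrite /d -expRN -expRD; congr expR; field.
  rewrite /cross kE cE aE /= -scalerA -[expR (x / 2) *: _]mul_polyC -/E.
  have -> : E * (iE * ('X * K2) + 'X * (v *: 'X + w%:P) * (iE * f1)) =
      (E * iE) * ('X * ((v *: 'X + w%:P) * f1 + K2)) by ring.
  by rewrite EiE mul1r -dE -mul_polyC mulrCA [_ * (_ * K)]mulrA -polyCM mulVf // mul1r.
- have -> : expR (- a / 2) = d * expR (- x / 2).
    by rewrite /d -expRD; congr expR; field.
  rewrite /cross kE cE bE /= -scalerA -[expR (- x / 2) *: _]mul_polyC -/iE.
  have -> : (expR (pos (x, w, v)))%:P = E * E.
    by rewrite -polyCM -expRD halfD.
  have -> : iE * (E * (f1 - 'X * K2) - E * E * ('X * (v *: 'X + w%:P) * (iE * f1))) =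
    (E * iE) * (f1 - 'X * K2) - (E * iE) * (E * iE) * ('X * ((v *: 'X + w%:P) * f1)) by ring.
  rewrite EiE !mul1r -addrA -opprD -mulrDr [K2 + _]addrC -dE -mul_polyC mulrBr f1E.
  by rewrite polyCM; ring.
Qed.

End InverseProblem.

(** * Norming constants and the Wronskian *)

Section DirectProblem.
Context {R : realType}.
Implicit Types (m : node R) (ns : seq (node R)) (f K : {poly R}) (a l : R).

Local Notation pcoupling := (coupling (@polyC R) 'X).
Local Notation pkick := (kick (@polyC R)).

Lemma state0 ns : ((state ns).1.[0] = 0) * ((state ns).2.[0] = 1).
Proof.
elim: ns => [|m ns [IH1 IH2]]; first by rewrite /= hornerC hornerC.
rewrite state_cons /cross /coupling /= !hornerE /= IH1 IH2.
by rewrite !hornerE /= expr0n /= !(mul0r, mulr0, addr0, subr0).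
Qed.

(** The value at [a] of the solution equal to [e^(-x/2)] near [+oo], if all of [ns] lies
    to the right of [a]. *)
Definition value a ns : {poly R} :=
  expR (a / 2) *: (state ns).1 + expR (- a / 2) *: (state ns).2.

Lemma value0 a ns : (value a ns).[0] = expR (- a / 2).
Proof. by rewrite /value hornerD !hornerZ !state0 mulr0 add0r mulr1. Qed.

Lemma value_kick m ns : value (pos m) ns = expR (pos m / 2) *: pkick m (state ns).
Proof.
rewrite /value /kick scalerDr; congr (_ + _).
by rewrite mul_polyC scalerA -expRD; congr (expR _ *: _); field.
Qed.

Lemma value_cons m ns : value (pos m) (m :: ns) = value (pos m) ns.
Proof.
by rewrite !value_kick state_cons kick_cross.
Qed.

(** [sum (w + 2 z v) phi^2] and [sum (z w + z^2 v) phi^2] over the nodes, [phi]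
    being the solution equal to [e^(-x/2)] near [+oo]. *)
Fixpoint norming ns : {poly R} :=
  if ns is m :: ns' then
    norming ns' + (pcoupling m)^`() * value (pos m) ns' ^+ 2
  else 0.

Fixpoint energy ns : {poly R} :=
  if ns is m :: ns' then energy ns' + pcoupling m * value (pos m) ns' ^+ 2
  else 0.

Lemma value_sqr m ns :
  value (pos m) ns ^+ 2 = (expR (pos m))%:P * pkick m (state ns) ^+ 2.
Proof.
rewrite value_kick -mul_polyC exprMn -polyC_exp; congr (_%:P * _).
by rewrite expr2 -expRD; congr expR; field.
Qed.

(** Lagrange's identity, from differentiating the transfer matrices. *)
Lemma wronskian_deriv ns :
  wronskian ((state ns).1^`(), (state ns).2^`()) (state ns) = - norming ns.
Proof.
rewrite /wronskian /=; elim: ns => [|m ns IH].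
  by rewrite /= deriv0 mul0r mulr0 subrr oppr0.
rewrite [norming _]/= opprD -IH value_sqr state_cons.
have := iota_exp (@polyC R) (pos m); rewrite /cross /kick /=.
move: (pcoupling m) (state ns).1 (state ns).2 => c s1 s2.
rewrite !(derivD, derivN, derivM, derivC, mul0r, add0r).
move: (c^`()) => c'; move: (s1^`()) (s2^`()) (expR _)%:P (expR _)%:P => t1 t2 e' e ee.
apply/eqP; rewrite -subr_eq0; apply/eqP.
transitivity ((1 - e * e') * (c * (s1 + e * s2) * t2 -
   (c' * (s1 + e * s2) + c * (t1 + e * t2)) * s2)).
  ring.
by rewrite ee subrr mul0r.
Qed.

End DirectProblem.

(** * Positivity and behaviour at infinity in the spectral parameter *)

Section Structure.
Context {R : realType}.
Implicit Types (m : node R) (ns : seq (node R)) (f K : {poly R}) (a l : R).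

Local Notation pcoupling := (coupling (@polyC R) 'X).
Local Notation pkick := (kick (@polyC R)).

(** Multiplying the equation by the solution and integrating to the right of the
    first node: the sum of the coupling terms and the boundary term is the integral of
    [f'^2 + f^2 / 4] plus half the square of the value at the node. The induction moves
    one gap at a time, and the increment of a gap is a positive multiple of a square. *)
Lemma energy_gt0_aux m ns l : admissible (m :: ns) ->
  0 < (energy (m :: ns)).[l] + (pkick m (state ns) * (state (m :: ns)).2).[l].
Proof.
have step m' ns' : energy (m' :: ns') + pkick m' (state ns') * (state (m' :: ns')).2
    = energy ns' + pkick m' (state ns') * (state ns').2.
  rewrite /= value_sqr; have := iota_exp (@polyC R) (pos m'); rewrite /cross /=.
  move: (pcoupling m') (pkick _ _) (expR (pos m'))%:P => c k e' _; ring.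
rewrite -hornerD step hornerD; elim: ns m => [|m' ns IH] m.
  by rewrite /kick /= !hornerE /= expR_gt0.
rewrite admissible_cons => /and4P[xns _ _ adm].
have xx' : pos m < pos m' by case/andP: xns.
have kk : pkick m' (state (m' :: ns)) = pkick m' (state ns).
  by rewrite state_cons kick_cross.
have := IH _ adm; rewrite -hornerD -step -kk.
move: (energy (m' :: ns)) (state (m' :: ns)) => E [s1 s2].
rewrite /kick /= !hornerD !hornerM !hornerD !hornerM !hornerC.
have : expR (- pos m') < expR (- pos m) by rewrite ltr_expR ltrN2.
move: (expR (- pos m)) (expR (- pos m')) (s1.[l]) (s2.[l]) E.[l].
move=> e e' t1 t2 {}E; rewrite -subr_gt0 => ee H.
have -> : E + (t1 + e * t2) * t2 = (E + (t1 + e' * t2) * t2) + (e - e') * t2 ^+ 2.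
  by ring.
by rewrite ltr_wpDr // mulr_ge0 ?sqr_ge0 // ltW.
Qed.

Lemma energy_gt0 ns l : admissible ns -> ns != [::] -> (state ns).2.[l] = 0 ->
  0 < (energy ns).[l].
Proof.
case: ns => // m ns adm _ b0.
by have := energy_gt0_aux l adm; rewrite hornerM b0 mulr0 addr0.
Qed.

(** The factor [2] of the dipole mass in the norming constant turns into an excess
    [z^2 v phi^2] over the energy. *)
Lemma norming_ge_energy ns l : admissible ns ->
  (energy ns).[l] <= l * (norming ns).[l].
Proof.
elim: ns => [|m ns IH]; first by rewrite /= horner0 mulr0.
rewrite admissible_cons => /and4P[_ v0 _ adm] /=.
have cl : (pcoupling m).[l] <= l * (pcoupling m)^`().[l].
  rewrite /coupling expr2 !(derivD, derivM, derivC, derivX).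
  rewrite !(mulr0, addr0, mul1r, mulr1) !hornerE /=.
  have : 0 <= dip m * l ^+ 2 by rewrite mulr_ge0 ?sqr_ge0.
  by move=> H; rewrite -subr_ge0 (_ : _ - _ = dip m * l ^+ 2) //; ring.
move: (pcoupling m) (value (pos m) ns) cl => c f cl.
rewrite hornerD [in leRHS]hornerD mulrDr lerD ?IH // !hornerM.
by rewrite [leRHS]mulrA ler_wpM2r // -expr2 sqr_ge0.
Qed.

Lemma norming_gt0 ns l : admissible ns -> ns != [::] -> (state ns).2.[l] = 0 ->
  0 < l * (norming ns).[l].
Proof.
by move=> adm ns0 b0; apply: lt_le_trans (norming_ge_energy l adm); apply: energy_gt0.
Qed.

Lemma size_coupling m : 0 < `|wgt m| + dip m -> (1 < size (pcoupling m))%N.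
Proof.
move=> m0; have cE : pcoupling m = Poly [:: 0; wgt m; dip m].
  apply/polyP => i; rewrite coef_Poly /coupling coefD !coefMC coefX coefXn.
  by case: i => [|[|[|i]]] //=;
     rewrite ?nth_nil !(mul1r, mul0r, addr0, add0r).
rewrite ltnNge; apply/negP => sc.
have w0 : wgt m = 0.
  by have /(leq_sizeP _ _) /(_ 1%N isT) := sc; rewrite cE coef_Poly.
have v0 : dip m = 0.
  by have /(leq_sizeP _ _) /(_ 2%N isT) := sc; rewrite cE coef_Poly.
by move: m0; rewrite w0 v0 normr0 addr0 ltxx.
Qed.

Lemma value_neq0 a ns : value a ns != 0.
Proof.
apply/eqP => H; have := value0 a ns; rewrite H horner0 => /eqP.
by rewrite eq_sym gt_eqF ?expR_gt0.
Qed.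

(** Values on the left of a node in terms of those on its right; [A] is the increasing
    part just left of the node, and [d] accounts for the distance to it. *)
Lemma value_cross a m ns (d := expR ((pos m - a) / 2))
    (A := expR (pos m / 2) *: (state ns).1 + pcoupling m * value (pos m) ns) :
  (expR (a / 2) *: (state (m :: ns)).1 = d^-1 *: A) *
  (value a (m :: ns) = d *: value (pos m) ns - (d - d^-1) *: A).
Proof.
have AE : expR (pos m / 2) *: (state (m :: ns)).1 = A.
  rewrite state_cons /cross /= scalerDr /A; congr (_ + _).
  by rewrite scalerAr -value_kick.
have e1 : expR (a / 2) = d^-1 * expR (pos m / 2).
  by rewrite /d -expRN -expRD; congr expR; field.
have e2 : expR (- a / 2) = d * expR (- pos m / 2).
  by rewrite /d -expRD; congr expR; field.
have E1 : expR (a / 2) *: (state (m :: ns)).1 = d^-1 *: A.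
  by rewrite e1 -scalerA AE.
split=> //; rewrite /value E1.
have -> : expR (- a / 2) *: (state (m :: ns)).2 = d *: (value (pos m) ns - A).
  rewrite e2 -scalerA; congr (_ *: _).
  by rewrite -value_cons {1}/value AE addrC addKr.
by rewrite scalerBr scalerBl opprB addrCA.
Qed.

(** [- r] is the limit at infinity in [z] of the quotient of the increasing part at [a]
    by the solution itself. A node makes this quotient infinite on its left, and moving
    on by a positive distance turns infinity into a finite negative limit. *)
Lemma state_asymp a ns : admissible ns -> all (fun m => a < pos m) ns ->
  exists2 r, 0 <= r &
    (size (expR (a / 2) *: (state ns).1 + r *: value a ns)%R < size (value a ns))%N.
Proof.
elim: ns a => [|m ns IH] a.
  move=> _ _; exists 0 => //; rewrite scale0r scaler0 addr0 size_poly0.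
  by rewrite size_poly_gt0 value_neq0.
rewrite admissible_cons => /and4P[xns _ /size_coupling sc adm] /= /andP[ax _].
have [r r0 sA] := IH _ adm xns.
have [-> ->] := value_cross a m ns.
set d := expR _; set f := value (pos m) ns in sA *.
set A0 := expR _ *: _ in sA *; set c := pcoupling m in sc *.
have f0 : f != 0 by apply: value_neq0.
have d1 : 1 < d by rewrite expR_gt1 divr_gt0 // subr_gt0.
have d0 : 0 < d := expR_gt0 _.
have dd : 0 < d - d^-1 by rewrite subr_gt0 (lt_trans _ d1) // invf_lt1.
have sA0 : (size A0 <= size f)%N.
  rewrite -[A0](addrK (r *: f)) (leq_trans (size_polyD _ _)) // geq_max ltnW //=.
  by rewrite size_polyN size_scale_leq.
have scf : (size f < size (c * f)%R)%N.
  rewrite size_mul //; last by rewrite -size_poly_gt0 (ltn_trans _ sc).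
  by case: (size c) sc => [|[|s]] // _; rewrite addSn /= addSn ltnS leq_addl.
clearbody d f A0 c; exists (d^-1 / (d - d^-1)); first by rewrite divr_ge0 ?invr_ge0 // ltW.
have -> : d^-1 *: (A0 + c * f) + d^-1 / (d - d^-1) *: (d *: f - (d - d^-1) *: (A0 + c * f))
    = (d^-1 / (d - d^-1) * d) *: f.
  rewrite scalerBr !scalerA divfK ?gt_eqF // addrCA subrr addr0 //.
have -> : d *: f - (d - d^-1) *: (A0 + c * f) =
    - (d - d^-1) *: (c * f) + (d *: f - (d - d^-1) *: A0).
  by rewrite scaleNr scalerDr opprD addrA addrC.
rewrite (leq_ltn_trans (size_scale_leq _ _)) // size_polyDl.
  by rewrite size_scale // oppr_eq0 gt_eqF.
rewrite size_scale ?oppr_eq0 ?gt_eqF //.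
rewrite (leq_ltn_trans _ scf) // (leq_trans (size_polyD _ _)) // size_polyN geq_max.
by rewrite size_scale_leq (leq_trans (size_scale_leq _ _)).
Qed.

Definition rights a ns := [seq m <- ns | a < pos m].
Definition lefts a ns := [seq m <- ns | pos m < a].

Lemma admissible_filter (P : pred (node R)) ns : admissible ns ->
  admissible [seq m <- ns | P m].
Proof.
move=> /andP[so al]; apply/andP; split.
  by apply: sorted_filter so => x y z; apply: lt_trans.
by rewrite all_filter; apply/allP => m min; apply/implyP => _; apply: (allP al).
Qed.

Lemma admissible_reflect ns : admissible (reflect_nodes ns) = admissible ns.
Proof.
rewrite /admissible /reflect_nodes rev_sorted sorted_map all_rev all_map.
congr (_ && _); apply: eq_sorted => m m' /=.
by rewrite /reflect_node /pos /= ltrN2.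
Qed.

Lemma split_nodes a ns : admissible ns ->
  ns = lefts a ns ++ rights a ns \/
  exists2 m, pos m = a & ns = lefts a ns ++ m :: rights a ns.
Proof.
elim: ns => [|m ns IH]; first by left.
rewrite admissible_cons => /and4P[xns _ _ adm].
have above : a <= pos m -> lefts a ns = [::] /\ rights a ns = ns.
  move=> am; split.
    rewrite /lefts -(filter_pred0 ns); apply: eq_in_filter => m' m'in.
    by rewrite ltNge ltW // (le_lt_trans am) // (allP xns).
  rewrite /rights -[RHS]filter_predT; apply: eq_in_filter => m' m'in.
  by rewrite (le_lt_trans am) // (allP xns).
have [-> ->] : (lefts a (m :: ns) = if pos m < a then m :: lefts a ns else lefts a ns)
    /\ (rights a (m :: ns) = if a < pos m then m :: rights a ns else rights a ns) by [].
case: (ltgtP (pos m) a) => [ma|am|ma].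
- by case: (IH adm) => [nsE|[m' m'a nsE]]; [left|right; exists m' => //]; rewrite {1}nsE.
- by have [-> ->] := above (ltW am); left.
- by have [|-> ->] := above _; [rewrite ma|right; exists m].
Qed.

End Structure.

Section Green.
Context {R : realType}.
Implicit Types (m : node R) (ns : seq (node R)) (f K : {poly R}) (a l : R).

Local Notation pcoupling := (coupling (@polyC R) 'X).
Local Notation pkick := (kick (@polyC R)).

Lemma shoot_left (L : seq (node R)) :
  shoot (@polyC R) 'X (swap (state (reflect_nodes L))) L = (1, 0).
Proof. by rewrite -{2}(reflect_nodesK L) shoot_reflect. Qed.

(** The solution decaying on the left, shot through [L], arrives as [e^(x/2)]; so the
    last coefficient is a Wronskian, and may be computed between [L] and [ns]. *)
Lemma state_end_wronskian L ns :
  (state (L ++ ns)).2 = (state ns).2 * (state (reflect_nodes L)).2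
                      - (state ns).1 * (state (reflect_nodes L)).1.
Proof.
have -> : (state (L ++ ns)).2 = wronskian (state (L ++ ns)) (1, 0).
  by rewrite /wronskian /= mulr1 mulr0 subr0.
by rewrite -(shoot_left L) {1}/state shoot_cat wronskian_shoot.
Qed.

Lemma shoot_horner (s : {poly R} * {poly R}) ns l :
  shoot (@idfun R) l (s.1.[l], s.2.[l]) ns =
  ((shoot (@polyC R) 'X s ns).1.[l], (shoot (@polyC R) 'X s ns).2.[l]).
Proof.
have H0 x : horner_eval l (polyC x) = idfun x by rewrite /horner_eval hornerC.
have := @shoot_morph R _ _ (@polyC R) idfun (horner_eval l) 'X H0 s ns.
by rewrite /= /horner_eval hornerX.
Qed.

(** At an eigenvalue both decaying solutions continue to a multiple of [e^(x/2)] at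
    the left end, and a solution is determined by its coefficients there. The last
    identity is [wronskian_deriv] with one coefficient zero: it ties the factor [k] to
    the norming constant. *)
Lemma proportional_at_eigenvalue L ns l (k := (state (L ++ ns)).1.[l]) :
  (state (L ++ ns)).2.[l] = 0 ->
  [/\ k != 0,
    (state ns).1.[l] = k * (state (reflect_nodes L)).2.[l],
    (state ns).2.[l] = k * (state (reflect_nodes L)).1.[l] &
    k * (state (L ++ ns)).2^`().[l] = - (norming (L ++ ns)).[l]].
Proof.
move=> b0.
have totE : shoot (@idfun R) l ((state ns).1.[l], (state ns).2.[l]) L = (k, 0).
  by rewrite shoot_horner -shoot_cat -b0.
have leftE : shoot (@idfun R) l (k * (state (reflect_nodes L)).2.[l],
    k * (state (reflect_nodes L)).1.[l]) L = (k, 0).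
  have := shoot_linear (@idfun R) l k
    ((state (reflect_nodes L)).2.[l], (state (reflect_nodes L)).1.[l]) L => /= ->.
  have := shoot_horner (swap (state (reflect_nodes L))) L l; rewrite shoot_left /= => ->.
  by rewrite /= hornerC horner0 mulr1 mulr0.
have := totE; rewrite -leftE => /shoot_inj [E1 E2].
have k0 : k != 0.
  apply/eqP => k0; have := totE; rewrite k0 -(shoot0 (@idfun R) l L) => /shoot_inj [H1 H2].
  have T : shoot (@idfun R) l (0, 1) ns = (0, 0).
    have := shoot_horner (0, 1) ns l; rewrite /= horner0 hornerC => ->.
    by rewrite -/(state ns) H1 H2.
  move: T; rewrite -(shoot0 (@idfun R) l ns) => /shoot_inj [] /eqP.
  by rewrite oner_eq0.
split => //.
have := congr1 (fun p : {poly R} => p.[l]) (wronskian_deriv (L ++ ns)).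
rewrite /wronskian /= hornerD !hornerN !hornerM b0 mulr0 subr0 mulrC => <-.
by [].
Qed.

Lemma value_reflect a ns : value (- a) ns =
  expR (a / 2) *: (state ns).2 + expR (- a / 2) *: (state ns).1.
Proof. by rewrite /value opprK addrC. Qed.

Lemma proportional_values a L ns l : (state (L ++ ns)).2.[l] = 0 ->
  (value a ns).[l] = (state (L ++ ns)).1.[l] * (value (- a) (reflect_nodes L)).[l].
Proof.
move=> /proportional_at_eigenvalue[_ E1 E2 _].
by rewrite value_reflect /value !hornerD !hornerZ E1 E2; ring.
Qed.

Lemma rightsP a ns : admissible ns ->
  admissible (rights a ns) /\ all (fun m => a < pos m) (rights a ns).
Proof. by move=> adm; split; [apply: admissible_filter|apply: filter_all]. Qed.

Lemma leftsP a ns : admissible ns ->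
  admissible (reflect_nodes (lefts a ns)) /\
  all (fun m => - a < pos m) (reflect_nodes (lefts a ns)).
Proof.
move=> adm; rewrite admissible_reflect; split; first exact: admissible_filter.
rewrite /reflect_nodes all_rev all_map /lefts; apply/allP => m.
by rewrite mem_filter => /andP[ma _] /=; rewrite /reflect_node /pos /= ltrN2.
Qed.

Lemma wronskian_values a L ns :
  (state (L ++ ns)).2 = value a ns * value (- a) (reflect_nodes L)
   - expR (a / 2) *: (state ns).1 * value (- a) (reflect_nodes L)
   - value a ns * (expR (- a / 2) *: (state (reflect_nodes L)).1).
Proof.
rewrite state_end_wronskian value_reflect /value -!mul_polyC.
have : (expR (a / 2))%:P * (expR (- a / 2))%:P = 1 :> {poly R}.
  by rewrite -polyCM -expRD mulNr subrr expR0.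
move: (expR (a / 2))%:P (expR (- a / 2))%:P => e e' ee.
move: (state ns) (state (reflect_nodes L)) => [s1 s2] [t1 t2] /=.
apply/eqP; rewrite -subr_eq0; apply/eqP.
by transitivity ((1 - e * e') * (s2 * t2 - s1 * t1)); [ring|rewrite ee subrr mul0r].
Qed.

(** The behaviour of [W / (phi_+ phi_-)] at infinity. Dividing [wronskian_values]
    by [phi_+ phi_-] leaves [1] minus two quotients that have limits at most [0] by
    [state_asymp]; if [a] is a node its coupling is subtracted too and dominates. *)
Lemma green_degree a ns (p := value a (rights a ns))
    (h := value (- a) (reflect_nodes (lefts a ns))) :
  admissible ns ->
  (exists2 c, 0 < c & (size ((state ns).2 - c *: (p * h))%R < size (p * h)%R)%N) \/
  (size (p * h)%R < size (state ns).2)%N.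
Proof.
move=> adm.
have [admR allR] := rightsP a adm; have [admL allL] := leftsP a adm.
have [r r0 sr] := state_asymp admR allR; rewrite -/p in sr.
have [s s0 ss] := state_asymp admL allL; rewrite -/h in ss.
have p0 : p != 0 by apply: value_neq0.
have h0 : h != 0 by apply: value_neq0.
pose c := 1 + r + s; have c0 : 0 < c by rewrite /c -addrA ltr_wpDr ?addr_ge0.
have sL (f g k : {poly R}) : k != 0 -> (size f < size g)%N ->
    (size (f * k)%R < size (g * k)%R)%N.
  move=> k0 fg; have g0 : g != 0 by rewrite -size_poly_gt0 (leq_ltn_trans _ fg).
  have [->|f0] := eqVneq f 0; first by rewrite mul0r size_poly0 size_poly_gt0 mulf_neq0.
  rewrite !size_mul // -!subn1 ltn_sub2r ?ltn_add2r //.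
  by rewrite (leq_trans _ (leq_addr _ _)) // (leq_ltn_trans _ fg) // size_poly_gt0.
have main : (size ((state (lefts a ns ++ rights a ns)).2 - c *: (p * h))%R < size (p * h)%R)%N.
  rewrite (wronskian_values a) -/p -/h.
  set A := expR _ *: _ in sr *; set B := expR _ *: _ in ss *.
  have -> : p * h - A * h - p * B - c *: (p * h) = - ((A + r *: p) * h) - (B + s *: h) * p.
    by rewrite /c -!mul_polyC !polyCD; ring.
  rewrite (leq_ltn_trans (size_polyD _ _)) // gtn_max !size_polyN sL //=.
  by rewrite [p * h]mulrC sL.
have spc : size (c *: (p * h))%R = size (p * h)%R by rewrite size_scale ?gt_eqF.
case: (split_nodes a adm) => [nsE|[m ma nsE]].
  by left; exists c => //; rewrite {1}nsE.
right; rewrite {1}nsE (wronskian_values a).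
have at_node ns' : (value a (m :: ns') = value a ns') *
    (expR (a / 2) *: (state (m :: ns')).1 =
     expR (a / 2) *: (state ns').1 + pcoupling m * value a ns').
  rewrite -ma value_cons; split=> //.
  by rewrite state_cons /cross /= scalerDr scalerAr -value_kick.
rewrite !at_node -/h -/p.
have := wronskian_values a (lefts a ns) (rights a ns); rewrite -/p -/h => WE.
set A := expR _ *: _ in WE *; set B := expR _ *: _ in WE *.
have -> : p * h - (A + pcoupling m * p) * h - p * B =
  - (pcoupling m * (p * h)) + (state (lefts a ns ++ rights a ns)).2.
  by rewrite WE; ring.
have sc : (1 < size (pcoupling m))%N.
  apply: size_coupling; case/andP: adm => _ /allP /(_ m).
  by rewrite nsE mem_cat mem_head orbT => /(_ isT) /andP[].
have sW : (size (state (lefts a ns ++ rights a ns)).2 <= size (p * h)%R)%N.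
  rewrite -[(state (lefts a ns ++ rights a ns)).2](subrK (c *: (p * h))).
  by rewrite (leq_trans (size_polyD _ _)) // geq_max spc leqnn (ltnW main).
have scp : (size (p * h)%R < size (pcoupling m * (p * h))%R)%N.
  rewrite (size_mul _ (mulf_neq0 p0 h0)); last by rewrite -size_poly_gt0 (ltn_trans _ sc).
  by case: (size (pcoupling m)) sc => [|[|q]] // _; rewrite addSn /= addSn ltnS leq_addl.
by rewrite size_polyDl size_polyN // (leq_ltn_trans sW).
Qed.

End Green.

(** * Solutions of the differential equation *)

Section RealSolutions.
Context {R : realType}.
Implicit Types (f g : R -> R) (a b x y : R).

Definition hyp a b x : R := expR (x / 2) * a + expR (- x / 2) * b.
Definition hyp' a b x : R := 2^-1 * (expR (x / 2) * a - expR (- x / 2) * b).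

Global Instance is_derive_exp_half (c : R) x :
  is_derive x 1 (fun t => expR (t * c)) (expR (x * c) * c).
Proof.
have H : is_derive x 1 (fun t : R => t * c) c.
  by apply: is_derive_eq; rewrite scaler0 add0r /GRing.scale /= mulr1.
by apply: (is_derive_eq (is_derive1_comp (is_derive_expR _) H)).
Qed.

Lemma is_derive_hyp a b x : is_derive x 1 (hyp a b) (hyp' a b x).
Proof.
have -> : hyp a b = (fun t => expR (t * 2^-1) * a + expR (t * - 2^-1) * b).
  by apply/funext => t; rewrite /hyp mulrN mulNr.
apply: is_derive_eq; rewrite /hyp' !(scaler0, add0r, addr0) /GRing.scale /= mulNr !mulrN.
ring.
Qed.

Lemma is_derive_hyp' a b x : is_derive x 1 (hyp' a b) (4^-1 * hyp a b x).
Proof.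
have -> : hyp' a b = (fun t => 2^-1 * (expR (t * 2^-1) * a - expR (t * - 2^-1) * b)).
  by apply/funext => t; rewrite /hyp' mulrN mulNr.
apply: is_derive_eq; rewrite /hyp !(scaler0, add0r, addr0) /GRing.scale /= mulNr !mulrN.
by field.
Qed.

Lemma derive_continuous f x df : is_derive x 1 f df -> f t @[t --> x] --> f x.
Proof. by case=> H _; apply/differentiable_continuous/derivable1_diffP. Qed.

Lemma const_of_derive0 g x y : x <= y ->
  (forall t, x <= t <= y -> is_derive t 1 g 0) -> g x = g y.
Proof.
move=> xy H.
have H1 t : t \in `]x, y[%R -> is_derive t 1 g ((fun=> 0) t).
  by rewrite in_itv /= => /andP[xt ty]; apply: H; rewrite !ltW.
have H2 : {within `[x, y], continuous g}.
  apply: derivable_within_continuous => t; rewrite in_itv /= => txy.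
  by have [] := H t txy.
have [t _] := MVT_segment xy H1 H2.
by rewrite mul0r => /eqP; rewrite subr_eq0 eq_sym => /eqP.
Qed.

(** On an interval without nodes the coefficients of [e^(x/2)] and [e^(-x/2)]
    are recovered from [f] and [f'], and do not move. *)
Lemma hyp_coef_const f g x y : x <= y ->
  (forall t, x <= t <= y -> is_derive t 1 f (g t) /\ is_derive t 1 g (4^-1 * f t)) ->
  (expR (- x / 2) * (2^-1 * f x + g x) = expR (- y / 2) * (2^-1 * f y + g y)) /\
  (expR (x / 2) * (2^-1 * f x - g x) = expR (y / 2) * (2^-1 * f y - g y)).
Proof.
move=> xy H; split.
- have E t : expR (- t / 2) * (2^-1 * f t + g t) = expR (t * - 2^-1) * (2^-1 * f t + g t).
    by rewrite mulrN mulNr.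
  apply: (etrans (E x)); apply: etrans (esym (E y)).
  apply: (@const_of_derive0 (fun t => expR (t * - 2^-1) * (2^-1 * f t + g t))) xy _.
  move=> t /H [H1 H2]; apply: is_derive_eq.
  by rewrite ?(scaler0, add0r, addr0) /GRing.scale /= ; field.
- rewrite -![_ / 2]/(_ * 2^-1).
  apply: (@const_of_derive0 (fun t => expR (t * 2^-1) * (2^-1 * f t - g t))) xy _.
  move=> t /H [H1 H2]; apply: is_derive_eq.
  by rewrite ?(scaler0, add0r, addr0) /GRing.scale /= ; field.
Qed.

End RealSolutions.

Section Continuation.
Context {R : realType}.
Implicit Types (f g : R -> R) (a b x y d : R) (ns : seq (node R)).

Lemma cvg_limit_eq (F : set_system R) (PF : ProperFilter F) f g (l l' : R) :
  f @ F --> l -> g @ F --> l' -> (\forall t \near F, f t = g t) -> l = l'.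
Proof.
move=> fl gl' fg; apply: (cvg_unique _ fl) => //.
by apply: cvg_trans gl'; apply: near_eq_cvg; apply: filterS fg => t ->.
Qed.

Lemma hyp_continuous a b x : hyp a b t @[t --> x] --> hyp a b x.
Proof. exact: derive_continuous (is_derive_hyp a b x). Qed.

Lemma hyp'_continuous a b x : hyp' a b t @[t --> x] --> hyp' a b x.
Proof. exact: derive_continuous (is_derive_hyp' a b x). Qed.

Lemma right_limit f g x y a b d : x < y ->
  (forall t, x < t <= y -> f t = hyp a b t /\ g t = hyp' a b t) ->
  f t @[t --> x] --> f x -> g t @[t --> x^'+] --> d ->
  f x = hyp a b x /\ d = hyp' a b x.
Proof.
move=> xy H fx gd.
have nr : \forall t \near x^'+, x < t <= y.
  near=> t; apply/andP; split; near: t; first exact: nbhs_right_gt.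
  exact: nbhs_right_ltW.
split.
- apply: (@cvg_limit_eq x^'+ _ f (hyp a b)).
  + exact: cvg_at_right_filter.
  + by apply: cvg_at_right_filter; apply: hyp_continuous.
  + by apply: filterS nr => t /H[].
- apply: (@cvg_limit_eq x^'+ _ g (hyp' a b)) => //.
  + by apply: cvg_at_right_filter; apply: hyp'_continuous.
  + by apply: filterS nr => t /H[].
Unshelve. all: by end_near. Qed.

Lemma left_limit f g x y a b d : y < x ->
  (forall t, y <= t < x -> f t = hyp a b t /\ g t = hyp' a b t) ->
  f t @[t --> x] --> f x -> g t @[t --> x^'-] --> d ->
  f x = hyp a b x /\ d = hyp' a b x.
Proof.
move=> xy H fx gd.
have nr : \forall t \near x^'-, y <= t < x.
  near=> t; apply/andP; split; near: t; last exact: nbhs_left_lt.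
  exact: nbhs_left_ge.
split.
- apply: (@cvg_limit_eq x^'- _ f (hyp a b)).
  + exact: cvg_at_left_filter.
  + by apply: cvg_at_left_filter; apply: hyp_continuous.
  + by apply: filterS nr => t /H[].
- apply: (@cvg_limit_eq x^'- _ g (hyp' a b)) => //.
  + by apply: cvg_at_left_filter; apply: hyp'_continuous.
  + by apply: filterS nr => t /H[].
Unshelve. all: by end_near. Qed.

Definition chyp (s : R[i] * R[i]) x : R[i] :=
  (expR (x / 2))%:C * s.1 + (expR (- x / 2))%:C * s.2.
Definition chyp' (s : R[i] * R[i]) x : R[i] :=
  (2^-1)%:C * ((expR (x / 2))%:C * s.1 - (expR (- x / 2))%:C * s.2).

Lemma Re_chyp s x : complex.Re (chyp s x) = hyp (complex.Re s.1) (complex.Re s.2) x.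
Proof.
case: s => [[a a'] [b b']]; rewrite /chyp /hyp /real_complex_def /=; simpc; ring.
Qed.

Lemma Im_chyp s x : complex.Im (chyp s x) = hyp (complex.Im s.1) (complex.Im s.2) x.
Proof.
case: s => [[a a'] [b b']]; rewrite /chyp /hyp /real_complex_def /=; simpc; ring.
Qed.

Lemma Re_chyp' s x : complex.Re (chyp' s x) = hyp' (complex.Re s.1) (complex.Re s.2) x.
Proof.
case: s => [[a a'] [b b']]; rewrite /chyp' /hyp' /real_complex_def /=; simpc; ring.
Qed.

Lemma Im_chyp' s x : complex.Im (chyp' s x) = hyp' (complex.Im s.1) (complex.Im s.2) x.
Proof.
case: s => [[a a'] [b b']]; rewrite /chyp' /hyp' /real_complex_def /=; simpc; ring.
Qed.

Lemma quarterC : (4^-1 : R[i]) = (4^-1)%:C.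
Proof. by rewrite fmorphV rmorph_nat. Qed.

Lemma Re_realM (a : R) (w : R[i]) :
  (complex.Re (a%:C * w) = a * complex.Re w) * (complex.Im (a%:C * w) = a * complex.Im w).
Proof. by case: w => w w'; rewrite /real_complex_def /=; simpc. Qed.

Lemma exp_halfC x : (expR (x / 2))%:C * (expR (- x / 2))%:C = 1 :> R[i].
Proof. by rewrite -rmorphM -expRD mulNr subrr expR0. Qed.

Lemma chyp_kick (z : R[i]) m s :
  chyp s (pos m) = (expR (pos m / 2))%:C * kick (real_complex R) m s.
Proof.
rewrite /chyp /kick mulrDr mulrA -rmorphM -expRD; congr (_ + (expR _)%:C * _).
by field.
Qed.

(** The linear system behind a node: [e] and [e'] are the exponentials at the node,
    [h] is one half. *)
Lemma jump_algebra (F : comNzRingType) (e e' h c a b a' b' : F)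
    (f := e * a + e' * b) :
  e * e' = 1 -> h * 2 = 1 -> e * a' + e' * b' = f ->
  h * (e * a' - e' * b') = h * (e * a - e' * b) + c * f ->
  a' = a + c * (e' * f) /\ b' = b - e * e * (c * (e' * f)).
Proof.
move=> ee h2 E1 E2.
have Ha : e * (a' - a) = c * f.
  transitivity (h * 2 * (e * (a' - a))); first by rewrite h2 mul1r.
  transitivity (h * (e * a' + e' * b' - f) +
    (h * (e * a' - e' * b') - h * (e * a - e' * b))); first by rewrite /f; ring.
  by rewrite E1 subrr mulr0 add0r E2 addrC addKr.
have Hb : e' * (b' - b) = - (c * f).
  rewrite -Ha; apply/eqP; rewrite -subr_eq0 opprK; apply/eqP.
  transitivity (e * a' + e' * b' - f); first by rewrite /f; ring.
  by rewrite E1 subrr.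
clearbody f; split; apply/eqP; rewrite -subr_eq0; apply/eqP.
- transitivity (e' * (e * (a' - a) - c * f) + (1 - e * e') * (a' - a)); first by ring.
  by rewrite Ha ee !(subrr, mulr0, mul0r, addr0).
- transitivity (e * (e' * (b' - b) + c * f) + (1 - e * e') * (b' - b) - (1 - e * e') * e * c * f).
    by ring.
  by rewrite Hb ee addNr !(subrr, mulr0, mul0r, addr0).
Qed.

(** The coefficients on the two sides of a node are determined by the value
    there and the jump of the derivative. *)
Lemma node_jump (z : R[i]) m s s' (c := coupling (real_complex R) z m) :
  chyp s' (pos m) = chyp s (pos m) ->
  chyp' s' (pos m) = chyp' s (pos m) + c * chyp s (pos m) ->
  s' = cross (real_complex R) z m s.
Proof.
rewrite /cross -/c => E1 E2.
have kE : kick (real_complex R) m s = (expR (- pos m / 2))%:C * chyp s (pos m).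
  by rewrite (chyp_kick z) mulrA [_%:C * _]mulrC exp_halfC mul1r.
have e2 : (expR (pos m))%:C = (expR (pos m / 2))%:C * (expR (pos m / 2))%:C :> R[i].
  by rewrite -rmorphM -expRD; congr (expR _)%:C; field.
rewrite kE /= e2; have h2 : (2^-1)%:C * 2 = 1 :> R[i].
  by rewrite fmorphV rmorph_nat mulVf // pnatr_eq0.
move: E1 E2 (exp_halfC (pos m)); rewrite /chyp /chyp'.
move: (expR _)%:C (expR _)%:C c => e' e c.
case: s s' {kE} => [a b] [a' b'] /= E1 E2 ee.
by have [-> ->] := jump_algebra ee h2 E1 E2.
Qed.

Lemma cross_jump (z : R[i]) m s (c := coupling (real_complex R) z m)
   (s' := cross (real_complex R) z m s) :
  chyp s' (pos m) = chyp s (pos m) /\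
  chyp' s' (pos m) = chyp' s (pos m) + c * chyp s (pos m).
Proof.
have kE : kick (real_complex R) m s = (expR (- pos m / 2))%:C * chyp s (pos m).
  by rewrite (chyp_kick z) mulrA [_%:C * _]mulrC exp_halfC mul1r.
split; first by rewrite !(chyp_kick z) kick_cross.
rewrite /s' /cross -/c kE.
have e2 : (expR (pos m))%:C = (expR (pos m / 2))%:C * (expR (pos m / 2))%:C :> R[i].
  by rewrite -rmorphM -expRD; congr (expR _)%:C; field.
have h2 : (2^-1)%:C * 2 = 1 :> R[i].
  by rewrite fmorphV rmorph_nat mulVf // pnatr_eq0.
rewrite /= e2 /chyp'; move: (chyp s _) (exp_halfC (pos m)) => F.
move: (expR _)%:C (expR _)%:C {kE} => e' e ee /=.
transitivity ((2^-1)%:C * (e * s.1 - e' * s.2) + ((2^-1)%:C * 2) * (c * F)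
  + ((e * e') * (1 + (e * e')) - 2) * (2^-1)%:C * (c * F)); first by ring.
by rewrite h2 ee; ring.
Qed.

End Continuation.

Section Solutions.
Context {R : realType}.
Implicit Types (p : mpair R) (z : R[i]) (f : R -> R[i]) (x y : R)
  (m : node R) (ns : seq (node R)) (s : R[i] * R[i]).

Local Notation cshoot z := (shoot (real_complex R) z).

(** The solution with coefficients [s] near [+oo]. *)
Definition continuation z s ns x : R[i] := chyp (cshoot z s (rights x ns)) x.

Lemma nodes_admissible p : admissible (nodes p).
Proof. by rewrite /admissible nodes_sorted nodes_mass. Qed.

Lemma eq_complexP (a b : R[i]) :
  complex.Re a = complex.Re b -> complex.Im a = complex.Im b -> a = b.
Proof. by case: a b => [a a'] [b b'] /= -> ->. Qed.

(** The coefficients of the two exponentials, recovered from value and derivative. *)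
Definition coefs (f g : R -> R[i]) x : R[i] * R[i] :=
  ((expR (- x / 2))%:C * ((2^-1)%:C * f x + g x),
   (expR (x / 2))%:C * ((2^-1)%:C * f x - g x)).

Lemma coefsE f g x : (f x = chyp (coefs f g x) x) * (g x = chyp' (coefs f g x) x).
Proof.
have h2 : (2^-1)%:C * 2 = 1 :> R[i].
  by rewrite fmorphV rmorph_nat mulVf // pnatr_eq0.
have := exp_halfC x; rewrite /chyp /chyp' /coefs /=.
move: (f x) (g x) => u v; move: (expR (x / 2))%:C (expR (- x / 2))%:C => e e' ee.
split.
- transitivity ((e * e') * (((2^-1)%:C * 2) * u)); last by ring.
  by rewrite ee h2 !mul1r.
- transitivity ((e * e') * (((2^-1)%:C * 2) * v)); last by ring.
  by rewrite ee h2 !mul1r.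
Qed.

Section FromSolution.
Variables (p : mpair R) (z : R[i]) (f g : R -> R[i]).
Hypothesis fc : Ccontinuous f.
Hypothesis fg : forall x, x \notin map pos (nodes p) ->
  Cis_derive x f (g x) /\
  exists2 f'' : R[i], Cis_derive x g f'' & - f'' + 4^-1 * f x = 0.
Hypothesis jump : forall m, m \in nodes p ->
  exists dl dr : R[i],
    [/\ Ccvg ((pos m)^'-) g dl, Ccvg ((pos m)^'+) g dr &
        dl = dr + z * (wgt m)%:C * f (pos m) + z ^+ 2 * (dip m)%:C * f (pos m)].

Lemma coefs_const x y : x <= y ->
  (forall m, m \in nodes p -> ~~ (x <= pos m <= y)) -> coefs f g x = coefs f g y.
Proof.
move=> xy nn.
have H t : x <= t <= y ->
    (is_derive t 1 (fun u => complex.Re (f u)) (complex.Re (g t)) /\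
     is_derive t 1 (fun u => complex.Re (g u)) (4^-1 * complex.Re (f t))) /\
    (is_derive t 1 (fun u => complex.Im (f u)) (complex.Im (g t)) /\
     is_derive t 1 (fun u => complex.Im (g u)) (4^-1 * complex.Im (f t))).
  move=> txy; have tn : t \notin map pos (nodes p).
    by apply/mapP => -[m /nn + tE]; rewrite -tE txy.
  have [[f1 f2] [w [g1 g2] /eqP]] := fg tn.
  rewrite addrC subr_eq0 quarterC => /eqP wE; rewrite -wE in g1 g2.
  by rewrite !Re_realM in g1 g2.
have [A1 B1] := hyp_coef_const xy (fun t txy => (H t txy).1).
have [A2 B2] := hyp_coef_const xy (fun t txy => (H t txy).2).
rewrite /coefs; congr (_, _); apply: eq_complexP; rewrite !Re_realM.
- move: A1; move: (f x) (g x) (f y) (g y) => [? ?] [? ?] [? ?] [? ?] /=.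
  by rewrite /real_complex_def; simpc => /= ->.
- move: A2; move: (f x) (g x) (f y) (g y) => [? ?] [? ?] [? ?] [? ?] /=.
  by rewrite /real_complex_def; simpc => /= ->.
- move: B1; move: (f x) (g x) (f y) (g y) => [? ?] [? ?] [? ?] [? ?] /=.
  by rewrite /real_complex_def; simpc => /= ->.
- move: B2; move: (f x) (g x) (f y) (g y) => [? ?] [? ?] [? ?] [? ?] /=.
  by rewrite /real_complex_def; simpc => /= ->.
Qed.

Lemma coefs_Re s x : coefs f g x = s ->
  (complex.Re (f x) = hyp (complex.Re s.1) (complex.Re s.2) x /\
   complex.Re (g x) = hyp' (complex.Re s.1) (complex.Re s.2) x) /\
  (complex.Im (f x) = hyp (complex.Im s.1) (complex.Im s.2) x /\
   complex.Im (g x) = hyp' (complex.Im s.1) (complex.Im s.2) x).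
Proof.
move=> <-; rewrite -!Re_chyp -!Re_chyp' -!Im_chyp -!Im_chyp'.
by rewrite -!coefsE.
Qed.

(** The coefficients do not move on either side of the node, so the one-sided limits
    of the derivative there are those of the exponential expressions, and the jump
    condition relates them. *)
Lemma coefs_cross m x y : m \in nodes p -> x < pos m < y ->
  (forall m', m' \in nodes p -> m' != m -> ~~ (x <= pos m' <= y)) ->
  (forall m', m' \in nodes p -> pos m' = pos m -> m' = m) ->
  f (pos m) = chyp (coefs f g y) (pos m) /\
  coefs f g x = cross (real_complex R) z m (coefs f g y).
Proof.
move=> min /andP[xm my] only uniq_pos.
have away t : x <= t <= y -> t != pos m -> forall m', m' \in nodes p -> ~~ (t <= pos m' <= t).
  move=> txy tm m' m'in; apply/negP => /andP[t1 t2].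
  have tE : t = pos m' by apply/le_anti; rewrite t1 t2.
  have [mE|ne] := eqVneq m' m; first by rewrite tE mE eqxx in tm.
  by have := only m' m'in ne; rewrite -tE txy.
have right t : pos m < t <= y -> coefs f g t = coefs f g y.
  move=> /andP[mt ty]; apply: coefs_const => // m' m'in.
  have [->|ne] := eqVneq m' m; first by rewrite leNgt mt.
  apply: contra (only m' m'in ne) => /andP[tm' ->].
  by rewrite andbT ltW // (lt_trans xm) // (lt_le_trans mt).
have left t : x <= t < pos m -> coefs f g t = coefs f g x.
  move=> /andP[xt tm]; apply/esym/coefs_const => // m' m'in.
  have [->|ne] := eqVneq m' m; first by rewrite [_ <= t]leNgt tm andbF.
  apply: contra (only m' m'in ne) => /andP[-> m't] /=.
  by rewrite ltW // (le_lt_trans m't) // (lt_trans tm).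
have [dl [dr [[l1 l2] [r1 r2] J]]] := jump min.
have [c1 c2] := fc (pos m).
have [fR dR] := @right_limit _ (fun t => complex.Re (f t)) (fun t => complex.Re (g t)) _ _ _ _ _ my
   (fun t ht => (coefs_Re (right t ht)).1) c1 r1.
have [fI dI] := @right_limit _ (fun t => complex.Im (f t)) (fun t => complex.Im (g t)) _ _ _ _ _ my
   (fun t ht => (coefs_Re (right t ht)).2) c2 r2.
have [fR' dR'] := @left_limit _ (fun t => complex.Re (f t)) (fun t => complex.Re (g t)) _ _ _ _ _ xm
   (fun t ht => (coefs_Re (left t ht)).1) c1 l1.
have [fI' dI'] := @left_limit _ (fun t => complex.Im (f t)) (fun t => complex.Im (g t)) _ _ _ _ _ xm
   (fun t ht => (coefs_Re (left t ht)).2) c2 l2.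
have fE : f (pos m) = chyp (coefs f g y) (pos m).
  by apply: eq_complexP; rewrite ?Re_chyp ?Im_chyp.
have fE' : f (pos m) = chyp (coefs f g x) (pos m).
  by apply: eq_complexP; rewrite ?Re_chyp ?Im_chyp.
have drE : dr = chyp' (coefs f g y) (pos m).
  by apply: eq_complexP; rewrite ?Re_chyp' ?Im_chyp'.
have dlE : dl = chyp' (coefs f g x) (pos m).
  by apply: eq_complexP; rewrite ?Re_chyp' ?Im_chyp'.
split=> //; apply: node_jump; first by rewrite -fE -fE'.
by rewrite -dlE -drE -fE J /coupling mulrDl addrA.
Qed.

Lemma rights_cons_inv x m ns ns' : admissible ns -> rights x ns = m :: ns' ->
  [/\ m \in ns, x < pos m, rights (pos m) ns = ns' &
      forall m', m' \in ns -> x < pos m' -> pos m <= pos m'].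
Proof.
move=> adm E.
have : admissible (rights x ns) by apply: admissible_filter.
rewrite E admissible_cons => /and4P[/allP mns' _ _ _].
have : m \in rights x ns by rewrite E mem_head.
rewrite mem_filter => /andP[xm min]; split => //; last first.
  move=> m' m'in xm'; have : m' \in rights x ns by rewrite mem_filter xm'.
  by rewrite E inE => /predU1P[->//|/mns'/ltW].
have -> : rights (pos m) ns = rights (pos m) (rights x ns).
  rewrite /rights -filter_predI; apply: eq_filter => m' /=.
  by case: ltP => // mm'; rewrite (lt_trans xm).
rewrite E /rights /= ltxx -[RHS]filter_predT; apply: eq_in_filter => m' /mns'.
by move=> ->.
Qed.

Lemma uniq_pos ns m m' : admissible ns -> m \in ns -> m' \in ns ->
  pos m' = pos m -> m' = m.
Proof.
move=> adm min m'in E.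
have at_pos q m0 : q \in ns -> pos q = pos m ->
    ns = lefts (pos m) ns ++ m0 :: rights (pos m) ns -> q = m0.
  move=> + qE nsE; rewrite nsE mem_cat inE !mem_filter qE ltxx /=.
  by rewrite orbF => /eqP.
case: (split_nodes (pos m) adm) => [nsE|[m0 _ nsE]].
  by move: min; rewrite nsE mem_cat !mem_filter ltxx.
by rewrite (at_pos _ m0 m'in E nsE) (at_pos _ m0 min erefl nsE).
Qed.

Lemma exists_gap_left m ns : exists2 y, y < pos m & forall m', m' \in ns -> pos m' < pos m -> pos m' < y.
Proof.
elim: ns => [|m' ns [y my Hy]]; first by exists (pos m - 1) => //; rewrite gtrBl.
have [mm'|] := ltP (pos m') (pos m); last first.
  move=> m'm; exists y => // m''; rewrite inE => /predU1P[->|/Hy//].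
  by rewrite ltNge m'm.
exists (Order.max y ((pos m' + pos m) / 2)).
  by rewrite gt_max my /= midf_lt.
move=> m''; rewrite inE => /predU1P[->|/Hy H] H'; rewrite lt_max ?H //.
by rewrite [X in _ || X]midf_lt // orbT.
Qed.

Lemma exists_above ns : exists b, forall m, m \in ns -> pos m < b.
Proof.
elim: ns => [|m ns [b Hb]]; first by exists 0.
exists (Order.max b (pos m + 1)) => m'; rewrite inE => /predU1P[->|/Hb H].
  by rewrite lt_max ltrDl ltr01 orbT.
by rewrite lt_max H.
Qed.

Lemma exists_gap m ns : exists2 y, pos m < y & forall m', m' \in ns -> pos m < pos m' -> y < pos m'.
Proof.
elim: ns => [|m' ns [y my Hy]]; first by exists (pos m + 1) => //; rewrite ltrDl.
have [mm'|] := ltP (pos m) (pos m'); last first.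
  move=> m'm; exists y => // m''; rewrite inE => /predU1P[->|/Hy//].
  by rewrite ltNge m'm.
exists (Order.min y ((pos m + pos m') / 2)).
  by rewrite lt_min my /= midf_lt.
move=> m''; rewrite inE => /predU1P[->|/Hy H] H'; rewrite gt_min ?H //.
by rewrite [X in _ || X]midf_lt // orbT.
Qed.

(** Induction on the number of nodes to the right of the point, one [coefs_cross] at
    each node. *)
Lemma solution_continuation : exists s, forall x, f x = continuation z s (nodes p) x.
Proof.
have adm := nodes_admissible p.
have [b bP] := exists_above (nodes p).
have nE m y : pos m < y -> (forall m', m' \in nodes p -> pos m < pos m' -> y < pos m') ->
    rights y (nodes p) = rights (pos m) (nodes p) /\ y \notin map pos (nodes p).
  move=> my Hy; split.
    apply: eq_in_filter => m' m'in; apply/idP/idP => H; first exact: lt_trans H.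
    exact: Hy.
  by apply/mapP => -[m' m'in yE]; have := Hy m' m'in; rewrite -yE ltxx => /(_ my).
have main ns x : rights x (nodes p) = ns -> x \notin map pos (nodes p) ->
    coefs f g x = cshoot z (coefs f g b) ns.
  elim: ns x => [|m ns IH] x xE xn.
    have le m : m \in nodes p -> pos m < x.
      move=> min; rewrite lt_neqAle; apply/andP; split.
        by apply: contraNneq xn => <-; apply: map_f.
      rewrite leNgt; apply/negP => xm.
      have : m \in rights x (nodes p) by rewrite mem_filter xm.
      by rewrite xE.
    have [xb|/ltW bx] := leP x b.
      apply: coefs_const => // m min; apply/negP => /andP[xm _].
      by have := le m min; rewrite ltNge xm.
    apply/esym/coefs_const => // m min; apply/negP => /andP[bm _].
    by have := bP m min; rewrite ltNge bm.
  have [min xm xE' minm] := rights_cons_inv adm xE.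
  have [y my Hy] := exists_gap m (nodes p).
  have [yE yn] := nE m y my Hy.
  have [_ ->] : f (pos m) = chyp (coefs f g y) (pos m) /\ coefs f g x = cross (real_complex R) z m (coefs f g y).
    apply: coefs_cross => //; first by rewrite xm.
      move=> m' m'in ne; apply/negP => /andP[xm' m'y].
      have lt_xm' : x < pos m'.
        rewrite lt_neqAle xm' andbT; apply: contraNneq xn => ->; exact: map_f.
      have := minm m' m'in lt_xm'; rewrite le_eqVlt => /orP[/eqP E|lt_mm'].
        by move: ne; rewrite (uniq_pos adm min m'in) // eqxx.
      by have := Hy m' m'in lt_mm'; rewrite ltNge m'y.
    by move=> m' m'in; apply: uniq_pos adm min m'in.
  by rewrite (IH y) // yE.
exists (coefs f g b) => x; rewrite /continuation.
have [/mapP[m min ->]|xn] := boolP (x \in map pos (nodes p)); last first.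
  by rewrite -(main _ _ erefl xn) -coefsE.
have [y my Hy] := exists_gap m (nodes p).
have [x' xm Hx] := exists_gap_left m (nodes p).
have [yE yn] := nE m y my Hy.
have [-> _] : f (pos m) = chyp (coefs f g y) (pos m) /\ 
    coefs f g x' = cross (real_complex R) z m (coefs f g y).
  apply: coefs_cross => //; first by rewrite xm.
    move=> m' m'in ne; apply/negP => /andP[xm' m'y].
    have [m'm|mm'|E] := ltgtP (pos m') (pos m).
    - by have := Hx m' m'in m'm; rewrite ltNge xm'.
    - by have := Hy m' m'in mm'; rewrite ltNge m'y.
    - by move: ne; rewrite (uniq_pos adm min m'in) // eqxx.
  by move=> m' m'in; apply: uniq_pos adm min m'in.
by rewrite (main _ _ erefl yn) yE.
Qed.

End FromSolution.

(** The nodes crossed just to the left of [x]. *)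
Definition rights_ge x ns := [seq m <- ns | x <= pos m].

Lemma near_order x ns : \forall t \near x, forall m, m \in ns ->
  (x < pos m -> t < pos m) /\ (pos m < x -> pos m < t).
Proof.
elim: ns => [|m ns IH]; first by near=> t => m; rewrite in_nil.
have H1 : \forall t \near x, x < pos m -> t < pos m.
  have [xm|] := ltP x (pos m); last by move=> _; near=> t.
  by apply: filterS (lt_nbhsl xm).
have H2 : \forall t \near x, pos m < x -> pos m < t.
  have [xm|] := ltP (pos m) x; last by move=> _; near=> t.
  by apply: filterS (lt_nbhsr xm).
near=> t => m'; rewrite inE => /predU1P[->|m'in].
  by split; [near: t|near: t].
by move: m' m'in; near: t.
Unshelve. all: by end_near. Qed.

Lemma near_rights x ns : \forall t \near x,
  (x <= t -> rights t ns = rights x ns) /\ (t < x -> rights t ns = rights_ge x ns).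
Proof.
apply: filterS (near_order x ns) => t H; split=> xt.
  apply: eq_in_filter => m /H[H1 H2]; apply/idP/idP => // tm; exact: le_lt_trans tm.
apply: eq_in_filter => m /H[H1 H2]; apply/idP/idP => tm.
  by rewrite leNgt; apply/negP => /H2; rewrite ltNge ltW.
exact: lt_le_trans tm.
Qed.

Lemma rights_geE x ns : admissible ns ->
  rights_ge x ns = rights x ns \/
  exists m, [/\ m \in ns, pos m = x & rights_ge x ns = m :: rights x ns].
Proof.
move=> adm.
have no L : rights_ge x (lefts x L) = [::].
  apply/eqP; rewrite -(negbK (_ == _)) -has_filter; apply/negP => /hasP[m].
  by rewrite mem_filter ltNge => /andP[/negPf ->].
have all L : rights_ge x (rights x L) = rights x L.
  apply/all_filterP/allP => m; rewrite mem_filter => /andP[/ltW].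
  by [].
case: (split_nodes x adm) => [nsE|[m mx nsE]]; [left|right].
  by rewrite {1}nsE /rights_ge filter_cat -!/(rights_ge _ _) no all.
exists m; split => //; first by rewrite nsE mem_cat mem_head orbT.
by rewrite {1}nsE /rights_ge filter_cat /= mx lexx -!/(rights_ge _ _) no all.
Qed.

Lemma Ccvg_chyp (F : set_system R) (PF : ProperFilter F) (f : R -> R[i]) s x :
  (forall (h : R -> R) (l : R), h t @[t --> x] --> l -> h t @[t --> F] --> l) ->
  (\forall t \near F, f t = chyp s t) -> Ccvg F f (chyp s x).
Proof.
move=> HF fE; rewrite /Ccvg Re_chyp Im_chyp; split.
- have H := HF (hyp (complex.Re s.1) (complex.Re s.2)) _ (@hyp_continuous _ _ _ x).
  apply: cvg_trans H; apply: near_eq_cvg.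
  by apply: filterS fE => t ->; rewrite Re_chyp.
- have H := HF (hyp (complex.Im s.1) (complex.Im s.2)) _ (@hyp_continuous _ _ _ x).
  apply: cvg_trans H; apply: near_eq_cvg.
  by apply: filterS fE => t ->; rewrite Im_chyp.
Qed.

Lemma Ccvg_chyp' (F : set_system R) (PF : ProperFilter F) (f : R -> R[i]) s x :
  (forall (h : R -> R) (l : R), h t @[t --> x] --> l -> h t @[t --> F] --> l) ->
  (\forall t \near F, f t = chyp' s t) -> Ccvg F f (chyp' s x).
Proof.
move=> HF fE; rewrite /Ccvg Re_chyp' Im_chyp'; split.
- have H := HF (hyp' (complex.Re s.1) (complex.Re s.2)) _ (@hyp'_continuous _ _ _ x).
  apply: cvg_trans H; apply: near_eq_cvg.
  by apply: filterS fE => t ->; rewrite Re_chyp'.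
- have H := HF (hyp' (complex.Im s.1) (complex.Im s.2)) _ (@hyp'_continuous _ _ _ x).
  apply: cvg_trans H; apply: near_eq_cvg.
  by apply: filterS fE => t ->; rewrite Im_chyp'.
Qed.

Lemma near_right_rights x ns : \forall t \near x^'+, rights t ns = rights x ns.
Proof.
near=> t; have [H _] : (x <= t -> rights t ns = rights x ns) /\ (t < x -> rights t ns = rights_ge x ns).
  near: t; apply: cvg_within; exact: near_rights.
apply: H; apply: ltW; near: t; exact: nbhs_right_gt.
Unshelve. all: by end_near. Qed.

Lemma near_left_rights x ns : \forall t \near x^'-, rights t ns = rights_ge x ns.
Proof.
near=> t; have [_ H] : (x <= t -> rights t ns = rights x ns) /\ (t < x -> rights t ns = rights_ge x ns).
  near: t; apply: cvg_within; exact: near_rights.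
apply: H; near: t; exact: nbhs_left_lt.
Unshelve. all: by end_near. Qed.

Lemma chyp_ge z s x ns : admissible ns ->
  chyp (cshoot z s (rights_ge x ns)) x = chyp (cshoot z s (rights x ns)) x.
Proof.
move=> /(rights_geE x)[->//|[m [_ <- ->]]] /=.
by have [] := cross_jump z m (cshoot z s (rights (pos m) ns)).
Qed.

Lemma continuation_solution p z s : solution p z (continuation z s (nodes p)).
Proof.
have adm := nodes_admissible p.
split.
  move=> x.
  have [r1 r2] := @Ccvg_chyp x^'+ _ (continuation z s (nodes p)) (cshoot z s (rights x (nodes p))) x
    (fun h l => @cvg_at_right_filter _ _ _ _ _)
    (filterS (fun t (H : rights t (nodes p) = rights x (nodes p)) =>
      congr1 (fun L => chyp (cshoot z s L) t) H) (near_right_rights x _)).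
  have [l1 l2] := @Ccvg_chyp x^'- _ (continuation z s (nodes p)) (cshoot z s (rights_ge x (nodes p))) x
    (fun h l => @cvg_at_left_filter _ _ _ _ _)
    (filterS (fun t (H : rights t (nodes p) = rights_ge x (nodes p)) =>
      congr1 (fun L => chyp (cshoot z s L) t) H) (near_left_rights x _)).
  rewrite chyp_ge // in l1 l2.
  by split; apply/left_right_continuousP.
exists (fun x => chyp' (cshoot z s (rights x (nodes p))) x); split.
  move=> x xn.
  have rE : rights_ge x (nodes p) = rights x (nodes p).
    case: (rights_geE x adm) => // -[m [min mx _]].
    by move/mapP: xn; case; exists m.
  set L := rights x (nodes p) in rE *.
  have nr : \forall t \near x, rights t (nodes p) = L.
    apply: filterS (near_rights x (nodes p)) => t [H1 H2].
    by have [/H1|/H2->] := leP x t.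
  have D1 : Cis_derive x (continuation z s (nodes p)) (chyp' (cshoot z s L) x).
    split; [rewrite Re_chyp'|rewrite Im_chyp'];
      apply: near_eq_is_derive (is_derive_hyp _ _ x); apply: filterS nr => t;
      rewrite /continuation => ->; by rewrite ?Re_chyp ?Im_chyp.
  split=> //; exists (4^-1 * continuation z s (nodes p) x); last by rewrite addNr.
  rewrite quarterC; split; rewrite Re_realM; [rewrite Re_chyp|rewrite Im_chyp];
      apply: near_eq_is_derive (is_derive_hyp' _ _ x); apply: filterS nr => t;
      move=> ->; by rewrite ?Re_chyp' ?Im_chyp'.
move=> m min; set x := pos m.
exists (chyp' (cshoot z s (rights_ge x (nodes p))) x), (chyp' (cshoot z s (rights x (nodes p))) x); split.
- apply: Ccvg_chyp'; first by move=> h l; apply: cvg_at_left_filter.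
  by apply: filterS (near_left_rights x (nodes p)) => t ->.
- apply: Ccvg_chyp'; first by move=> h l; apply: cvg_at_right_filter.
  by apply: filterS (near_right_rights x (nodes p)) => t ->.
- case: (rights_geE x adm) => [E|[m' [m'in m'x ->]]].
    have : m \in rights_ge x (nodes p) by rewrite mem_filter lexx.
    by rewrite E mem_filter ltxx.
  have -> : m' = m by apply: uniq_pos adm min m'in m'x.
  have [_ /= ->] := cross_jump z m (cshoot z s (rights x (nodes p))).
  by rewrite /coupling mulrDl addrA.
Qed.

End Solutions.

(** * Eigenvalues, eigenfunctions and norming constants as polynomial values *)

Section Spectrum.
Context {R : realType}.
Implicit Types (p : mpair R) (z : R[i]) (f : R -> R[i]) (x y l : R)
  (m : node R) (ns : seq (node R)) (s : R[i] * R[i]).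

Local Notation cshoot z := (shoot (real_complex R) z).

Lemma rights_above ns b x : (forall m, m \in ns -> pos m < b) -> b <= x ->
  rights x ns = [::].
Proof.
move=> H bx; apply/eqP; rewrite -(negbK (_ == _)) -has_filter; apply/negP => /hasP[m min].
by rewrite ltNge ltW // (lt_le_trans (H m min)).
Qed.

Lemma hyp_eq_decay (a b : R) B : (forall x, B < x -> hyp a b x = expR (- x / 2)) ->
  a = 0 /\ b = 1.
Proof.
move=> H; have E x : B < x -> expR x * a + b = 1.
  move=> /H; rewrite /hyp => /(congr1 (fun y => expR (x / 2) * y)).
  by rewrite mulrDr !mulrA -!expRD mulNr subrr expR0 mul1r => <-; congr (expR _ * _ + _); field.
have E1 := E (B + 1); have E2 := E (B + 2).
have a0 : a = 0.
  have : (expR (B + 2) - expR (B + 1)) * a = 0.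
    have [] : B < B + 1 /\ B < B + 2 by split; lra.
    by move=> /E1 e1 /E2 e2; rewrite mulrBl; apply/eqP; rewrite subr_eq0; apply/eqP; lra.
  move/eqP; rewrite mulf_eq0 subr_eq0 => /orP[/eqP/expR_inj|/eqP//]; lra.
by split=> //; move: E1; rewrite a0 mulr0 add0r; apply; lra.
Qed.

Lemma decay_continuation p z :
  \forall x \near +oo, continuation z (0, 1) (nodes p) x = (expR (- x / 2))%:C.
Proof.
have [b bP] := exists_above (nodes p).
near=> x; rewrite /continuation (rights_above bP) /=.
  by rewrite /chyp /= mulr0 add0r mulr1.
by near: x; apply: nbhs_pinfty_ge; apply: num_real.
Unshelve. all: by end_near. Qed.

(** Near [+oo] the coefficients are determined by the values, because the two exponentials
    are linearly independent there. *)
Lemma phi_plusE p z : phi_plus p z = continuation z (0, 1) (nodes p).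
Proof.
apply: xget_unique; first by split; [apply: continuation_solution|apply: decay_continuation].
move=> f [[fc [g [fg jump]]] fdec].
have [s fs] := solution_continuation fc fg jump.
have [b bP] := exists_above (nodes p).
suff -> : (0, 1) = s by apply/funext => x; rewrite fs.
have [B [_ HB]] := fdec.
pose B' := Order.max b B.
have tail x : B' < x -> chyp s x = (expR (- x / 2))%:C.
  rewrite gt_max => /andP[bx Bx]; rewrite -HB // fs /continuation (rights_above bP) //.
  exact: ltW.
have [a1 b1] : complex.Re s.1 = 0 /\ complex.Re s.2 = 1.
  by apply: (@hyp_eq_decay _ _ B') => x xB; rewrite -Re_chyp tail.
have tail2 x : B' < x -> hyp (complex.Im s.1) (complex.Im s.2 + 1) x = expR (- x / 2).
  move=> xB; have := tail x xB; move/(congr1 (@complex.Im R)); rewrite Im_chyp /=.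
  by rewrite /hyp mulrDr mulr1 addrA => ->; rewrite add0r.
have [a2 b2] := hyp_eq_decay tail2.
case: s a1 b1 a2 b2 {fs tail tail2} => [[s1 s1'] [s2 s2']] /= -> -> -> b2.
by congr (_, _ +i* _); lra.
Qed.

Lemma shoot_map_poly z ns :
  cshoot z (0, 1) ns = ((map_poly (real_complex R) (state ns).1).[z],
                        (map_poly (real_complex R) (state ns).2).[z]).
Proof.
have cz : commr_rmorph (real_complex R) z by move=> x; apply: mulrC.
have H0 x : horner_morph cz (polyC x) = real_complex R x by rewrite horner_morphC.
have := @shoot_morph R _ _ (@polyC R) (real_complex R) (horner_morph cz) 'X H0 (0, 1) ns.
by rewrite /= horner_morphX rmorph0 rmorph1.
Qed.

Lemma continuation_real l x ns :
  continuation l%:C (0, 1) ns x = ((value x (rights x ns)).[l])%:C.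
Proof.
rewrite /continuation shoot_map_poly /chyp /= /value hornerD !hornerZ.
by rewrite !(horner_map (real_complex R)) /= -!rmorphM -rmorphD.
Qed.

Lemma phi_plus_real p l x :
  phi_plus p l%:C x = ((value x (rights x (nodes p))).[l])%:C.
Proof. by rewrite phi_plusE continuation_real. Qed.

Lemma normc_real (x : R) : Normc.normc x%:C = `|x|.
Proof. by rewrite /real_complex_def /= expr0n addr0 sqrtr_sqr. Qed.

Lemma normc_0 : Normc.normc (0 : R[i]) = 0.
Proof. by rewrite -[RHS](normr0 R) -normc_real. Qed.

Lemma normc_1 : Normc.normc (1 : R[i]) = 1.
Proof. by rewrite -[RHS](normr1 R) -normc_real. Qed.

Lemma sum_rights (V : zmodType) ns (F : node R -> seq (node R) -> V) : admissible ns ->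
  \sum_(m <- ns) F m (rights (pos m) ns) =
  (fix S ns := if ns is m :: ns' then S ns' + F m ns' else 0) ns.
Proof.
elim: ns => [|m ns IH]; first by rewrite big_nil.
rewrite admissible_cons => /and4P[/allP mns _ _ adm]; rewrite big_cons -IH // addrC.
congr (_ + F _ _).
  rewrite big_seq [RHS]big_seq; apply: eq_bigr => m' /mns mm'.
  by rewrite /rights /= ltNge ltW.
rewrite /rights /= ltxx -[RHS]filter_predT; apply: eq_in_filter => m' /mns.
by move=> ->.
Qed.

Lemma gamma2E p l : gamma2 p l = (norming (nodes p)).[l].
Proof.
have adm := nodes_admissible p.
rewrite /gamma2 mulr_sumr -big_split /=.
pose F m ns := (value (pos m) ns).[l] ^+ 2 * (wgt m + 2 * l * dip m).
rewrite (eq_bigr (fun m => F m (rights (pos m) (nodes p)))); last first.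
  by move=> m _; rewrite phi_plus_real normc_real real_normK ?num_real // /F; ring.
rewrite sum_rights //; elim: (nodes p) => [|m ns IH] /=; first by rewrite horner0.
rewrite IH hornerD; congr (_ + _).
rewrite /F hornerM mulrC -!horner_exp; congr (_ * _).
rewrite /coupling expr2 !(derivD, derivM, derivC, derivX).
by rewrite !(mulr0, addr0, mul1r, mulr1) !hornerE /=; ring.
Qed.

Lemma eigenfunction_real p l x : eigenfunction p l x =
  ((value x (rights x (nodes p))).[l] / Num.sqrt (l * (norming (nodes p)).[l]))%:C.
Proof. by rewrite /eigenfunction phi_plus_real gamma2E -fmorph_div. Qed.

Lemma hyp_bounded_right (a b B M : R) : (forall x, B < x -> `|hyp a b x| <= M) -> a = 0.
Proof.
move=> H; apply/eqP/negPn/negP => a0.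
have na : 0 < `|a| by rewrite normr_gt0.
have M0 : 0 <= M by apply: le_trans (H (B + 1) _); rewrite ?normr_ge0 // ltrDl.
pose x := Order.max 0 B + 1 + 2 * ((M + `|b|) / `|a|).
have K0 : 0 <= (M + `|b|) / `|a| by rewrite divr_ge0 // addr_ge0.
have [x0 Bx] : 0 < x /\ B < x.
  have : 0 <= Order.max 0 B by rewrite le_max lexx.
  have : B <= Order.max 0 B by rewrite le_max lexx orbT.
  by rewrite /x; move: (Order.max 0 B) => t; split; lra.
have := H x Bx; apply/negP; rewrite -ltNge.
have h1 : `|expR (- x / 2) * b| <= `|b|.
  rewrite normrM ger0_norm ?expR_ge0 // ler_piMl //.
  by rewrite -[leRHS]expR0 ler_expR mulNr oppr_le0 divr_ge0 // ltW.
have h2 : M + `|b| < `|expR (x / 2) * a|.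
  rewrite normrM ger0_norm ?expR_ge0 // -ltr_pdivrMr //.
  apply: lt_le_trans (expR_ge1Dx _).
  have : 0 <= Order.max 0 B by rewrite le_max lexx.
  by rewrite /x; move: (Order.max 0 B) => t; lra.
have : `|expR (x / 2) * a| <= `|hyp a b x| + `|expR (- x / 2) * b|.
  have -> : expR (x / 2) * a = hyp a b x - expR (- x / 2) * b by rewrite /hyp addrK.
  by rewrite (le_trans (ler_normB _ _)).
lra.
Qed.

Lemma hyp_swap (a b x : R) : hyp a b (- x) = hyp b a x.
Proof. by rewrite /hyp opprK addrC. Qed.

Lemma hyp_bounded_left (a b B M : R) : (forall x, x < B -> `|hyp a b x| <= M) -> b = 0.
Proof.
move=> H; apply: (@hyp_bounded_right b a (- B) M) => x xB.
by rewrite -hyp_swap H // ltrNl.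
Qed.

Lemma normr_Re (w : R[i]) : `|complex.Re w| <= Normc.normc w.
Proof.
by case: w => a b /=; rewrite -[`|a|]sqrtr_sqr ler_sqrt ?lerDl ?addr_ge0 ?sqr_ge0.
Qed.

Lemma normr_Im (w : R[i]) : `|complex.Im w| <= Normc.normc w.
Proof.
by case: w => a b /=; rewrite -[`|b|]sqrtr_sqr ler_sqrt ?lerDr ?addr_ge0 ?sqr_ge0.
Qed.

Lemma normc_chyp s x : Normc.normc (chyp s x) <=
  expR (x / 2) * Normc.normc s.1 + expR (- x / 2) * Normc.normc s.2.
Proof.
rewrite /chyp (le_trans (le_normcD _ _)) // !Normc.normcM !normc_real.
by rewrite !ger0_norm ?expR_ge0.
Qed.

Lemma continuation_bounded_right z b ns : admissible ns ->
  exists M, forall x, b <= x -> Normc.normc (continuation z (0, 1) ns x) <= M.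
Proof.
have n0 (w : R[i]) : 0 <= Normc.normc w by case: w => ? ?; apply: sqrtr_ge0.
elim: ns => [|m ns IH].
  exists (expR (- b / 2)) => x bx; rewrite /continuation.
  apply: le_trans (normc_chyp (0, 1) _) _.
  rewrite [(0, 1).1]/(0 : R[i]) [(0, 1).2]/(1 : R[i]) normc_0 mulr0 add0r normc_1 mulr1.
  by rewrite ler_expR ler_pM2r ?invr_gt0 // lerN2.
move=> adm; have := adm; rewrite admissible_cons => /and4P[/allP mns _ _ /IH[M HM]].
pose t := cshoot z (0, 1) (m :: ns).
exists (Order.max M (expR (pos m / 2) * Normc.normc t.1 + expR (- b / 2) * Normc.normc t.2)).
move=> x bx; rewrite le_max; have [mx|xm] := leP (pos m) x.
  rewrite (_ : continuation _ _ _ _ = continuation z (0, 1) ns x) ?HM //.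
  by rewrite /continuation /rights /= ltNge mx.
rewrite /continuation; have -> : rights x (m :: ns) = m :: ns.
  apply/all_filterP/allP => m'; rewrite inE => /predU1P[->//|/mns].
  exact: lt_trans.
rewrite -/t; apply/orP; right; apply: le_trans (normc_chyp _ _) _.
by rewrite lerD // ler_wpM2r // ler_expR ler_pM2r ?invr_gt0 ?lerN2 // ltW.
Qed.

Lemma rights_below m ns x : admissible (m :: ns) -> x < pos m ->
  rights x (m :: ns) = m :: ns.
Proof.
rewrite admissible_cons => /and4P[/allP mns _ _ _] xm.
apply/all_filterP/allP => m'; rewrite inE => /predU1P[->//|/mns].
exact: lt_trans.
Qed.

(** A bounded solution decays at both ends, so the eigenvalues are the zeros of
    the coefficient at [-oo] of the solution decaying at [+oo]. *)
Lemma eigenvalueP p z : Defs.eigenvalue p z <->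
  root (map_poly (real_complex R) (state (nodes p)).2) z.
Proof.
have adm := nodes_admissible p.
have n0 (w : R[i]) : 0 <= Normc.normc w by case: w => ? ?; apply: sqrtr_ge0.
have -> : root (map_poly (real_complex R) (state (nodes p)).2) z <->
    (cshoot z (0, 1) (nodes p)).2 = 0.
  by rewrite shoot_map_poly /=; split; [move/rootP|move=> H; apply/rootP].
have [b bP] := exists_above (nodes p).
split=> [[f [[fc [g [fg jump]]] [x0 fx0] [M HM]]]|W0]; last first.
  case E : (nodes p) => [|m ns]; first by move: W0; rewrite E /= => /eqP; rewrite oner_eq0.
  exists (continuation z (0, 1) (nodes p)); split.
  - exact: continuation_solution.
  - exists b; rewrite /continuation (rights_above bP) //= /chyp /= mulr0 add0r mulr1.
    by move=> /complexI /eqP; rewrite gt_eqF ?expR_gt0.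
  have [M HM] := continuation_bounded_right z (pos m) adm.
  exists (Order.max M (expR (pos m / 2) * Normc.normc (cshoot z (0, 1) (nodes p)).1)) => x.
  rewrite le_max; have [mx|xm] := leP (pos m) x; first by rewrite HM.
  apply/orP; right; rewrite /continuation; have -> : rights x (nodes p) = nodes p.
    by rewrite E rights_below // -E.
  apply: le_trans (normc_chyp _ _) _; rewrite W0 normc_0 mulr0 addr0.
  by rewrite ler_wpM2r // ler_expR ler_pM2r ?invr_gt0 // ltW.
have [s fs] := solution_continuation fc fg jump.
have right x : b < x -> Normc.normc (chyp s x) <= M.
  by move=> bx; have := HM x; rewrite fs /continuation (rights_above bP) // ltW.
have s1 : s.1 = 0.
  apply: eq_complexP => /=.
    apply: (@hyp_bounded_right _ (complex.Re s.2) b M) => x /right H.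
    by rewrite -Re_chyp (le_trans (normr_Re _)).
  apply: (@hyp_bounded_right _ (complex.Im s.2) b M) => x /right H.
  by rewrite -Im_chyp (le_trans (normr_Im _)).
have sE : s = (s.2 * 0, s.2 * 1) by case: (s) s1 => u v /= ->; rewrite mulr0 mulr1.
have s2 : s.2 != 0.
  apply/eqP => s2; apply: fx0; rewrite fs /continuation.
  have -> : s = (0, 0) by case: (s) s1 s2 => u v /= -> ->.
  by rewrite shoot0 /chyp /= !mulr0 addr0.
pose t := cshoot z s (nodes p).
have [c left] : exists c, forall x, x < c -> Normc.normc (chyp t x) <= M.
  case E : (nodes p) => [|m ns].
    by exists 0 => x _; have := HM x; rewrite fs /continuation /t E.
  exists (pos m) => x xm; have := HM x; rewrite fs /continuation.
  by rewrite E rights_below // -E.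
have t2 : t.2 = 0.
  apply: eq_complexP => /=.
    apply: (@hyp_bounded_left (complex.Re t.1) _ c M) => x /left H.
    by rewrite -Re_chyp (le_trans (normr_Re _)).
  apply: (@hyp_bounded_left (complex.Im t.1) _ c M) => x /left H.
  by rewrite -Im_chyp (le_trans (normr_Im _)).
have := shoot_linear (real_complex R) z s.2 (0, 1) (nodes p).
rewrite -sE -/t => tE; move: t2; rewrite tE /= => /eqP.
by rewrite mulf_eq0 (negPf s2) => /eqP.
Qed.

End Spectrum.

(** * Products of linear factors normalized at the origin *)

Section LinearFactors.
Context {R : rcfType} {I : finType} (t : I -> R).
Hypotheses (t0 : forall x, t x != 0) (tI : injective t).
Implicit Types (B : {set I}) (x y : I) (q : {poly R}).

Definition lin (c : R) : {poly R} := 1 - c^-1 *: 'X.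
Definition lprod B : {poly R} := \prod_(x in B) lin (t x).

Lemma linE (c y : R) : (lin c).[y] = 1 - y / c.
Proof. by rewrite /lin hornerD hornerN hornerZ hornerX hornerE mulrC. Qed.

Lemma lin_XsubC c : c != 0 -> lin c = - c^-1 *: ('X - c%:P).
Proof.
move=> c0; rewrite scaleNr scalerBr -[c^-1 *: c%:P]mul_polyC -polyCM mulVf //.
by rewrite opprB.
Qed.

Lemma lprodE B (y : R) : (lprod B).[y] = \prod_(x in B) (1 - y / t x).
Proof. by rewrite horner_prod; apply: eq_bigr => x _; rewrite linE. Qed.

Lemma lprod_at0 B : (lprod B).[0] = 1.
Proof. by rewrite lprodE big1 // => x _; rewrite mul0r subr0. Qed.

Lemma lprod_neq0 B : lprod B != 0.
Proof. by apply/eqP => H; have := lprod_at0 B; rewrite H horner0 => /eqP; rewrite eq_sym oner_eq0. Qed.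

Lemma lprod_XsubC B :
  lprod B = lead_coef (lprod B) *: \prod_(s <- [seq t x | x in B]) ('X - s%:P).
Proof.
have E : lprod B = (\prod_(x in B) - (t x)^-1) *: \prod_(s <- [seq t x | x in B]) ('X - s%:P).
  rewrite big_map big_enum /= /lprod -mul_polyC rmorph_prod -big_split /=.
  by apply: eq_bigr => x _; rewrite lin_XsubC // mul_polyC.
rewrite {1}E; congr (_ *: _); rewrite E lead_coefZ.
by rewrite (monicP (monic_prod_XsubC _ _ _)) mulr1.
Qed.

Lemma uniq_image B : uniq [seq t x | x in B].
Proof. by rewrite map_inj_uniq // enum_uniq. Qed.

Lemma size_lprod B : size (lprod B) = #|B|.+1.
Proof.
by rewrite (size_split (lprod_neq0 B) (lprod_XsubC B)) size_map -cardE.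
Qed.

Lemma root_lprod B (y : R) : root (lprod B) y = (y \in [seq t x | x in B]).
Proof. by rewrite (root_split _ (lprod_neq0 B) (lprod_XsubC B)). Qed.

Lemma root_lprodP B (y : R) : reflect (exists2 x, x \in B & y = t x) (root (lprod B) y).
Proof.
by rewrite root_lprod; apply: (iffP mapP) => -[x xB ->]; exists x; rewrite ?mem_enum // -mem_enum.
Qed.

Lemma lprod_D1 B x : x \in B -> lprod B = lin (t x) * lprod (B :\ x).
Proof. exact: big_setD1. Qed.

Lemma lprod_eq0 B x : x \in B -> (lprod B).[t x] = 0.
Proof. by move=> xB; apply/rootP/root_lprodP; exists x. Qed.

Lemma lprod_D1_neq0 B x : (lprod (B :\ x)).[t x] != 0.
Proof.
apply/negP => /root_lprodP[y]; rewrite !inE => /andP[yx _] /tI xy.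
by rewrite xy eqxx in yx.
Qed.

Lemma deriv_lprod B x : x \in B ->
  (lprod B)^`().[t x] = - (t x)^-1 * (lprod (B :\ x)).[t x].
Proof.
move=> xB; rewrite (lprod_D1 xB) derivM hornerD !hornerM linE divff // subrr mul0r addr0.
by rewrite /lin derivB derivZ derivX -[1]polyC1 derivC sub0r hornerN hornerZ hornerC mulr1.
Qed.

Lemma lprod_setID B B' : lprod B = lprod (B :&: B') * lprod (B :\: B').
Proof. exact: big_setID. Qed.

Lemma dvdp_lprod B q : (forall x, x \in B -> root q (t x)) -> lprod B %| q.
Proof.
move=> H; rewrite lprod_XsubC dvdpZl ?lead_coef_eq0 ?lprod_neq0 //.
apply: uniq_roots_dvdp; last by rewrite uniq_rootsE uniq_image.
by apply/allP => y /mapP[x]; rewrite mem_enum => /H rx ->.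
Qed.

Lemma interpolation B (q q' : {poly R}) : (size q <= #|B|.+1)%N -> (size q' <= #|B|.+1)%N ->
  q.[0] = q'.[0] -> (forall x, x \in B -> q.[t x] = q'.[t x]) -> q = q'.
Proof.
move=> sq sq' e0 eB; apply/eqP; rewrite -subr_eq0; apply/eqP.
apply: (@roots_geq_poly_eq0 _ _ (0 :: [seq t x | x in B])).
- rewrite /= rootE hornerD hornerN e0 subrr eqxx /=.
  apply/allP => y /mapP[x]; rewrite mem_enum => /eB ex ->.
  by rewrite rootE hornerD hornerN ex subrr.
- rewrite /= uniq_image andbT; apply/negP => /mapP[x _ /eqP].
  by rewrite eq_sym (negPf (t0 x)).
- by rewrite /= size_map -cardE (leq_trans (size_polyD _ _)) // size_polyN geq_max sq.
Qed.

Lemma divisor_lprod B q q' : q * q' = lprod B ->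
  q = q.[0] *: lprod [set x in B | root q (t x)].
Proof.
move=> qq'; set C := [set x in B | _].
have q0 : q != 0 by apply: contraTneq (lprod_neq0 B) => qE; rewrite -qq' qE mul0r eqxx.
have [k kE] : exists k, q = k *: lprod C.
  have : q %| \prod_(s <- [seq t x | x in B]) ('X - s%:P).
    rewrite -(dvdpZr _ _ (_ : lead_coef (lprod B) != 0)) -?lprod_XsubC -?qq' ?dvdp_mulr //.
    by rewrite qq' lead_coef_eq0 lprod_neq0.
  move=> /dvdp_prod_XsubC[b /eqpP[[c1 c2] /= /andP[c10 c20] E]].
  set m := mask _ _ in E.
  have rq (y : R) : root q y = (y \in m).
    by rewrite -(rootZ _ _ c10) E rootZ // root_prod_XsubC.
  have pm : perm_eq m [seq t x | x in C].
    apply: uniq_perm; rewrite ?uniq_image ?mask_uniq ?uniq_image // => y.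
    apply/idP/idP => [ym|/mapP[x]]; last first.
      by rewrite mem_enum inE -rq => /andP[_ rx] ->.
    have /mapP[x] := mem_mask ym; rewrite mem_enum => xB yE.
    by apply/mapP; exists x => //; rewrite mem_enum inE xB -yE rq.
  rewrite (perm_big _ pm) /= in E.
  exists (c1^-1 * c2 / lead_coef (lprod C)).
  have lpE : (lead_coef (lprod C))^-1 *: lprod C =
      \prod_(s <- [seq t x | x in C]) ('X - s%:P).
    by rewrite {2}lprod_XsubC scalerA mulVf ?scale1r // lead_coef_eq0 lprod_neq0.
  by rewrite -!scalerA lpE -E scalerA mulVf // scale1r.
by rewrite {1}kE {1}kE hornerZ lprod_at0 mulr1.
Qed.

(** The polynomial [- sum r_x f / (X - t x)] with [f = c *: lprod B]: the numerator of
    the Herglotz function with poles [t x] and masses [r x]. *)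
Definition weyl_num (c : R) (r : I -> R) B : {poly R} :=
  \sum_(x in B) (c * r x / t x) *: lprod (B :\ x).

Lemma weyl_num_at c r B x : x \in B ->
  (weyl_num c r B).[t x] = c * r x / t x * (lprod (B :\ x)).[t x].
Proof.
move=> xB; rewrite /weyl_num horner_sum (bigD1 x) //= hornerZ big1 ?addr0 // => y /andP[yB yx].
by rewrite hornerZ lprod_eq0 ?mulr0 // !inE eq_sym yx xB.
Qed.

Lemma size_weyl_num c r B : c != 0 -> (size (weyl_num c r B) < size (c *: lprod B)%R)%N.
Proof.
move=> c0; rewrite size_scale // size_lprod ltnS.
apply: (big_ind (fun q : {poly R} => (size q <= #|B|)%N)).
- by rewrite size_poly0.
- by move=> p q sp sq; rewrite (leq_trans (size_polyD _ _)) // geq_max sp.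
- move=> x xB; rewrite (leq_trans (size_scale_leq _ _)) // size_lprod.
  by rewrite (cardsD1 x B) xB.
Qed.

Lemma weyl_num_herglotz c r B : c != 0 -> (forall x, x \in B -> 0 < r x) ->
  herglotz_residues (weyl_num c r B) (c *: lprod B).
Proof.
move=> c0 r0; exists [seq t x | x in B]; split; first exact: uniq_image.
- by rewrite lead_coefZ -scalerA -lprod_XsubC.
- by rewrite scaler_eq0 negb_or c0 lprod_neq0.
- move=> s /mapP[x]; rewrite mem_enum => xB ->.
  rewrite weyl_num_at // derivZ hornerZ deriv_lprod //.
  have := lprod_D1_neq0 B x; set v := _.[_] => v0.
  have -> : c * r x / t x * v * (c * (- (t x)^-1 * v)) = - (r x * (c * v / t x) ^+ 2).
    by field.
  by rewrite oppr_lt0 mulr_gt0 ?r0 // exprn_even_gt0 //= !mulf_neq0 ?invr_eq0.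
Qed.

End LinearFactors.

(** * The Green function is determined by the data *)

Section SpectralPolynomials.
Context {R : realType}.
Implicit Types (p : mpair R) (a l : R).

(** The Wronskian of the two decaying solutions, and their values at [a]. *)
Definition charpoly p : {poly R} := (state (nodes p)).2.
Definition right_value p a : {poly R} := value a (rights a (nodes p)).
Definition left_value p a : {poly R} := value (- a) (reflect_nodes (lefts a (nodes p))).

Lemma nodes_neq0 p : nodes p != [::].
Proof. by rewrite -size_eq0 -lt0n nodes_nonempty. Qed.

Lemma charpoly0 p : (charpoly p).[0] = 1.
Proof. exact: (state0 _).2. Qed.

Lemma charpoly_neq0 p : charpoly p != 0.
Proof. by apply/eqP => H; have := charpoly0 p; rewrite H horner0 => /eqP; rewrite eq_sym oner_eq0. Qed.

(** A node at [a] itself changes no value at [a], so it may be counted among those on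
    the right. *)
Lemma at_eigenvalue p a l : (charpoly p).[l] = 0 ->
  0 < l * (norming (nodes p)).[l] /\
  exists k, [/\ k != 0, k * (charpoly p)^`().[l] = - (norming (nodes p)).[l] &
     (right_value p a).[l] = k * (left_value p a).[l]].
Proof.
move=> Wl; have adm := nodes_admissible p.
split; first by apply: norming_gt0 => //; apply: nodes_neq0.
case: (split_nodes a adm) => [nsE|[m ma nsE]].
  have Wl' : (state (lefts a (nodes p) ++ rights a (nodes p))).2.[l] = 0 by rewrite -nsE.
  have := proportional_values a Wl'; have [k0 _ _ kW] := proportional_at_eigenvalue Wl'.
  by rewrite -nsE in k0 kW *; eexists; split; eauto.
have Wl' : (state (lefts a (nodes p) ++ m :: rights a (nodes p))).2.[l] = 0 by rewrite -nsE.
have := proportional_values a Wl'; have [k0 _ _ kW] := proportional_at_eigenvalue Wl'.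
rewrite -nsE in k0 kW *; rewrite -{1}ma value_cons ma => E.
by eexists; split; eauto.
Qed.

Section Data.
Variables (N : nat) (lam : 'I_N -> R).

Lemma increasing_inj : (forall i j : 'I_N, (i < j)%N -> lam i < lam j) -> injective lam.
Proof.
move=> H i j E; apply/val_inj; case: (ltngtP (val i) (val j)) => // /H; by rewrite E ltxx.
Qed.

(** The zeros of [W] are simple because the norming constants do not vanish; together with
    [W(0) = 1] they determine [W]. *)
Lemma eigenvalues_charpoly p : eigenvalues p lam ->
  (forall i, lam i != 0) /\ charpoly p = lprod lam [set: 'I_N].
Proof.
move=> [/increasing_inj lamI spec].
have specP z : root (map_poly (real_complex R) (charpoly p)) z <-> exists i, z = (lam i)%:C.
  rewrite -eigenvalueP; have : [set z | Defs.eigenvalue p z] z <-> [set (lam i)%:C | i in [set: 'I_N]]%classic z.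
    by rewrite spec.
  by move=> /= ->; split=> [[i _ <-]|[i ->]]; exists i.
have rl i : (charpoly p).[lam i] = 0.
  by apply/rootP; rewrite -(fmorph_root (real_complex R)); apply/specP; exists i.
have l0 i : lam i != 0.
  by apply/eqP => H; have := rl i; rewrite H charpoly0 => /eqP; rewrite oner_eq0.
split=> //; have [|rs WE] := @real_rooted_splits R _ (charpoly_neq0 p).
  by move=> z H; have [i ->] := (specP z).1 H.
have rsP s : s \in rs -> exists i, s = lam i.
  rewrite -(root_split _ (charpoly_neq0 p) WE) -(fmorph_root (real_complex R)).
  by move=> H; have [i /complexI ->] := (specP _).1 H; exists i.
have urs : uniq rs.
  apply: (prod_XsubC_uniq erefl) => s sin; have [i sE] := rsP s sin.
  have [lg [k [k0 kW _]]] := at_eigenvalue 0 (rl i).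
  apply: contraTneq lg => H.
  suff : (charpoly p)^`().[lam i] = 0.
    by move=> E; move/eqP: kW; rewrite E mulr0 eq_sym oppr_eq0 => /eqP ->; rewrite mulr0 ltxx.
  by rewrite WE derivZ hornerZ -sE H mulr0.
apply: (@interpolation R _ lam l0 lamI [set: 'I_N]%SET).
- rewrite (size_split (charpoly_neq0 p) WE) ltnS cardsT.
  have -> : #|'I_N| = size [seq lam i | i : 'I_N] by rewrite size_map -cardE.
  apply: uniq_leq_size => // s /rsP[i ->]; exact: map_f (mem_enum _ _).
- by rewrite size_lprod.
- by rewrite charpoly0 lprod_at0.
- by move=> i _; rewrite rl lprod_eq0.
Qed.

Lemma charpoly_eigenvalues p : (forall i j : 'I_N, (i < j)%N -> lam i < lam j) ->
  (forall i, lam i != 0) -> charpoly p = lprod lam [set: 'I_N] -> eigenvalues p lam.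
Proof.
move=> inc l0 WE; split=> //; apply/seteqP; split=> z /=; rewrite eigenvalueP -/(charpoly p) WE.
  rewrite lprod_XsubC // map_polyZ rootZ; last first.
    by rewrite fmorph_eq0 lead_coef_eq0 lprod_neq0.
  rewrite rmorph_prod /= big_map big_enum /= => /rootP; rewrite horner_prod.
  move=> /eqP /prodf_eq0[i _]; rewrite rmorphB /= map_polyX map_polyC /= !hornerE.
  by rewrite subr_eq0 => /eqP ->; exists i.
by case=> i _ <-; rewrite fmorph_root; apply/rootP; apply: lprod_eq0.
Qed.

Hypotheses (l0 : forall i, lam i != 0) (lamI : injective lam).

(** Up to sign, the residue of [phi_+ phi_- / W] at an eigenvalue is [phi_+^2] divided by
    the norming constant. *)
Lemma product_at p a i : charpoly p = lprod lam [set: 'I_N] ->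
  (right_value p a * left_value p a).[lam i] * (lam i * (norming (nodes p)).[lam i]) =
  (right_value p a).[lam i] ^+ 2 * (lprod lam ([set: 'I_N] :\ i)).[lam i].
Proof.
move=> WE; have Wi : (charpoly p).[lam i] = 0 by rewrite WE lprod_eq0.
have [_ [k [_ kW phiE]]] := at_eigenvalue a Wi.
have kw : lam i * (norming (nodes p)).[lam i] = k * (lprod lam ([set: 'I_N] :\ i)).[lam i].
  by rewrite -[(norming _).[_]]opprK -kW WE deriv_lprod //; field.
by rewrite hornerM phiE kw; ring.
Qed.

Lemma vanish_together p a i : charpoly p = lprod lam [set: 'I_N] ->
  ((right_value p a).[lam i] == 0) = ((left_value p a).[lam i] == 0).
Proof.
move=> WE; have Wi : (charpoly p).[lam i] = 0 by rewrite WE lprod_eq0.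
have [_ [k [k0 _ ->]]] := at_eigenvalue a Wi.
by rewrite mulf_eq0 (negPf k0).
Qed.

Lemma norming_pos p i : charpoly p = lprod lam [set: 'I_N] ->
  0 < lam i * (norming (nodes p)).[lam i].
Proof.
move=> WE; have Wi : (charpoly p).[lam i] = 0 by rewrite WE lprod_eq0.
by have [] := at_eigenvalue 0 Wi.
Qed.

End Data.

Section Green.
Variables (N : nat) (lam : 'I_N -> R) (r : 'I_N -> R).
Hypotheses (l0 : forall i, lam i != 0) (lamI : injective lam).

(** The numerator of [alpha + sum r_i^2 lam_i / (lam_i - z)] over the denominator
    [lprod lam [set: 'I_N]]. *)
Definition green_num : {poly R} :=
  (1 - \sum_i r i ^+ 2) *: lprod lam [set: 'I_N] +
  \sum_i r i ^+ 2 *: lprod lam ([set: 'I_N] :\ i).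

Lemma green_num0 : green_num.[0] = 1.
Proof.
rewrite /green_num hornerD hornerZ lprod_at0 mulr1 horner_sum.
by rewrite [X in _ + X](eq_bigr (fun i => r i ^+ 2)) ?subrK // => i _; rewrite hornerZ lprod_at0 mulr1.
Qed.

Lemma green_num_at i : green_num.[lam i] = r i ^+ 2 * (lprod lam ([set: 'I_N] :\ i)).[lam i].
Proof.
have iT : i \in [set: 'I_N]%SET by rewrite inE.
rewrite /green_num hornerD hornerZ (lprod_eq0 l0 iT) mulr0 add0r horner_sum (bigD1 i) //=.
rewrite hornerZ big1 ?addr0 // => j ji.
by rewrite hornerZ lprod_eq0 ?mulr0 // !inE eq_sym ji.
Qed.

Lemma size_green_num : (size green_num <= N.+1)%N.
Proof.
rewrite (leq_trans (size_polyD _ _)) // geq_max.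
rewrite (leq_trans (size_scale_leq _ _)) ?size_lprod ?cardsT ?card_ord //=.
apply: (big_ind (fun q : {poly R} => (size q <= N.+1)%N)).
- by rewrite size_poly0.
- by move=> p q sp sq; rewrite (leq_trans (size_polyD _ _)) // geq_max sp.
- move=> i _; rewrite (leq_trans (size_scale_leq _ _)) // size_lprod // ltnS.
  by rewrite -[leqRHS](card_ord N) max_card.
Qed.

Lemma green_num_coef : green_num`_N =
  (1 - \sum_i r i ^+ 2) * lead_coef (lprod lam [set: 'I_N]).
Proof.
rewrite /green_num coefD coefZ coef_sum [X in _ + X]big1 ?addr0.
  by rewrite /lead_coef size_lprod // cardsT card_ord.
move=> i _; rewrite coefZ nth_default ?mulr0 // size_lprod //.
by rewrite cardsDS ?sub1set // cardsT card_ord cards1 subn1 prednK // (leq_ltn_trans _ (ltn_ord i)).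
Qed.

Variables (p : mpair R) (a : R).
Hypothesis WE : charpoly p = lprod lam [set: 'I_N].

Lemma charpoly_size : size (charpoly p) = N.+1.
Proof. by rewrite WE size_lprod // cardsT card_ord. Qed.

Lemma size_product : (size (right_value p a * left_value p a)%R <= N.+1)%N.
Proof.
rewrite -charpoly_size; have [[c c0 sc]|] := green_degree a (nodes_admissible p); last exact: ltnW.
rewrite leqNgt; apply/negP => H.
have : size (charpoly p - c *: (right_value p a * left_value p a)) =
    size (right_value p a * left_value p a)%R.
  by rewrite addrC size_polyDl ?size_polyN ?size_scale ?gt_eqF.
by move=> E; move: sc; rewrite /= -/(charpoly p) -/(right_value p a) -/(left_value p a) E ltnn.
Qed.

(** Both sides have degree at most [N] and agree at [0] and at the [N] eigenvalues. *)
Lemma product_green :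
  (forall i, (right_value p a).[lam i] ^+ 2 = r i ^+ 2 * (lam i * (norming (nodes p)).[lam i])) ->
  right_value p a * left_value p a = green_num.
Proof.
move=> Hr; apply: (@interpolation R _ lam l0 lamI [set: 'I_N]%SET).
- by rewrite cardsT card_ord size_product.
- by rewrite cardsT card_ord size_green_num.
- rewrite green_num0 hornerM /right_value /left_value !value0 opprK.
  by rewrite -expRD -mulrDl addNr mul0r expR0.
- move=> i _; have := product_at l0 a i WE; rewrite Hr.
  have g0 : lam i * (norming (nodes p)).[lam i] != 0 by rewrite gt_eqF // (norming_pos l0 _ WE).
  by rewrite mulrAC => /(mulIf g0) ->; rewrite green_num_at.
Qed.

(** The number [1 - sum r_i^2] is the limit of [phi_+ phi_- / W] at infinity. *)
Lemma green_pos : 1 - \sum_i r i ^+ 2 != 0 ->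
  right_value p a * left_value p a = green_num ->
  0 < 1 - \sum_i r i ^+ 2.
Proof.
move=> al0 PE.
have lc0 : lead_coef (lprod lam [set: 'I_N]) != 0 by rewrite lead_coef_eq0 lprod_neq0.
have cN : (right_value p a * left_value p a)`_N != 0.
  by rewrite PE green_num_coef mulf_neq0.
have sP : size (right_value p a * left_value p a)%R = N.+1.
  apply/eqP; rewrite eqn_leq size_product ltnNge; apply: contra cN => sP.
  by rewrite nth_default.
have [[c c0 sc]|] := green_degree a (nodes_admissible p); last first.
  by rewrite -/(charpoly p) -/(right_value p a) -/(left_value p a) sP charpoly_size ltnn.
move: sc; rewrite -/(charpoly p) -/(right_value p a) -/(left_value p a) sP ltnS.
move=> /leq_sizeP /(_ N (leqnn _)); rewrite coefB coefZ PE green_num_coef.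
have -> : (charpoly p)`_N = lead_coef (lprod lam [set: 'I_N]).
  by rewrite -WE /lead_coef charpoly_size.
move=> /eqP; rewrite -{1}[lead_coef _]mul1r mulrA -mulrBl mulf_eq0 (negPf lc0) orbF subr_eq0.
by move=> /eqP E; rewrite -(pmulr_rgt0 _ c0) -E ltr01.
Qed.

End Green.
End SpectralPolynomials.

(** * Zeros of the Green function *)

Section GreenZeros.
Context {R : realType}.
Variables (N : nat) (lam : 'I_N -> R) (r : 'I_N -> R).
Hypotheses (l0 : forall i, lam i != 0) (lamI : injective lam).

Lemma herglotz_pole_between (f K K0 : {poly R}) (a b x y : R) :
  herglotz_residues K f -> K = (a *: 'X + b%:P) * f + K0 -> (size K0 < size f)%N ->
  0 < a -> root K x -> root K y -> x < y -> exists2 s, root f s & x < s < y.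
Proof.
move=> [rs [urs fE f0 Kn]] KE sK a0 rx ry xy.
have a01 : (0 < a) || (1 < size f)%N by rewrite a0.
have [s sin xsy] := pole_between urs f0 fE Kn KE sK (ltW a0) a01 rx ry xy.
by exists s => //; rewrite (root_split _ f0 fE).
Qed.

Definition active : {set 'I_N} := [set i | r i != 0].

(** [phi_+ phi_- / W] in lowest terms is [green_red / lprod lam active]. *)
Definition green_red : {poly R} :=
  (1 - \sum_i r i ^+ 2) *: lprod lam active +
  \sum_(i in active) r i ^+ 2 *: lprod lam (active :\ i).

Lemma sum_active (V : zmodType) (F : 'I_N -> V) : (forall i, r i = 0 -> F i = 0) ->
  \sum_i F i = \sum_(i in active) F i.
Proof.
move=> H; rewrite (bigID (mem active)) /= [X in _ + X]big1 ?addr0 // => i.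
by rewrite inE negbK => /eqP/H.
Qed.

Lemma lprod_setT : lprod lam [set: 'I_N] = lprod lam (~: active) * lprod lam active.
Proof. by rewrite (lprod_setID lam _ active) finset.setTI finset.setTD mulrC. Qed.

Lemma green_num_red : green_num lam r = lprod lam (~: active) * green_red.
Proof.
rewrite /green_num /green_red lprod_setT mulrDr -scalerAr; congr (_ + _).
rewrite sum_active => [|i ->]; last by rewrite expr0n scale0r.
rewrite mulr_sumr; apply: eq_bigr => i iA; rewrite -scalerAr; congr (_ *: _).
rewrite [LHS](lprod_setID lam _ active) [LHS]mulrC; congr (_ * _); congr (lprod lam _).
  rewrite inE in iA; apply/finset.setP => j; rewrite !inE.
  by have [->|_] := eqVneq j i; rewrite ?iA ?andbF ?andbT.
by apply/finset.setP => j; rewrite !inE andbT.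
Qed.

Lemma green_red0 : green_red.[0] = 1.
Proof.
have := green_num0 lam r; rewrite green_num_red hornerM lprod_at0 mul1r; exact.
Qed.

Lemma green_red_neq0 : green_red != 0.
Proof. by apply/eqP => H; have := green_red0; rewrite H horner0 => /eqP; rewrite eq_sym oner_eq0. Qed.

Lemma green_red_at i : i \in active ->
  green_red.[lam i] = r i ^+ 2 * (lprod lam (active :\ i)).[lam i].
Proof.
move=> iA; rewrite /green_red hornerD hornerZ (lprod_eq0 l0 iA) mulr0 add0r.
rewrite horner_sum (bigD1 i) //= hornerZ big1 ?addr0 // => j /andP[jA ji].
by rewrite hornerZ (lprod_eq0 l0 (x := i)) ?mulr0 // !inE eq_sym ji; rewrite inE in iA.
Qed.

Lemma size_green_sum :
  (size (\sum_(i in active) r i ^+ 2 *: lprod lam (active :\ i))%R <= #|active|)%N.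
Proof.
apply: (big_ind (fun q : {poly R} => (size q <= #|active|)%N)).
- by rewrite size_poly0.
- by move=> p q sp sq; rewrite (leq_trans (size_polyD _ _)) // geq_max sp.
- move=> i iA; rewrite (leq_trans (size_scale_leq _ _)) // size_lprod //.
  by rewrite (cardsD1 i active) iA.
Qed.

Hypothesis al0 : 0 < 1 - \sum_i r i ^+ 2.

Lemma size_green_red : size green_red = #|active|.+1.
Proof.
rewrite /green_red size_polyDl size_scale ?gt_eqF // size_lprod //.
by rewrite ltnS size_green_sum.
Qed.

Lemma green_herglotz : herglotz_residues ('X * green_red) (lprod lam active).
Proof.
exists [seq lam i | i in active]; split.
- exact: uniq_image.
- exact: lprod_XsubC.
- exact: lprod_neq0.
move=> s sin; have : root (lprod lam active) s by rewrite root_lprod.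
move=> /(root_lprodP l0)[i iA ->].
rewrite hornerM hornerX green_red_at // deriv_lprod //.
have := lprod_D1_neq0 l0 lamI active i; set v := _.[_] => v0.
have -> : lam i * (r i ^+ 2 * v) * (- (lam i)^-1 * v) = - (r i * v) ^+ 2 by field.
by rewrite oppr_lt0 exprn_even_gt0 //= mulf_neq0 //; rewrite inE in iA.
Qed.

Lemma green_polynomial_part : exists b K0,
  'X * green_red = ((1 - \sum_i r i ^+ 2) *: 'X + b%:P) * lprod lam active + K0 /\
  (size K0 < size (lprod lam active))%N.
Proof.
set D := lprod lam active; set E1 := \sum_(i in active) r i ^+ 2 *: lprod lam (active :\ i).
pose b := ('X * E1)`_#|active| / lead_coef D.
exists b, ('X * E1 - b *: D); split.
  rewrite /green_red -/D -/E1 -!mul_polyC; ring.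
rewrite size_lprod // ltnS; apply/leq_sizeP => j hj.
have sX : (size ('X * E1)%R <= #|active|.+1)%N.
  have [->|E10] := eqVneq E1 0; first by rewrite mulr0 size_poly0.
  by rewrite mulrC size_mulX // ltnS size_green_sum.
have lD : lead_coef D = D`_#|active| by rewrite /lead_coef size_lprod.
rewrite coefB coefZ; case: (ltngtP j #|active|) => [|hj'|->]; first by rewrite ltnNge hj.
  by rewrite !nth_default ?mulr0 ?subrr ?size_lprod // (leq_trans sX).
by rewrite /b -lD divfK ?subrr // lead_coef_eq0 lprod_neq0.
Qed.

Lemma green_zeros_herglotz :
  herglotz_residues (- lprod lam active) ('X * green_red).
Proof.
have [b [K0 [KE sK]]] := green_polynomial_part.
apply: (herglotz_inv green_herglotz KE sK (ltW al0)).
by rewrite mulf_neq0 ?polyX_eq0 ?green_red_neq0.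
Qed.

Lemma pole_between_zeros (x y : R) : root ('X * green_red) x -> root ('X * green_red) y ->
  x < y -> exists2 i, i \in active & x < lam i < y.
Proof.
have [b [K0 [KE sK]]] := green_polynomial_part => rx ry xy.
have [s] := herglotz_pole_between green_herglotz KE sK al0 rx ry xy.
by move=> /(root_lprodP l0)[i iA ->]; exists i.
Qed.

(** Besides [0], which is removed, the zeros of the Herglotz function [z phi_+ phi_- / W]
    are counted by its degree, since [1 - sum r_i^2] is its growth rate at infinity. *)
Lemma green_zeros : exists (M : nat) (t : 'I_M -> R),
  [/\ forall x, t x != 0, injective t, M = #|active| & green_red = lprod t [set: 'I_M]].
Proof.
have [ts [uts tE X0 _]] := green_zeros_herglotz.
have t0 : 0 \in ts by rewrite -(root_split _ X0 tE) rootM rootX eqxx.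
pose es := rem 0 ts.
have ues : uniq es by rewrite rem_uniq.
have es0 s : s \in es -> s != 0 by rewrite mem_rem_uniq // !inE => /andP[].
have EE : green_red = lead_coef ('X * green_red) *: \prod_(s <- es) ('X - s%:P).
  apply: (mulfI (x := 'X)); first by rewrite polyX_eq0.
  rewrite {1}tE -scalerAr; congr (_ *: _).
  by rewrite (perm_big _ (perm_to_rem t0)) big_cons polyC0 subr0.
pose t : 'I_(size es) -> R := tnth (in_tuple es).
have tn0 x : t x != 0 by apply/es0/mem_tnth.
have tI : injective t by apply/tuple_uniqP.
have EE' : green_red = lprod t [set: 'I_(size es)].
  have PE : \prod_(s <- es) ('X - s%:P) =
      \prod_(s <- [seq t x | x in [set: 'I_(size es)]%SET]) ('X - s%:P).
    rewrite (big_tnth _ _ es) big_map big_enum /=.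
    by apply: eq_bigl => x; rewrite inE.
  have := lprod_at0 t [set: 'I_(size es)]%SET; have := green_red0.
  rewrite [in X in _ -> X -> _](lprod_XsubC tn0) [in X in X -> _]EE PE !hornerZ.
  set q := _.[0] => H1 H2; rewrite EE PE (lprod_XsubC tn0); congr (_ *: _).
  have q0 : q != 0 by apply: contra_eq_neq H1 => ->; rewrite mulr0 eq_sym oner_eq0.
  by apply: (mulIf q0); rewrite H1 H2.
exists (size es), t; split => //.
have := size_green_red; rewrite EE' size_lprod //; first by rewrite cardsT card_ord => -[].
Qed.

End GreenZeros.

(** * Pairs from a distribution of the zeros and norming constants *)

Section Configurations.
Context {R : realType}.

Lemma lprod_same_roots (I J : finType) (t : I -> R) (s : J -> R) (B : {set I}) (C : {set J}) :
  (forall x, t x != 0) -> injective t -> (forall x, s x != 0) -> injective s ->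
  (forall y, root (lprod t B) y = root (lprod s C) y) -> lprod t B = lprod s C.
Proof.
move=> t0 tI s0 sI H.
have pm : perm_eq [seq t x | x in B] [seq s x | x in C].
  by apply: uniq_perm; rewrite ?uniq_image // => y; rewrite -!root_lprod // H.
have := lprod_at0 s C; have := lprod_at0 t B.
rewrite (lprod_XsubC t0 B) (lprod_XsubC s0 C) (perm_big _ pm) /= !hornerZ.
set q := _.[0] => H1 H2; congr (_ *: _).
have q0 : q != 0 by apply: contra_eq_neq H1 => ->; rewrite mulr0 eq_sym oner_eq0.
by apply: (mulIf q0); rewrite H1 H2.
Qed.

(** Two half line problems glued at [a]. The condition that their Wronskian is not [1]
    excludes the empty configuration of nodes. *)
Lemma inverse_pair a (fR KR fL KL : {poly R}) :
  herglotz_residues KR fR -> (size KR < size fR)%N -> fR.[0] = expR (- a / 2) ->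
  herglotz_residues KL fL -> (size KL < size fL)%N -> fL.[0] = expR (a / 2) ->
  fR * fL - 'X * KR * fL - fR * ('X * KL) != 1 ->
  exists p : mpair R, [/\ charpoly p = fR * fL - 'X * KR * fL - fR * ('X * KL),
    right_value p a = fR, left_value p a = fL &
    forall l, (charpoly p).[l] = 0 -> fL.[l] = 0 -> l != 0 ->
    exists k, k * (charpoly p)^`().[l] = - (norming (nodes p)).[l] /\
              KR.[l] = - k * KL.[l]].
Proof.
move=> HR sR R0 HL sL L0 W1.
have [nsR [aboveR admR A1 B1]] := inverse_half (leqnSn _) HR sR R0.
have L0' : fL.[0] = expR (- - a / 2) by rewrite opprK.
have [nsL [aboveL admL A2 B2]] := inverse_half (leqnSn _) HL sL L0'.
have below m : m \in reflect_nodes nsL -> pos m < a.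
  rewrite mem_rev => /mapP[m' /(allP aboveL) am' ->].
  by rewrite /reflect_node {1}/pos /= ltrNl.
have adm : admissible (reflect_nodes nsL ++ nsR).
  have : admissible (reflect_nodes nsL) by rewrite admissible_reflect.
  elim: (reflect_nodes nsL) below => //= m ns IH below; rewrite !admissible_cons.
  move=> /and4P[mns v0 vw adm]; rewrite v0 vw IH //; last first.
    by move=> m' m'in; apply: below; rewrite inE m'in orbT.
  rewrite all_cat mns /= andbT; apply/allP => m' /(allP aboveR).
  by apply: lt_trans; apply: below; rewrite mem_head.
have vR : value a nsR = fR by rewrite /value A1 B1 addrC subrK.
have vL : value (- a) nsL = fL by rewrite /value A2 B2 addrC subrK.
have WE : (state (reflect_nodes nsL ++ nsR)).2 =
    fR * fL - 'X * KR * fL - fR * ('X * KL).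
  by rewrite (wronskian_values a) reflect_nodesK vR vL A1 A2.
have [so ma] := andP adm.
have ne : (0 < size (reflect_nodes nsL ++ nsR))%N.
  rewrite lt0n; apply: contra W1 => /eqP/size0nil E.
  by rewrite -WE E.
exists (MPair ne so ma); rewrite /charpoly /right_value /left_value /=.
have rE : rights a (reflect_nodes nsL ++ nsR) = nsR.
  rewrite /rights filter_cat; have /all_filterP -> := aboveR.
  rewrite (eq_in_filter (a2 := pred0)) ?filter_pred0 // => m /below ma'.
  by rewrite ltNge ltW.
have lE : lefts a (reflect_nodes nsL ++ nsR) = reflect_nodes nsL.
  rewrite /lefts filter_cat [X in _ ++ X](eq_in_filter (a2 := pred0)) ?filter_pred0 ?cats0.
    by apply/all_filterP/allP.
  by move=> m /(allP aboveR) am; rewrite ltNge ltW.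
rewrite rE lE reflect_nodesK; split => // l Wl Ll l0.
have [k0 E1 _ kW] := proportional_at_eigenvalue Wl.
exists (state (reflect_nodes nsL ++ nsR)).1.[l]; split => //.
move: E1; rewrite reflect_nodesK; set k := (state (_ ++ _)).1.[l] => E1.
have HA : expR (a / 2) * (state nsR).1.[l] = l * KR.[l].
  by rewrite -hornerZ A1 hornerM hornerX.
have HB : expR (a / 2) * (state nsL).2.[l] = - (l * KL.[l]).
  have := congr1 (fun q : {poly R} => q.[l]) B2.
  by rewrite opprK hornerZ hornerD hornerN hornerM hornerX Ll add0r.
apply: (mulfI l0); rewrite -HA E1 mulrCA HB; ring.
Qed.

Variables (N : nat) (lam : 'I_N -> R) (r : 'I_N -> R).
Hypotheses (l0 : forall i, lam i != 0) (lamI : injective lam)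
  (al0 : 0 < 1 - \sum_i r i ^+ 2).
Variables (M : nat) (t : 'I_M -> R).
Hypotheses (t0 : forall x, t x != 0) (tI : injective t) (MA : M = #|active r|)
  (tE : green_red lam r = lprod t [set: 'I_M])
  (inactive_zero : forall j, j \notin active r -> exists x, t x = lam j).

(** The zeros common to both solutions: those at eigenvalues whose eigenfunction vanishes
    at [a]. *)
Definition shared : {set 'I_M} := [set x | [exists j, t x == lam j]].

Lemma sharedP x : reflect (exists2 j, j \notin active r & t x = lam j) (x \in shared).
Proof.
rewrite inE; apply: (iffP existsP) => [[j /eqP xj]|[j _ xj]]; last by exists j; rewrite xj.
exists j => //; apply/negP => jA.
have := green_red_at l0 jA; rewrite tE -xj lprod_eq0 ?inE // xj => /eqP.
rewrite eq_sym mulf_eq0 expf_eq0 /= (negPf (lprod_D1_neq0 l0 lamI _ _)) orbF.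
by rewrite inE in jA; rewrite (negPf jA).
Qed.

Lemma lprod_shared : lprod lam (~: active r) = lprod t shared.
Proof.
apply: lprod_same_roots => // y; apply/(root_lprodP l0)/(root_lprodP t0).
  by move=> [j]; rewrite inE => /inactive_zero[x xj] ->; exists x => //; rewrite inE;
     apply/existsP; exists j; rewrite xj.
by move=> [x /sharedP[j jA xj] ->]; exists j; rewrite // inE.
Qed.

Lemma green_num_shared : green_num lam r = lprod t shared * lprod t [set: 'I_M].
Proof. by rewrite green_num_red // lprod_shared tE. Qed.

(** [Q] is the set of zeros of [phi_+(., a)]; the complementary set together with
    the shared zeros are those of [phi_-(., a)]. *)
Definition coshared (Q : {set 'I_M}) : {set 'I_M} := shared :|: ~: Q.

Lemma lprod_coshared (Q : {set 'I_M}) : shared \subset Q ->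
  lprod t Q * lprod t (coshared Q) = lprod t shared * lprod t [set: 'I_M].
Proof.
move=> sQ; rewrite (lprod_setID t [set: 'I_M]%SET Q) finset.setTI finset.setTD.
rewrite mulrCA; congr (_ * _); rewrite /coshared (lprod_setID t _ shared).
congr (lprod t _ * lprod t _); apply/finset.setP => x; rewrite !inE.
  by case: existsP => //=; rewrite ?andbF ?andbT.
have := fintype.subsetP sQ x; rewrite inE.
by case: existsP => [_ /(_ isT) ->|_ _].
Qed.

(** Both factors carry the shared zeros, and the remaining zeros are simple; so a factor
    is the choice of some of these. *)
Lemma factor_of_product (f h : {poly R}) : f * h = green_num lam r ->
  (forall j, j \notin active r -> f.[lam j] = 0 /\ h.[lam j] = 0) ->
  exists2 Q : {set 'I_M}, shared \subset Q & f = f.[0] *: lprod t Q.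
Proof.
move=> fh fh0.
have /dvdpP[f' fE] : lprod t shared %| f.
  by apply: dvdp_lprod => // x /sharedP[j /fh0[fj _] ->]; apply/rootP.
have /dvdpP[h' hE] : lprod t shared %| h.
  by apply: dvdp_lprod => // x /sharedP[j /fh0[_ hj] ->]; apply/rootP.
have V0 := lprod_neq0 t shared.
have f'h' : f' * h' = lprod t (~: shared).
  apply: (mulfI V0); apply: (mulfI V0); rewrite mulrA.
  transitivity (f * h); first by rewrite fE hE; ring.
  by rewrite fh green_num_shared (lprod_setID t [set: 'I_M]%SET shared) finset.setTI finset.setTD.
have f'E := divisor_lprod t0 tI f'h'.
set C := [set x in ~: shared | _] in f'E.
exists (shared :|: C); first exact: finset.subsetUl.
have -> : lprod t (shared :|: C) = lprod t shared * lprod t C.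
  rewrite (lprod_setID t _ shared); congr (lprod t _ * lprod t _).
    by apply/finset.setP => x; rewrite !inE; case: [exists j, _] => //=; rewrite andbF.
  by apply/finset.setP => x; rewrite !inE; case: [exists j, _].
rewrite {1 2}fE hornerM lprod_at0 mulr1 {1}f'E -scalerAl; congr (_ *: _).
exact: mulrC.
Qed.

(** The masses of the Herglotz function [- W / (z phi_+ phi_-)] at the zeros other
    than [0]. *)
Definition rho x : R :=
  - (lprod lam (active r)).[t x] / (lprod t ([set: 'I_M] :\ x)).[t x].

Lemma rho_gt0 x : 0 < rho x.
Proof.
have [ts [_ tsE X0 neg]] := green_zeros_herglotz l0 lamI al0.
have xT : x \in [set: 'I_M]%SET by rewrite inE.
have rx : root ('X * green_red lam r) (t x).
  by rewrite rootM; apply/orP; right; rewrite tE; apply/rootP; apply: lprod_eq0.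
have := neg (t x); rewrite -(root_split _ X0 tsE) => /(_ rx).
rewrite derivM derivX mul1r hornerD hornerM hornerX tE lprod_eq0 // add0r deriv_lprod // hornerN.
have e0 := lprod_D1_neq0 t0 tI [set: 'I_M]%SET x.
rewrite /rho; move: (_.[t x]) (_.[t x]) e0 => D e e0.
have -> : - D * (t x * (- (t x)^-1 * e)) = - (- D / e * e ^+ 2) by field; rewrite t0 e0.
by rewrite oppr_lt0 pmulr_lgt0 // exprn_even_gt0.
Qed.

(** The expansion of [W / (phi_+ phi_-)] in partial fractions; its constant term is
    the value at [0]. *)
Lemma active_expansion : lprod lam (active r) =
  green_red lam r - 'X * \sum_x (rho x / t x) *: lprod t ([set: 'I_M] :\ x).
Proof.
have sT : #|[set: 'I_M]%SET| = M by rewrite cardsT card_ord.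
apply: (@interpolation R _ t t0 tI [set: 'I_M]%SET).
- by rewrite size_lprod // sT MA.
- rewrite sT (leq_trans (size_polyD _ _)) // size_polyN geq_max.
  rewrite tE size_lprod // sT leqnn /=.
  set S := \sum_x _; have [->|S0] := eqVneq S 0; first by rewrite mulr0 size_poly0.
  rewrite mulrC size_mulX // ltnS.
  apply: (big_ind (fun q : {poly R} => (size q <= M)%N)).
  + by rewrite size_poly0.
  + by move=> p q sp sq; rewrite (leq_trans (size_polyD _ _)) // geq_max sp.
  + move=> x _; rewrite (leq_trans (size_scale_leq _ _)) // size_lprod //.
    by rewrite -[leqRHS]sT (cardsD1 x [set: 'I_M]%SET) inE.
- by rewrite lprod_at0 hornerD hornerN hornerM hornerX mul0r subr0 tE lprod_at0.
- move=> x xT; rewrite hornerD hornerN hornerM hornerX tE lprod_eq0 // add0r.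
  rewrite horner_sum (bigD1 x) //= hornerZ big1 ?addr0 => [|y yx]; last first.
    by rewrite hornerZ lprod_eq0 ?mulr0 // !inE eq_sym yx.
  rewrite /rho; have e0 := lprod_D1_neq0 t0 tI [set: 'I_M]%SET x.
  by field; rewrite t0 e0.
Qed.

Section Construction.
Variables (a : R) (Q : {set 'I_M}) (th : 'I_M -> R).
Hypotheses (N0 : (0 < N)%N) (sQ : shared \subset Q)
  (th01 : forall x, x \in shared -> 0 < th x < 1).

Let V := lprod t shared.
Let cR := expR (- a / 2).
Let cL := expR (a / 2).
(** The mass at a shared zero is divided between the two half lines in the ratio
    [th : 1 - th]; every other zero belongs to one side, which gets its mass. *)
Let wR x := if x \in shared then th x * rho x else rho x.
Let wL x := if x \in shared then (1 - th x) * rho x else rho x.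

Lemma lprod_coshared_D1 x :
  (x \in Q -> lprod t (Q :\ x) * lprod t (coshared Q) = V * lprod t ([set: 'I_M] :\ x)) *
  (x \in coshared Q -> lprod t Q * lprod t (coshared Q :\ x) = V * lprod t ([set: 'I_M] :\ x)).
Proof.
have lx0 : lin (t x) != 0.
  by apply: contraNneq (lprod_neq0 t [set x]) => H; rewrite /lprod big_set1 H.
have xT : x \in [set: 'I_M]%SET by rewrite inE.
have := lprod_coshared sQ; rewrite (lprod_D1 t xT) -/V => H.
split=> xin; apply: (mulfI lx0); rewrite [RHS]mulrCA -H.
- by rewrite (lprod_D1 t xin) mulrA.
- by rewrite (lprod_D1 t xin) mulrCA.
Qed.

Lemma scale_scale (c d w y : R) (A B : {poly R}) : c * d = 1 ->
  (c *: A) * ((d * w / y) *: B) = (w / y) *: (A * B).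
Proof.
move=> cd; rewrite -!mul_polyC mulrACA -polyCM; congr (_%:P * _).
by rewrite !mulrA cd mul1r.
Qed.

(** The masses of the two half lines add up to those of the whole line. *)
Lemma weyl_num_sum :
  weyl_num t cR wR Q * (cL *: lprod t (coshared Q)) +
  (cR *: lprod t Q) * weyl_num t cL wL (coshared Q) =
  V * \sum_x (rho x / t x) *: lprod t ([set: 'I_M] :\ x).
Proof.
have cc : cR * cL = 1 by rewrite -expRD -mulrDl addNr mul0r expR0.
have -> : weyl_num t cR wR Q * (cL *: lprod t (coshared Q)) =
    \sum_x ((if x \in Q then wR x else 0) / t x) *: (V * lprod t ([set: 'I_M] :\ x)).
  rewrite /weyl_num mulr_suml big_mkcond /=; apply: eq_bigr => x _.
  case: ifP => xQ; last by rewrite mul0r scale0r.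
  rewrite -(lprod_coshared_D1 x).1 // [LHS]mulrC
    (scale_scale _ _ _ _ (etrans (mulrC _ _) cc)).
  by rewrite [lprod t (coshared Q) * _]mulrC.
have -> : (cR *: lprod t Q) * weyl_num t cL wL (coshared Q) =
    \sum_x ((if x \in coshared Q then wL x else 0) / t x) *: (V * lprod t ([set: 'I_M] :\ x)).
  rewrite /weyl_num mulr_sumr big_mkcond /=; apply: eq_bigr => x _.
  case: ifP => xQ; last by rewrite mul0r scale0r.
  by rewrite -(lprod_coshared_D1 x).2 // (scale_scale _ _ _ _ cc).
rewrite mulr_sumr -big_split; apply: eq_bigr => x _ /=.
rewrite -scalerDl -scalerAr; congr (_ *: _); rewrite -mulrDl; congr (_ / _).
have := fintype.subsetP sQ x; rewrite /wR /wL !inE.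
case: [exists j, _] => /= [/(_ isT) ->|_]; first by ring.
by case: (x \in Q); rewrite ?addr0 ?add0r.
Qed.

(** The factor between the norming constant at a shared zero and the ratio
    [th / (1 - th)] of the masses. *)
Definition norming_ratio x : R :=
  t x * (lprod lam [set: 'I_N])^`().[t x] * (cR * (lprod t (Q :\ x)).[t x]) /
  (cL * (lprod t (coshared Q :\ x)).[t x]).

Lemma pair_of_configuration : exists p : mpair R,
  [/\ charpoly p = lprod lam [set: 'I_N], right_value p a = cR *: lprod t Q,
      left_value p a = cL *: lprod t (coshared Q) &
      forall x j, x \in shared -> t x = lam j ->
        lam j * (norming (nodes p)).[lam j] * (1 - th x) = th x * norming_ratio x].
Proof.
have cc : cR * cL = 1 by rewrite -expRD -mulrDl addNr mul0r expR0.
have cR0 : cR != 0 by rewrite gt_eqF ?expR_gt0.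
have cL0 : cL != 0 by rewrite gt_eqF ?expR_gt0.
have wR0 x : x \in Q -> 0 < wR x.
  have := rho_gt0 x; rewrite /wR; case: ifP => [/th01/andP[h _]|_ //] rx _.
  exact: mulr_gt0.
have wL0 x : x \in coshared Q -> 0 < wL x.
  have := rho_gt0 x; rewrite /wL; case: ifP => [/th01/andP[_ h]|_ //] rx _.
  by apply: mulr_gt0; rewrite // subr_gt0.
set KR := weyl_num t cR wR Q; set KL := weyl_num t cL wL (coshared Q).
have WE : (cR *: lprod t Q) * (cL *: lprod t (coshared Q)) -
   'X * KR * (cL *: lprod t (coshared Q)) - (cR *: lprod t Q) * ('X * KL) =
   lprod lam [set: 'I_N].
  rewrite (@lprod_setT _ _ _ r) lprod_shared active_expansion -/V.
  have := weyl_num_sum; rewrite -/KR -/KL => S.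
  have -> : (cR *: lprod t Q) * (cL *: lprod t (coshared Q)) = V * green_red lam r.
    by rewrite -!mul_polyC mulrACA -polyCM cc polyC1 mul1r lprod_coshared // tE.
  rewrite mulrBr [V * ('X * _)]mulrCA -S; ring.
have [|||||||p [pW pR pL pk]] := @inverse_pair a (cR *: lprod t Q) KR (cL *: lprod t (coshared Q)) KL.
- exact: weyl_num_herglotz.
- exact: size_weyl_num.
- by rewrite hornerZ lprod_at0 mulr1.
- exact: weyl_num_herglotz.
- exact: size_weyl_num.
- by rewrite hornerZ lprod_at0 mulr1.
- rewrite WE; apply: contraTneq N0 => /(congr1 (fun q : {poly R} => size q)).
  by rewrite size_lprod // cardsT card_ord size_poly1 => -[->].
exists p; rewrite pW; split => // x j xS xj.
have xQ : x \in Q by apply: fintype.subsetP sQ x xS.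
have xQ' : x \in coshared Q by rewrite !inE; rewrite inE in xS; rewrite xS.
have [||k [kW kK]] := pk (lam j) _ _ (l0 j).
- by rewrite pW WE lprod_eq0 ?inE.
- by rewrite -xj hornerZ lprod_eq0 // mulr0.
rewrite pW WE in kW; rewrite -xj in kW kK *.
rewrite !weyl_num_at // /wR /wL xS in kK.
have q'0 := lprod_D1_neq0 t0 tI (coshared Q) x.
rewrite /norming_ratio; move: kK kW (rho_gt0 x) (t0 x) q'0.
set q := (lprod t (Q :\ x)).[t x]; set q' := (lprod t (coshared Q :\ x)).[t x].
set W' := _^`().[t x]; set g := (norming _).[t x].
move: (rho x) (t x) q q' W' g => h y q q' W' g kK kW h0 y0 q'0.
have gE : g = - (k * W') by rewrite kW opprK.
have E : cR * th x * q = - k * cL * (1 - th x) * q'.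
  apply: (mulfI (x := h / y)); first by rewrite mulf_neq0 ?invr_eq0 // gt_eqF.
  have -> : h / y * (cR * th x * q) = cR * (th x * h) / y * q by ring.
  by rewrite kK; ring.
have -> : th x * (y * W' * (cR * q) / (cL * q')) = cR * th x * q * (y * W') / (cL * q').
  by rewrite !mulrA; congr (_ / _); ring.
by rewrite E gE; field; rewrite cL0 q'0.
Qed.

End Construction.

(** The norming constant at a shared zero is a positive multiple of [th / (1 - th)], which
    takes every positive value. *)
Lemma pair_of_normings (a : R) (Q : {set 'I_M}) (tau : 'I_N -> R) :
  (0 < N)%N -> shared \subset Q -> (forall j, j \notin active r -> 0 < tau j) ->
  exists p : mpair R,
  [/\ charpoly p = lprod lam [set: 'I_N], right_value p a = expR (- a / 2) *: lprod t Q,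
      left_value p a = expR (a / 2) *: lprod t (coshared Q) &
      forall j, j \notin active r -> lam j * (norming (nodes p)).[lam j] = tau j].
Proof.
move=> N0 sQ tau0.
have half01 x : x \in shared -> 0 < (fun=> 2^-1 : R) x < 1.
  by move=> _; rewrite invr_gt0 ltr0n /= invf_lt1 ?ltr1n.
(* The sign of the factor is read off one pair, the one with equal splitting, as the
   norming constants of an actual pair are positive. *)
have C0 x : x \in shared -> 0 < norming_ratio a Q x.
  move=> xS; have [j _ xj] := sharedP x xS.
  have [p [pW _ _ pn]] := pair_of_configuration a N0 sQ half01.
  have := pn x j xS xj; have := norming_pos l0 j pW => g0.
  have -> : 1 - 2^-1 = 2^-1 :> R by field.
  by rewrite mulrC => /(mulfI _) <- //; rewrite invr_eq0 pnatr_eq0.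
pose ta x := if [pick j | t x == lam j] is Some j then tau j else 1.
have taE x j : t x = lam j -> ta x = tau j.
  rewrite /ta => xj; case: pickP => [j' /eqP|/(_ j)]; last by rewrite xj eqxx.
  by rewrite xj => /lamI ->.
have ta0 x : x \in shared -> 0 < ta x.
  by move=> /sharedP[j jA xj]; rewrite (taE x j) // tau0.
pose th x := ta x / (ta x + norming_ratio a Q x).
have th01 x : x \in shared -> 0 < th x < 1.
  move=> xS; have := ta0 x xS; have := C0 x xS; rewrite /th.
  move: (ta x) (norming_ratio a Q x) => u c c0 u0.
  by rewrite divr_gt0 ?addr_gt0 //= ltr_pdivrMr ?addr_gt0 // mul1r ltrDl.
have [p [pW pR pL pn]] := pair_of_configuration a N0 sQ th01.
exists p; split => // j jA; have [x xj] := inactive_zero jA.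
have xS : x \in shared by apply/sharedP; exists j.
have := pn x j xS xj; rewrite -(taE x j) // /th; have := ta0 x xS; have := C0 x xS.
move: (_ * _) (ta x) (norming_ratio a Q x) => g u c c0 u0.
have uc : u + c != 0 by rewrite gt_eqF ?addr_gt0.
have -> : 1 - u / (u + c) = c / (u + c) by field.
have -> : u / (u + c) * c = u * (c / (u + c)) by ring.
by move/mulIf; apply; rewrite mulf_neq0 ?invr_eq0 // gt_eqF.
Qed.

End Configurations.

(** * Counting the valid distributions *)

Section SymmetricDifference.
Context {T : finType}.
Implicit Types (B C : {set T}).

Definition symdiff B C : {set T} := (B :\: C) :|: (C :\: B).

Lemma in_symdiff B C x : (x \in symdiff B C) = ((x \in B) (+) (x \in C)).
Proof. by rewrite !inE; case: (x \in B); case: (x \in C). Qed.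

Lemma symdiffK B : involutive (symdiff B).
Proof. by move=> C; apply/finset.setP => x; rewrite !in_symdiff addKb. Qed.

End SymmetricDifference.

Section Validity.
Context {R : realType}.
Variables (n : nat).
Local Notation N := n.+1.
Variables (lam : 'I_N -> R) (r : 'I_N -> R).
Hypotheses (l0 : forall i, lam i != 0) (inc : forall i j : 'I_N, (i < j)%N -> lam i < lam j)
  (lneg : lam ord0 < 0) (lpos : 0 < lam ord_max)
  (al0 : 0 < 1 - \sum_i r i ^+ 2).
Variables (M : nat) (t : 'I_M -> R).
Hypotheses (t0 : forall x, t x != 0) (tI : injective t) (MA : M = #|active r|)
  (tE : green_red lam r = lprod t [set: 'I_M])
  (inactive_zero : forall j, j \notin active r -> exists x, t x = lam j).

Let lamI : injective lam := increasing_inj inc.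
Local Notation A := (active r).
Local Notation sharedP := (sharedP l0 lamI t0 tE).
Implicit Types (Q B : {set 'I_M}) (x y : 'I_M) (i : 'I_N).

Lemma lam_le (i j : 'I_N) : (i <= j)%N -> lam i <= lam j.
Proof. by rewrite leq_eqVlt => /orP[/eqP/val_inj ->//|/inc/ltW]. Qed.

Lemma t_neq_active x i : i \in A -> t x != lam i.
Proof.
move=> iA; apply/eqP => xi.
have /sharedP[j jA] : x \in shared lam t by rewrite inE; apply/existsP; exists i; rewrite xi.
by rewrite xi => /lamI ij; rewrite -ij iA in jA.
Qed.

Lemma root_t x : root ('X * green_red lam r) (t x).
Proof. by rewrite rootM tE; apply/orP; right; apply/rootP/lprod_eq0; rewrite ?inE. Qed.

Lemma between x y : t x < t y -> exists2 i, i \in A & t x < lam i < t y.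
Proof. by apply: (pole_between_zeros l0 lamI al0); apply: root_t. Qed.

Lemma root_0 : root ('X * green_red lam r) 0.
Proof. by rewrite rootM rootX eqxx. Qed.

Definition outward x : bool :=
  [forall i in A, t x < lam i] || [forall i in A, lam i < t x].

(** The zero [0] of [z phi_+ phi_- / W] is itself separated from the others by the active
    eigenvalues, which gives the sign of an outward zero. *)
Lemma outward_pos x i : outward x -> i \in A -> 0 < 1 - lam i / t x.
Proof.
rewrite subr_gt0 => /orP[|] /forall_inP H iA; have Hi := H i iA.
- have tx : t x < 0.
    rewrite lt_neqAle t0 /= leNgt; apply/negP => tx.
    have [j jA /andP[_]] := pole_between_zeros l0 lamI al0 root_0 (root_t x) tx.
    by rewrite ltNge ltW // H.
  by rewrite ltr_ndivrMr // mul1r.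
- have tx : 0 < t x.
    rewrite lt_neqAle eq_sym t0 /= leNgt; apply/negP => tx.
    have [j jA /andP[+ _]] := pole_between_zeros l0 lamI al0 (root_t x) root_0 tx.
    by rewrite ltNge ltW // H.
  by rewrite ltr_pdivrMr // mul1r.
Qed.

(** Between two consecutive active eigenvalues there is only one zero of
    [z phi_+ phi_- / W]; so a product of factors [1 - z / t] keeps its sign at all
    active eigenvalues only if no [t] lies between two of them. *)
Lemma lprod_pos B : (forall i, i \in A -> 0 < (lprod t B).[lam i]) <->
  (forall x, x \in B -> outward x).
Proof.
split=> [H x xB|H i iA]; last first.
  by rewrite lprodE prodr_gt0 // => x /H ox; apply: outward_pos ox iA.
apply/negPn/negP; rewrite negb_or !negb_forall_in => /andP[].
move=> /exists_inP[i0 i0A i0x] /exists_inP[j0 j0A j0x].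
have Pi0 : (i0 \in A) && (lam i0 < t x).
  by rewrite i0A lt_neqAle eq_sym t_neq_active //= leNgt.
have Pj0 : (j0 \in A) && (t x < lam j0).
  by rewrite j0A lt_neqAle t_neq_active //= leNgt.
(* The neighbours of [t x] among the active eigenvalues: every other zero is on the same
   side of both, so [x] alone changes the sign. *)
case: (@Order.TotalTheory.arg_maxP _ _ _ i0 (fun i => (i \in A) && (lam i < t x)) lam Pi0) => i /andP[iA ix] imax.
case: (@Order.TotalTheory.arg_minP _ _ _ j0 (fun j => (j \in A) && (t x < lam j)) lam Pj0) => j /andP[jA jx] jmin.
have t2 y : 0 < t y ^+ 2 by rewrite exprn_even_gt0 //= t0.
have away y : y \in B -> y != x -> 0 < (1 - lam i / t y) * (1 - lam j / t y).
  move=> yB yx; have -> : (1 - lam i / t y) * (1 - lam j / t y) =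
      (t y - lam i) * (t y - lam j) / t y ^+ 2 by field.
  apply: divr_gt0 (t2 y).
  have : t y != t x by apply: contra_neq yx => /tI.
  rewrite neq_lt => /orP[|] /between[m mA /andP[m1 m2]].
    have mi : lam m <= lam i by apply: imax; rewrite mA.
    have yi : t y < lam i := lt_le_trans m1 mi.
    have yj : t y < lam j := lt_trans (lt_trans m1 m2) jx.
    by rewrite nmulr_rgt0 subr_lt0.
  have mj : lam j <= lam m by apply: jmin; rewrite mA.
  have yj : lam j < t y := le_lt_trans mj m2.
  have yi : lam i < t y := lt_trans ix (lt_trans m1 m2).
  by rewrite mulr_gt0 ?subr_gt0.
have : 0 < (lprod t B).[lam i] * (lprod t B).[lam j] by rewrite mulr_gt0 // H.
have rest : 0 < \prod_(y in B | y != x) ((1 - lam i / t y) * (1 - lam j / t y)).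
  by apply: prodr_gt0 => z /andP[zB zx]; apply: away.
rewrite !lprodE -big_split /= (bigD1 x) //= (pmulr_lgt0 _ rest).
have -> : (1 - lam i / t x) * (1 - lam j / t x) =
      (t x - lam i) * (t x - lam j) / t x ^+ 2 by field.
rewrite pmulr_lgt0 ?invr_gt0 ?t2 // pmulr_rgt0 ?subr_gt0 //.
by rewrite ltNge ltW.
Qed.

Definition outer : {set 'I_M} := [set x | (x \notin shared lam t) && outward x].

Definition valid Q : bool :=
  (shared lam t \subset Q) && [forall i in A, 0 < r i * (lprod t Q).[lam i]].

Lemma lprod_symdiff Q Q' (y : R) : (lprod t Q).[y] * (lprod t Q').[y] =
  (lprod t (Q :&: Q')).[y] ^+ 2 * (lprod t (symdiff Q Q')).[y].
Proof.
rewrite (lprod_setID t Q Q') (lprod_setID t Q' Q) (lprod_setID t (symdiff Q Q') Q).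
have -> : symdiff Q Q' :&: Q = Q :\: Q'.
  by apply/finset.setP => x; rewrite !inE; case: (x \in Q); case: (x \in Q').
have -> : symdiff Q Q' :\: Q = Q' :\: Q.
  by apply/finset.setP => x; rewrite !inE; case: (x \in Q); case: (x \in Q').
by rewrite [Q' :&: Q]finset.setIC !hornerM; ring.
Qed.

Lemma lprod_active_neq0 B i : i \in A -> (lprod t B).[lam i] != 0.
Proof.
move=> iA; apply/negP => /(root_lprodP t0)[x _ /eqP].
by rewrite eq_sym (negPf (t_neq_active x iA)).
Qed.

(** In the product of the values of two configurations the common factors are squared, so
    the signs agree exactly when the product over the symmetric difference is positive
    at the active eigenvalues; then [lprod_pos] applies. *)
Lemma valid_symdiff Q0 Q : valid Q0 -> valid Q = (symdiff Q0 Q \subset outer).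
Proof.
move=> /andP[s0 /forall_inP v0].
have sgn i : i \in A -> (0 < r i * (lprod t Q).[lam i]) = (0 < (lprod t (symdiff Q0 Q)).[lam i]).
  move=> iA; rewrite -(pmulr_rgt0 _ (v0 i iA)).
  have -> : r i * (lprod t Q0).[lam i] * (r i * (lprod t Q).[lam i]) =
     r i ^+ 2 * ((lprod t Q0).[lam i] * (lprod t Q).[lam i]) by ring.
  rewrite lprod_symdiff mulrA pmulr_rgt0 // -exprMn exprn_even_gt0 //=.
  by rewrite mulf_neq0 ?lprod_active_neq0 //; rewrite inE in iA.
apply/andP/fintype.subsetP => [[sQ /forall_inP vQ] x xd|H].
  rewrite inE; apply/andP; split.
    apply/negP => xs; move: xd; rewrite in_symdiff.
    by rewrite (fintype.subsetP s0 x xs) (fintype.subsetP sQ x xs).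
  by move: x xd; apply/lprod_pos => i iA; rewrite -sgn // vQ.
split.
  apply/fintype.subsetP => x xs; apply/negPn/negP => xQ.
  have : x \in outer by apply: H; rewrite in_symdiff (fintype.subsetP s0 x xs) (negPf xQ).
  by rewrite inE xs.
apply/forall_inP => i iA; rewrite sgn //; apply/lprod_pos: i iA => x /H.
by rewrite inE => /andP[].
Qed.

Lemma card_valid Q0 : valid Q0 -> #|[set Q | valid Q]%SET| = (2 ^ #|outer|)%N.
Proof.
move=> v0; rewrite -card_powerset -[RHS](card_imset _ (inv_inj (symdiffK Q0))).
apply: eq_card => Q; have -> : (Q \in [set Q | valid Q]%SET) = valid Q by rewrite inE.
rewrite (valid_symdiff Q v0).
apply/idP/imsetP => [H|[B]].
  by exists (symdiff Q0 Q); rewrite ?symdiffK // inE.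
by rewrite inE => BO ->; rewrite symdiffK.
Qed.

(** The expansion [active_expansion] at one of the zeros of [W]. *)
Lemma active_sum i : i \in A -> lam i * (\sum_x rho lam r t x / (t x - lam i)) = 1.
Proof.
move=> iA; have := active_expansion l0 t0 tI MA tE.
move/(congr1 (fun q : {poly R} => q.[lam i])); rewrite lprod_eq0 // hornerD hornerN hornerM hornerX tE.
set e := (lprod t [set: 'I_M]).[lam i]; have e0 : e != 0 by apply: lprod_active_neq0.
rewrite horner_sum => /esym/eqP; rewrite subr_eq0 => /eqP H.
apply: (mulIf e0); rewrite mul1r [RHS]H -mulrA; congr (_ * _).
rewrite mulr_suml; apply: eq_bigr => x _; rewrite hornerZ.
have xT : x \in [set: 'I_M]%SET by rewrite inE.
have tx : t x - lam i != 0 by rewrite subr_eq0 t_neq_active.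
rewrite /e (lprod_D1 t xT) hornerM linE; have := t0 x.
move: (rho _ _ _ _) (lprod _ _).[_] (t x) tx => h q y yl y0.
by field; rewrite y0 yl.
Qed.

(** If no zero were below the lowest eigenvalue, all terms of [active_sum] would have
    the sign of [lam ord0], which is negative. *)
Lemma exists_below : ord0 \in A -> exists x, t x < lam ord0.
Proof.
move=> oA; apply: contrapT => H; have := active_sum oA.
have S0 : 0 <= \sum_x rho lam r t x / (t x - lam ord0).
  apply: sumr_ge0 => x _; rewrite divr_ge0 ?(ltW (rho_gt0 l0 lamI al0 t0 tI tE x)) // subr_ge0 leNgt.
  by apply/negP => tx; apply: H; exists x.
move=> E; have : lam ord0 * \sum_x rho lam r t x / (t x - lam ord0) <= 0.
  by rewrite mulr_le0_ge0 // ltW.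
by rewrite E leNgt ltr01.
Qed.

Lemma exists_beyond : ord_max \in A -> exists x, lam ord_max < t x.
Proof.
move=> oA; apply: contrapT => H; have := active_sum oA.
have S0 : \sum_x rho lam r t x / (t x - lam ord_max) <= 0.
  apply: sumr_le0 => x _; rewrite mulr_ge0_le0 ?(ltW (rho_gt0 l0 lamI al0 t0 tI tE x)) // invr_le0 subr_le0 leNgt.
  by apply/negP => tx; apply: H; exists x.
move=> E; have : lam ord_max * \sum_x rho lam r t x / (t x - lam ord_max) <= 0.
  by rewrite mulr_ge0_le0 // ltW.
by rewrite E leNgt ltr01.
Qed.

Definition lower : {set 'I_M} := [set x | (x \notin shared lam t) && [forall i in A, t x < lam i]].
Definition upper : {set 'I_M} := [set x | (x \notin shared lam t) && [forall i in A, lam i < t x]].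

Lemma card_le1 B : (forall x y, x \in B -> y \in B -> t x < t y -> False) ->
  (#|B| <= 1)%N.
Proof.
move=> H; apply/card_le1_eqP => x y xB yB; apply: tI.
by case: (ltgtP (t x) (t y)) => // /H; case.
Qed.

(** Two zeros below all active eigenvalues would be separated by one of them. If the
    lowest eigenvalue is inactive it is itself a zero, and any further zero below the
    active ones would again be separated from it. *)
Lemma card_lower : #|lower| = (ord0 \in A).
Proof.
have le1 : (#|lower| <= 1)%N.
  apply: card_le1 => x y _; rewrite inE => /andP[_ /forall_inP yl] /between[i iA].
  by move=> /andP[_]; rewrite ltNge ltW // yl.
case: (boolP (ord0 \in A)) => oA.
  apply/eqP; rewrite eqn_leq le1 /= card_gt0; apply/set0Pn.
  have [x tx] := exists_below oA; exists x; rewrite inE; apply/andP; split.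
    apply/negP => /sharedP[j _ xj]; move: tx; rewrite xj ltNge lam_le //.
  by apply/forall_inP => i _; apply: lt_le_trans tx _; apply: lam_le.
apply/eqP; rewrite cards_eq0; apply/eqP/finset.setP => x; rewrite !inE; apply/negP.
move=> /andP[xs /forall_inP xl]; have [x0 x0E] := inactive_zero oA.
have : t x != lam ord0.
  by apply: contra xs => /eqP xE; apply/existsP; exists ord0; rewrite xE.
rewrite -x0E neq_lt => /orP[|] /between[i iA /andP[i1 i2]].
  by move: i2; rewrite x0E ltNge lam_le.
by move: i2; rewrite ltNge ltW // xl.
Qed.

Lemma card_upper : #|upper| = (ord_max \in A).
Proof.
have le1 : (#|upper| <= 1)%N.
  apply: card_le1 => x y; rewrite inE => /andP[_ /forall_inP xl] _ /between[i iA].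
  by move=> /andP[+ _]; rewrite ltNge ltW // xl.
case: (boolP (ord_max \in A)) => oA.
  apply/eqP; rewrite eqn_leq le1 /= card_gt0; apply/set0Pn.
  have [x tx] := exists_beyond oA; exists x; rewrite inE; apply/andP; split.
    apply/negP => /sharedP[j _ xj]; move: tx; rewrite xj ltNge lam_le // -ltnS ltn_ord //.
  by apply/forall_inP => i _; apply: le_lt_trans tx; apply: lam_le; rewrite -ltnS ltn_ord.
apply/eqP; rewrite cards_eq0; apply/eqP/finset.setP => x; rewrite !inE; apply/negP.
move=> /andP[xs /forall_inP xl]; have [x0 x0E] := inactive_zero oA.
have : t x != lam ord_max.
  by apply: contra xs => /eqP xE; apply/existsP; exists ord_max; rewrite xE.
rewrite -x0E neq_lt => /orP[|] /between[i iA /andP[i1 i2]].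
  by move: i1; rewrite ltNge ltW // xl.
by move: i1; rewrite x0E ltNge lam_le // -ltnS ltn_ord.
Qed.

Lemma card_outer : #|outer| = ((ord0 \in A) + (ord_max \in A))%N.
Proof.
rewrite -card_lower -card_upper -cardsUI; have -> : lower :&: upper = finset.set0.
  apply/finset.setP => x; rewrite !inE; apply/negP.
  move=> /andP[/andP[_ /forall_inP xl] /andP[_ /forall_inP xu]].
  have : (0 < #|A|)%N by rewrite -MA; case: (x) => m /=; apply: leq_ltn_trans.
  move=> /card_gt0P[i iA]; have := xl i iA; by rewrite ltNge ltW // xu.
rewrite cards0 addn0; apply: eq_card => x; rewrite !inE /outward.
by case: [exists j, _].
Qed.

(** The norming constant forced at an active eigenvalue, as the eigenfunction has value
    [r i] at [a]. *)
Definition kappa (a : R) Q i : R :=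
  (expR (- a / 2) * (lprod t Q).[lam i]) ^+ 2 / r i ^+ 2.

(** The squares agree at the active eigenvalues, and validity fixes the signs; so the
    two products agree at all eigenvalues and at [0], hence everywhere. *)
Lemma kappa_inj a Q Q' : valid Q -> valid Q' ->
  (forall i, i \in A -> kappa a Q i = kappa a Q' i) -> Q = Q'.
Proof.
move=> /andP[sQ /forall_inP vQ] /andP[sQ' /forall_inP vQ'] H.
have sM B : (size (lprod t B) <= #|[set: 'I_N]%SET|.+1)%N.
  have MN : (M <= N)%N by rewrite {1}MA -[leqRHS](card_ord N) max_card.
  rewrite size_lprod // ltnS cardsT card_ord (leq_trans _ MN) //.
  by rewrite -[leqRHS](card_ord M) max_card.
have LE : lprod t Q = lprod t Q'.
  apply: (interpolation l0 lamI) (sM Q) (sM Q') _ _; first by rewrite !lprod_at0.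
  move=> i _; case: (boolP (i \in A)) => iA; last first.
    have [x xi] := inactive_zero iA.
    have xs : x \in shared lam t by apply/sharedP; exists i.
    have xQ := fintype.subsetP sQ x xs; have xQ' := fintype.subsetP sQ' x xs.
    by rewrite -xi !lprod_eq0.
  have ri : r i != 0 by rewrite inE in iA.
  have e0 : expR (- a / 2) ^+ 2 != 0 by rewrite expf_neq0 // gt_eqF ?expR_gt0.
  have := H i iA; rewrite /kappa => /mulIf; rewrite invr_eq0 sqrf_eq0 ri => /(_ isT).
  rewrite !exprMn => /(mulfI e0) /eqP; rewrite eqf_sqr => /orP[/eqP//|/eqP E].
  by have := vQ i iA; rewrite E mulrN oppr_gt0 ltNge ltW // vQ'.
apply/finset.setP => x; apply/idP/idP => xQ.
  have : root (lprod t Q') (t x) by rewrite -LE; apply/rootP/lprod_eq0.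
  by move=> /(root_lprodP t0)[y yQ /tI ->].
have : root (lprod t Q) (t x) by rewrite LE; apply/rootP/lprod_eq0.
by move=> /(root_lprodP t0)[y yQ /tI ->].
Qed.

End Validity.

(** * Topology of a union of boxes *)

Section Boxes.
Context {R : realType}.

Lemma avoid_finite (vals : seq R) (x y : R) : x < y ->
  exists2 w, x < w < y & w \notin vals.
Proof.
move=> xy; suff [x' [y' [xx' x'y' y'y H]]] : exists x' y', [/\ x <= x', x' < y', y' <= y &
    forall v, v \in vals -> ~~ (x' < v < y')].
  exists ((x' + y') / 2); first by rewrite (le_lt_trans xx') ?(lt_le_trans _ y'y) // midf_lt.
  by apply/negP => /H; rewrite !midf_lt.
elim: vals => [|v vals [x' [y' [xx' x'y' y'y H]]]]; first by exists x, y.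
have [xvy|xvy] := boolP (x' < v < y'); last first.
  by exists x', y'; split => // w; rewrite inE => /predU1P[->|/H].
have /andP[xv vy] := xvy.
exists x', v; split => //; first exact: le_trans (ltW vy) y'y.
move=> w; rewrite inE => /predU1P[->|/H]; first by rewrite ltxx andbF.
by apply: contra => /andP[-> wv]; rewrite (lt_trans wv).
Qed.

(** The image is an interval contained in a finite set. *)
Lemma connected_finite_range (T : topologicalType) (C : set T) (f : T -> R) (vals : seq R) :
  connected C -> continuous f -> (forall x, C x -> f x \in vals) ->
  forall x y, C x -> C y -> f x = f y.
Proof.
move=> cC cf fv.
have /connected_intervalP itv : connected (f @` C).
  by apply: connected_continuous_connected cC _; apply: continuous_subspaceT.
have main x y : C x -> C y -> ~ f x < f y.
  move=> Cx Cy fxy; have [w /andP[xw wy] /negP wn] := avoid_finite vals fxy.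
  have Hx : (f @` C) (f x) by exists x.
  have Hy : (f @` C) (f y) by exists y.
  have [|q Cq qw] := itv _ _ Hx Hy w; first by rewrite !ltW.
  by apply: wn; rewrite -qw fv.
move=> x y Cx Cy; case: (ltgtP (f x) (f y)) => // H; by case: (main _ _ _ _ H).
Qed.

Lemma continuous_rV (T : topologicalType) d (f : T -> 'rV[R]_d) :
  (forall j, continuous (fun x => f x 0 j)) -> continuous f.
Proof.
move=> H x; apply/cvg_ballP => e e0.
have : \forall y \near x, forall j, ball (f x 0 j) e (f y 0 j).
  apply: filter_forall => j; have /cvg_ballP := H j x; exact.
by apply: filterS => y Hy; split=> // i j; rewrite (ord1 i).
Qed.

Variables (N : nat) (lam : 'I_N -> R) (A : {set 'I_N}).

(** The shape of each component of the set of spectral data: the entries in [A] are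
    forced, the others are free positive numbers. *)
Definition box (kap : 'I_N -> R) : set 'rV[R]_(N + N) :=
  [set s | [/\ forall i, lsubmx s 0 i = lam i, forall i, i \in A -> rsubmx s 0 i = kap i &
               forall i, i \notin A -> 0 < rsubmx s 0 i]].

(** A box is convex. *)
Lemma box_connected kap : connected (box kap).
Proof.
have [[x0 Bx0]|no] := pselect (exists x, box kap x); last first.
  have -> : box kap = set0 by apply/seteqP; split=> // x Bx; apply: no; exists x.
  exact: connected0.
pose seg y := (fun u : R => x0 + u *: (y - x0)) @` `[0, 1].
have -> : box kap = \bigcup_(y in box kap) seg y.
  apply/seteqP; split=> [y By|z [y [y1 y2 y3] [u]]].
    by exists y => //; exists 1; [rewrite /= in_itv /= ler01 lexx|rewrite scale1r addrC subrK].
  have [x1 x2 x3] := Bx0; rewrite /= in_itv /= => /andP[u0 u1] <-.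
  have lE i : lsubmx (x0 + u *: (y - x0)) 0 i =
      lsubmx x0 0 i + u * (lsubmx y 0 i - lsubmx x0 0 i) by rewrite !mxE.
  have rE i : rsubmx (x0 + u *: (y - x0)) 0 i =
      rsubmx x0 0 i + u * (rsubmx y 0 i - rsubmx x0 0 i) by rewrite !mxE.
  split=> i.
  - by rewrite lE x1 y1 subrr mulr0 addr0.
  - by move=> iA; rewrite rE x2 // y2 // subrr mulr0 addr0.
  - move=> iA; rewrite rE; have := x3 i iA; have := y3 i iA.
    move: (rsubmx y 0 i) (rsubmx x0 0 i) => v w v0 w0.
    have -> : w + u * (v - w) = (1 - u) * w + u * v by ring.
    have [->|un] := eqVneq u 0; first by rewrite subr0 mul1r mul0r addr0.
    by rewrite ltr_wpDl // ?mulr_ge0 ?subr_ge0 ?(ltW w0) // mulr_gt0 // lt0r un.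
apply: bigcup_connected.
  exists x0 => y _; exists 0; first by rewrite /= in_itv /= lexx ler01.
  by rewrite scale0r addr0.
move=> y _; apply: connected_continuous_connected; first exact: segment_connected.
apply: continuous_subspaceT => u; apply: cvgD; first exact: cvg_cst.
exact: scalel_continuous.
Qed.

Lemma rsubmx_continuous (i : 'I_N) : continuous (fun s : 'rV[R]_(N + N) => rsubmx s 0 i).
Proof.
rewrite (_ : (fun s => _) = (fun s : 'rV[R]_(N + N) => s 0 (rshift N i))).
  exact: coord_continuous.
by apply/funext => s; rewrite mxE.
Qed.

Lemma box_manifold kap : manifold #|~: A| (box kap).
Proof.
move=> x0 Bx0.
pose h (s : 'rV[R]_(N + N)) : 'rV[R]_#|~: A| := \row_j rsubmx s 0 (enum_val j).
pose idx (i : 'I_N) : option 'I_#|~: A| := [pick j | enum_val j == i].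
pose g (v : 'rV[R]_#|~: A|) : 'rV[R]_(N + N) :=
  row_mx (\row_i lam i) (\row_i if idx i is Some j then v 0 j else kap i).
have idxE j : idx (enum_val j) = Some j.
  by rewrite /idx; case: pickP => [j' /eqP/enum_val_inj ->//|/(_ j)]; rewrite eqxx.
have idxN i : i \in A -> idx i = None.
  move=> iA; rewrite /idx; case: pickP => // j /eqP ji.
  by have := enum_valP j; rewrite ji inE iA.
have idxS i : i \notin A -> exists j : 'I_#|~: A|, i = enum_val j.
  move=> iA; have iA' : i \in ~: A by rewrite inE.
  by exists (enum_rank_in iA' i); rewrite enum_rankK_in.
have gl v i : lsubmx (g v) 0 i = lam i by rewrite row_mxKl mxE.
have gr v i : rsubmx (g v) 0 i = if idx i is Some j then v 0 j else kap i.
  by rewrite row_mxKr mxE.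
exists setT, [set v | forall j, 0 < v 0 j], h, g; split; first split.
- exact: openT.
- by [].
- rewrite openE => v Hv.
  have K j : \forall w \near v, 0 < (w : 'rV[R]_#|~: A|) 0 j.
    have cv := @coord_continuous R 1 #|~: A| 0 j v.
    by apply: (cv [set y | 0 < y]); apply: lt_nbhsr; apply: Hv.
  exact: (@filter_forall _ _ _ _ _ K).
split; first split.
- by move=> s [[_ _ s3] _] j /=; rewrite mxE s3 //; have := enum_valP j; rewrite inE.
- move=> v Hv; split=> //; split=> i; first by rewrite gl.
    by move=> /idxN iN; rewrite gr iN.
  by move=> /idxS[j ->]; rewrite gr idxE Hv.
- move=> s [[s1 s2 _] _]; rewrite -[RHS]hsubmxK; congr row_mx; apply/rowP => i; rewrite mxE ?s1 //.
  case: (boolP (i \in A)) => iA; first by rewrite idxN // s2.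
  by have [j ->] := idxS i iA; rewrite idxE mxE.
- by move=> v _; apply/rowP => j; rewrite mxE gr idxE.
split; apply: continuous_subspaceT; apply: continuous_rV => j.
- rewrite (_ : (fun s => _) = (fun s : 'rV[R]_(N + N) => rsubmx s 0 (enum_val j))).
    exact: rsubmx_continuous.
  by apply/funext => s; rewrite mxE.
- case: (split_ordP j) => i ->.
    rewrite (_ : (fun s => _) = (fun=> lam i)); first exact: cst_continuous.
    by apply/funext => v; rewrite row_mxEl mxE.
  case E : (idx i) => [j'|].
    rewrite (_ : (fun s => _) = (fun v : 'rV[R]_#|~: A| => v 0 j')); first exact: coord_continuous.
    by apply/funext => v; rewrite row_mxEr mxE E.
  rewrite (_ : (fun s => _) = (fun=> kap i)); first exact: cst_continuous.
  by apply/funext => v; rewrite row_mxEr mxE E.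
Qed.

Variables (J : finType) (B : {set J}) (kap : J -> 'I_N -> R).
Hypothesis kap_inj : forall b b', b \in B -> b' \in B ->
  (forall i, i \in A -> kap b i = kap b' i) -> b = b'.

Definition boxes : set 'rV[R]_(N + N) := \bigcup_(b in [set` B]) box (kap b).

Lemma box_point b : box (kap b) (row_mx (\row_i lam i) (\row_i if i \in A then kap b i else 1)).
Proof.
split=> i; first by rewrite row_mxKl mxE.
  by move=> iA; rewrite row_mxKr mxE iA.
by move=> iA; rewrite row_mxKr mxE (negPf iA).
Qed.

Lemma box_disjoint b b' s : b \in B -> b' \in B -> box (kap b) s -> box (kap b') s -> b = b'.
Proof.
move=> bB b'B [_ H _] [_ H' _]; apply: kap_inj => // i iA.
by rewrite -H // H'.
Qed.

(** The forced entries are continuous and take finitely many values on the union, so they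
    are constant on a connected part of it. *)
Lemma component_box b s : b \in B -> box (kap b) s ->
  connected_component boxes s = box (kap b).
Proof.
move=> bB Bs; apply/seteqP; split; last first.
  apply: connected_component_max => //; last exact: box_connected.
  by move=> y By; exists b.
have bs : boxes s by exists b.
move=> y Cy; have [b' b'B By] := connected_component_sub Cy.
have Cs := connected_component_refl bs.
suff -> : b = b' by [].
apply: kap_inj => // i iA; have [_ sE _] := Bs; have [_ yE _] := By.
rewrite -sE // -yE //.
apply: (@connected_finite_range _ (connected_component boxes s) (fun s => rsubmx s 0 i)
   [seq kap c i | c <- enum B]) => //.
- exact: component_connected.
- exact: rsubmx_continuous.
- move=> w /connected_component_sub[c cB [_ wE _]].
  by rewrite wE //; apply: map_f; rewrite mem_enum.
Qed.

Lemma boxes_disjoint_manifolds : disjoint_manifolds #|B| #|~: A| boxes.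
Proof.
split; last first.
  by move=> s [b bB Bs]; rewrite (component_box bB Bs); apply: box_manifold.
have [b0 b0B|B0] := pickP [pred b | b \in B]; last first.
  have -> : boxes = set0 by apply/seteqP; split=> // s [b /= bB]; have := B0 b; rewrite /= bB.
  have -> : #|B| = 0%N by apply: eq_card0 => b; exact: B0.
  by rewrite image_set0 II0.
pose f m := box (kap (nth b0 (enum B) m)).
have nB m : (m < #|B|)%N -> nth b0 (enum B) m \in B.
  by rewrite cardE => mB; rewrite -mem_enum mem_nth.
have -> : connected_component boxes @` boxes = f @` `I_#|B|.
  apply/seteqP; split=> [C [s [b bB Bs] <-]|C [m mB <-]].
    rewrite (component_box bB Bs); exists (index b (enum B)).
      by rewrite /= cardE index_mem mem_enum.
    by rewrite /f nth_index // mem_enum.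
  have bB := nB m mB; have Bp := box_point (nth b0 (enum B) m).
  by exists (row_mx (\row_i lam i) (\row_i if i \in A then kap (nth b0 (enum B) m) i else 1));
    [exists (nth b0 (enum B) m)|rewrite (component_box bB Bp)].
apply: inj_card_eq => m m'; rewrite !inE => mB m'B E.
have := box_point (nth b0 (enum B) m); rewrite -/(f m) E => H.
have := box_disjoint (nB _ mB) (nB _ m'B) (box_point _) H.
by move=> /eqP; rewrite nth_uniq -?cardE ?enum_uniq // => /eqP.
Qed.

End Boxes.

(** * The set of spectral data *)

Section SpectralSet.
Context {R : realType}.

(** Both families list the same set in increasing order. *)
Lemma increasing_unique N (l l' : 'I_N -> R) :
  (forall i j : 'I_N, (i < j)%N -> l i < l j) -> (forall i j : 'I_N, (i < j)%N -> l' i < l' j) ->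
  (forall i, exists j, l i = l' j) -> (forall i, exists j, l' i = l j) -> forall i, l i = l' i.
Proof.
move=> inc inc' H H'.
have so (f : 'I_N -> R) : (forall i j : 'I_N, (i < j)%N -> f i < f j) ->
    sorted <%R [seq f i | i <- enum 'I_N].
  move=> Hf; rewrite sorted_map.
  have : sorted ltn [seq val i | i <- enum 'I_N] by rewrite val_enum_ord iota_ltn_sorted.
  by rewrite sorted_map; apply: sub_sorted => i j; apply: Hf.
have E : [seq l i | i <- enum 'I_N] = [seq l' i | i <- enum 'I_N].
  apply: (lt_sorted_eq (so _ inc) (so _ inc')) => y; apply/mapP/mapP => -[i _ ->].
    by have [j ->] := H i; exists j; rewrite ?mem_enum.
  by have [j ->] := H' i; exists j; rewrite ?mem_enum.
by move=> i; move/eq_in_map: E; apply; rewrite mem_enum.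
Qed.

Variables (n : nat).
Local Notation N := n.+1.
Variables (a : R) (lam : 'I_N -> R) (r : 'I_N -> R).
Let u i : R[i] := (r i)%:C.

Lemma interior_value p : interior_data p a lam u -> forall i,
  r i = (right_value p a).[lam i] / Num.sqrt (lam i * (norming (nodes p)).[lam i]).
Proof. by move=> [_ ud] i; have := ud i; rewrite eigenfunction_real => /complexI. Qed.

Lemma interior_sqr p : interior_data p a lam u -> forall i,
  (right_value p a).[lam i] ^+ 2 = r i ^+ 2 * (lam i * (norming (nodes p)).[lam i]).
Proof.
move=> id i; have [eig _] := id; have [l0 WE] := eigenvalues_charpoly eig.
have g0 := norming_pos l0 i WE; rewrite (interior_value id) expr_div_n sqr_sqrtr ?(ltW g0) //.
by rewrite divfK // gt_eqF.
Qed.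

Lemma interior_sign p : interior_data p a lam u -> forall i, r i != 0 ->
  0 < r i * (right_value p a).[lam i].
Proof.
move=> id i ri; have [eig _] := id; have [l0 WE] := eigenvalues_charpoly eig.
have g0 := norming_pos l0 i WE; have s0 : 0 < Num.sqrt (lam i * (norming (nodes p)).[lam i]) by rewrite sqrtr_gt0.
have E : (right_value p a).[lam i] = r i * Num.sqrt (lam i * (norming (nodes p)).[lam i]).
  by rewrite (interior_value id) divfK // gt_eqF.
by rewrite E mulrA -expr2 mulr_gt0 // exprn_even_gt0.
Qed.

Lemma interior_vanish p : interior_data p a lam u -> forall i, r i = 0 ->
  (right_value p a).[lam i] = 0 /\ (left_value p a).[lam i] = 0.
Proof.
move=> id i ri; have [eig _] := id; have [l0 WE] := eigenvalues_charpoly eig.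
have phi0 : (right_value p a).[lam i] = 0.
  by apply/eqP; rewrite -sqrf_eq0 interior_sqr // ri expr0n mul0r.
by split=> //; apply/eqP; rewrite -(vanish_together l0 a i WE) phi0.
Qed.

Variable p0 : mpair R.
Hypotheses (id0 : interior_data p0 a lam u) (al : 1 - \sum_i r i ^+ 2 != 0)
  (lneg : lam ord0 < 0) (lpos : 0 < lam ord_max).

(** A pair with given interior data is the same as a distribution of the zeros of
    the Green function at [a] between the two half lines that is compatible with
    the signs of the data, together with a free positive norming constant for each
    eigenfunction vanishing at [a]. *)
Lemma spectral_set_boxes : exists (M : nat) (B : {set {set 'I_M}})
    (kap : {set 'I_M} -> 'I_N -> R),
  [/\ spectral_set a lam u = boxes lam (active r) B kap,
      forall b b', b \in B -> b' \in B ->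
        (forall i, i \in active r -> kap b i = kap b' i) -> b = b',
      B != finset.set0 &
      #|B| = (2 ^ ((ord0 \in active r) + (ord_max \in active r)))%N].
Proof.
have [eig0 _] := id0; have [inc spec0] := eig0; have lamI := increasing_inj inc.
have [l0 WE0] := eigenvalues_charpoly eig0.
have PE p : interior_data p a lam u -> right_value p a * left_value p a = green_num lam r.
  move=> id; have [eig _] := id; have [_ WE] := eigenvalues_charpoly eig.
  exact (product_green l0 lamI WE (interior_sqr id)).
have al0 := green_pos l0 WE0 al (PE _ id0).
have [M [t [t0 tI MA tE]]] := green_zeros l0 lamI al0.
have inactive0 j : j \notin active r -> r j = 0 by rewrite inE negbK => /eqP.
have inactive_zero j : j \notin active r -> exists x, t x = lam j.
  move=> jA.
  have /dvdpP[f fE] : lprod lam (~: active r) %| right_value p0 a.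
    apply: dvdp_lprod => // i; rewrite inE => /inactive0 /(interior_vanish id0)[H _].
    exact/rootP.
  have /dvdpP[h hE] : lprod lam (~: active r) %| left_value p0 a.
    apply: dvdp_lprod => // i; rewrite inE => /inactive0 /(interior_vanish id0)[_ H].
    exact/rootP.
  have V0 := lprod_neq0 lam (~: active r).
  have E : green_red lam r = f * h * lprod lam (~: active r).
    apply: (mulfI V0); rewrite -green_num_red // -(PE _ id0) fE hE; ring.
  have : root (green_red lam r) (lam j).
    by rewrite E; apply/rootP; rewrite hornerM lprod_eq0 ?mulr0 // inE.
  by rewrite tE => /(root_lprodP t0)[x _ ->]; exists x.
(* The zeros of [phi_+ (., a)] for an arbitrary pair with the given data. *)
have config p : interior_data p a lam u -> exists2 Q, valid lam r t Q &
    right_value p a = expR (- a / 2) *: lprod t Q.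
  move=> id.
  have [|Q sQ] := factor_of_product l0 lamI t0 tI tE inactive_zero (PE p id).
    by move=> j /inactive0; apply: interior_vanish.
  rewrite /right_value value0 -/(right_value p a) => fE; exists Q => //.
  apply/andP; split=> //; apply/forall_inP => i; rewrite inE => ri.
  have := interior_sign id ri; rewrite fE hornerZ mulrCA pmulr_rgt0 ?expR_gt0 //.
have [Q0 v0 _] := config _ id0.
exists M, [set Q | valid lam r t Q]%SET, (kappa lam r t a); split.
- apply/seteqP; split=> s.
    move=> [p id [eig' sn]]; have [eig _] := id.
    have [_ WE] := eigenvalues_charpoly eig.
    have lE : forall i, lsubmx s 0 i = lam i.
      have [inc' spec'] := eig'; have [_ spec] := eig.
      have img (l l' : 'I_N -> R) : [set z | Defs.eigenvalue p z] = [set (l i)%:C | i in [set: 'I_N]]%classic ->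
          [set z | Defs.eigenvalue p z] = [set (l' i)%:C | i in [set: 'I_N]]%classic ->
          forall i, exists j, l i = l' j.
        move=> H H' i; have : [set (l i)%:C | i in [set: 'I_N]]%classic (l i)%:C by exists i.
        by rewrite -H H' => -[j _ /complexI E]; exists j.
      apply: increasing_unique => //; first exact: img spec' spec.
      exact: img spec spec'.
    have [Q vQ fE] := config _ id.
    exists Q; first by rewrite /= inE.
    split=> // i iA; rewrite sn lE gamma2E.
      have ri : r i != 0 by rewrite inE in iA.
      have := interior_sqr id i; rewrite fE hornerZ /kappa => ->.
      by rewrite mulrAC divff ?mul1r // expf_neq0.
    exact (norming_pos l0 i WE).
  move=> [Q /=]; rewrite inE => vQ [s1 s2 s3].
  have /andP[sQ /forall_inP sg] := vQ.
  have [p [pW pR pL pn]] := @pair_of_normings R N lam r l0 lamI al0 M t t0 tI MA tE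
    inactive_zero a Q (fun j => rsubmx s 0 j) isT sQ s3.
  have eig : eigenvalues p lam by apply: charpoly_eigenvalues.
  have P : right_value p a * left_value p a = green_num lam r.
    rewrite pR pL (green_num_shared l0 lamI t0 tI tE inactive_zero) -(lprod_coshared sQ).
    rewrite -!mul_polyC mulrACA -polyCM -expRD -mulrDl addNr mul0r expR0 polyC1 mul1r //.
  have gpos i := norming_pos l0 i pW.
  have sq i : (right_value p a).[lam i] ^+ 2 = r i ^+ 2 * (lam i * (norming (nodes p)).[lam i]).
    have w0 := lprod_D1_neq0 l0 lamI [set: 'I_N]%SET i.
    apply: (mulIf w0); rewrite -(product_at l0 a i pW) P green_num_at //; ring.
  have idp : interior_data p a lam u.
    split=> // i; rewrite eigenfunction_real /u; congr (_%:C).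
    have s0 : 0 < Num.sqrt (lam i * (norming (nodes p)).[lam i]) by rewrite sqrtr_gt0.
    rewrite -/(right_value p a).
    case: (boolP (i \in active r)) => iA; last first.
      have /eqP := sq i; rewrite (inactive0 i iA) expr0n mul0r sqrf_eq0 => /eqP ->.
      by rewrite mul0r.
    (* The square of the value is prescribed; validity of [Q] decides the sign. *)
    apply: (mulIf (x := Num.sqrt (lam i * (norming (nodes p)).[lam i]))); first by rewrite gt_eqF.
    rewrite divfK ?gt_eqF //; apply/eqP.
    have : (right_value p a).[lam i] ^+ 2 = (r i * Num.sqrt (lam i * (norming (nodes p)).[lam i])) ^+ 2.
      by rewrite sq exprMn sqr_sqrtr // ltW.
    move/eqP; rewrite eqf_sqr eq_sym => /orP[//|/eqP E].
    have := sg i iA; have : (lprod t Q).[lam i] = (right_value p a).[lam i] / expR (- a / 2).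
      by rewrite pR hornerZ mulrC mulKf // gt_eqF ?expR_gt0.
    move=> ->; rewrite E mulNr mulrN oppr_gt0 ltNge => /negP[].
    by rewrite !mulrA -expr2 divr_ge0 ?expR_ge0 // mulr_ge0 ?sqr_ge0 // ltW.
  exists p => //; split.
    have -> : (fun i => lsubmx s 0 i) = lam by apply/funext.
    by [].
  move=> i; rewrite s1 gamma2E; case: (boolP (i \in active r)) => iA; last by rewrite pn.
  have ri : r i != 0 by rewrite inE in iA.
  rewrite s2 // /kappa -hornerZ -pR sq.
  by rewrite mulrAC divff ?mul1r // expf_neq0.
- move=> Q Q'; rewrite !inE => vQ vQ'.
  exact: (kappa_inj l0 inc t0 tI MA tE inactive_zero vQ vQ').
- by apply/set0Pn; exists Q0; rewrite inE.
- rewrite (card_valid l0 inc al0 t0 tI tE v0).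
  by rewrite (card_outer l0 inc lneg lpos al0 t0 tI MA tE inactive_zero).
Qed.

(** The norming constant of an inactive eigenvalue takes infinitely many values. *)
Lemma infinite_pairs : (0 < #|~: active r|)%N ->
  infinite_set [set p : mpair R | interior_data p a lam u].
Proof.
move=> /card_gt0P[j]; rewrite inE => jA fin.
have [M [B [kap [SE _ /set0Pn[b bB] _]]]] := spectral_set_boxes.
pose F p : 'rV[R]_(N + N) := row_mx (\row_i lam i) (\row_i (lam i * gamma2 p (lam i))).
have finS : finite_set (F @` [set p : mpair R | interior_data p a lam u]) by apply: finite_image.
pose f (m : nat) : 'rV[R]_(N + N) :=
  row_mx (\row_i lam i) (\row_i if i \in active r then kap b i else m.+1%:R).
have fS m : (F @` [set p : mpair R | interior_data p a lam u]) (f m).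
  have : spectral_set a lam u (f m).
    rewrite SE; exists b => //; split=> i; first by rewrite row_mxKl mxE.
      by move=> iA; rewrite row_mxKr mxE iA.
    by move=> /negPf iA; rewrite row_mxKr mxE iA ltr0n.
  move=> [p id [_ sn]]; exists p => //; rewrite /F /f; congr row_mx.
  by apply/rowP => i; have := sn i; rewrite row_mxKr row_mxKl !mxE.
have fI : {in [set: nat] &, injective f}.
  move=> m m' _ _ /(congr1 (fun s => rsubmx s 0 j)); rewrite !row_mxKr !mxE (negPf jA).
  by move/eqP; rewrite eqr_nat => /eqP[].
have : finite_set (f @` [set: nat]) by apply: sub_finite_set finS => _ [m _ <-].
rewrite /finite_set => -[c fc]; apply: infinite_nat; exists c.
by apply: card_eq_trans fc; rewrite card_eq_sym; apply: inj_card_eq.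
Qed.

End SpectralSet.

(* N = n.+1; indices are shifted by one, so lambda_1, lambda_N are
   lam ord0, lam ord_max, and lambda_(j0), lambda_(j0+1) are the entries at
   widen_ord (leqnSn n) j0 and lift ord0 j0. *)
Theorem theorem4p7 (R : realType) (a : R) (n k : nat)
    (lam : 'I_n.+1 -> R) (u : 'I_n.+1 -> R[i]) (j0 : 'I_n) :
  (exists p : mpair R, interior_data p a lam u) ->
  1 - \sum_(i < n.+1) Normc.normc (u i) ^+ 2 != 0 ->
  lam (widen_ord (leqnSn n) j0) < 0 < lam (lift ord0 j0) ->
  #|[set i | u i == 0]%SET| = k ->
  (1 <= k)%N ->
  infinite_set [set p : mpair R | interior_data p a lam u] /\
  [/\ (u ord0 = 0 /\ u ord_max = 0 ->
        connected (spectral_set a lam u) /\ manifold k (spectral_set a lam u)),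
      ((u ord0 = 0 /\ u ord_max <> 0) \/ (u ord0 <> 0 /\ u ord_max = 0) ->
        disjoint_manifolds 2 k (spectral_set a lam u)) &
      (u ord0 <> 0 /\ u ord_max <> 0 ->
        disjoint_manifolds 4 k (spectral_set a lam u))].
Proof.
move=> [p0 id0] al /andP[lneg lpos] kE k0.
have [[inc _] ud] := id0.
have [r uE] : exists r : 'I_n.+1 -> R, u = fun i => (r i)%:C.
  by exists (fun i => complex.Re (u i)); apply/funext => i; rewrite ud eigenfunction_real.
rewrite {}uE {ud} in id0 al kE *.
have {}al : 1 - \sum_i r i ^+ 2 != 0.
  rewrite (eq_bigr (fun i => Normc.normc (r i)%:C ^+ 2)) // => i _.
  by rewrite normc_real real_normK ?num_real.
have kA : k = #|~: active r|.
  rewrite -kE; apply: eq_card => i; rewrite !inE negbK.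
  by rewrite -(inj_eq (@complexI R)).
have rP i : reflect ((r i)%:C = 0 :> R[i]) (i \notin active r).
  by rewrite inE negbK; apply: (iffP eqP) => [->//|/complexI].
have mono (i j : 'I_n.+1) : (i <= j)%N -> lam i <= lam j.
  by rewrite leq_eqVlt => /orP[/eqP/val_inj ->//|/inc/ltW].
have lneg0 : lam ord0 < 0 by apply: le_lt_trans lneg; apply: mono.
have lpos0 : 0 < lam ord_max.
  by apply: lt_le_trans lpos _; apply: mono; rewrite -ltnS ltn_ord.
rewrite kA in k0 *; split; first exact: infinite_pairs id0 al lneg0 lpos0 k0.
have [M [B [kap [-> kap_inj B0 cB]]]] := spectral_set_boxes id0 al lneg0 lpos0.
have manifolds := boxes_disjoint_manifolds lam kap_inj.
split.
- move=> [/rP/negPf h0 /rP/negPf h1]; rewrite h0 h1 in cB.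
  have /cards1P[b BE] : #|B| == 1%N by rewrite cB.
  have -> : boxes lam (active r) B kap = box lam (active r) (kap b).
    rewrite BE; apply/seteqP; split=> [s [b' /=]|s Bs]; first by rewrite inE => /eqP ->.
    by exists b; rewrite //= inE.
  by split; [apply: box_connected|apply: box_manifold].
- move=> H; have -> : 2%N = #|B|; last exact: manifolds.
  by rewrite cB; case: H => [[/rP/negPf -> /rP ->]|[/rP -> /rP/negPf ->]].
- move=> H; have -> : 4%N = #|B|; last exact: manifolds.
  by rewrite cB; case: H => /rP -> /rP ->.
Qed.
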